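(* Let $u(t),B(t)\in U_h^{\mathrm{div}}$, $\rho(t)\in F_h$, $p(t)\in Q_h$ be a (time-differentiable) solution, for $t$ in a time interval $[0,T]$, with $\operatorname{div}B(0)\equiv0$, of the semidiscrete method $$\langle \partial_t(\rho u),v\rangle + a_h(\rho u,u,v)-a_h(B,B,v)+\tfrac12 b_h(u\cdot u,\rho,v)=\langle p,\operatorname{div} v\rangle\quad \forall v\in U_h^{\mathrm{div}},$$ $$\langle \partial_t B,C\rangle + a_h(C,B,u)=0\quad\forall C\in U_h^{\mathrm{div}},$$ $$\langle \partial_t\rho,\sigma\rangle + b_h(\sigma,\rho,u)=0\quad\forall \sigma\in F_h,$$ $$\langle \operatorname{div} u,q\rangle=0\quad\forall q\in Q_h.$$ Then the quantities $\int_\Omega\rho\,dx$, $\int_\Omega\rho^2\,dx$, $\int_\Omega (\rho u\cdot u+B\cdot B)\,dx$, and (if $\rho\equiv1$) $\int_\Omega u\cdot B\,dx$ are independent of $t$.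
   Context: $\Omega\subset\mathbb{R}^3$ is a bounded domain with unit normal $n$ on $\partial\Omega$, $\mathcal{T}_h$ is a (conforming simplicial) triangulation of $\Omega$, and $\mathcal{E}_h$ is the set of interior 2-dimensional faces of $\mathcal{T}_h$. For $K\in\mathcal{T}_h$, $P_s(K)$ denotes the polynomials of degree at most $s$ on $K$, and $x$ denotes the position vector. $\langle\cdot,\cdot\rangle$ is the $L^2(\Omega)$ inner product of scalar or vector fields. Set $H_0(\mathrm{div},\Omega)=\{u\in L^2(\Omega)^3: \operatorname{div}u\in L^2(\Omega),\ u\cdot n=0 \text{ on }\partial\Omega\}$, $H_0(\mathrm{curl},\Omega)=\{u\in L^2(\Omega)^3:\nabla\times u\in L^2(\Omega)^3,\ u\times n=0\text{ on }\partial\Omega\}$, $L^2_{\int=0}(\Omega)=\{f\in L^2(\Omega):\int_\Omega f\,dx=0\}$. Fix integers $s\ge 0$ and $m\ge0$ and define the finite element spaces $U_h^{\mathrm{div}}=\{u\in H_0(\mathrm{div},\Omega): u|_K\in P_s(K)^3+xP_s(K)\ \forall K\in\mathcal{T}_h\}$ (Raviart-Thomas), $U_h^{\mathrm{curl}}=\{u\in H_0(\mathrm{curl},\Omega): u|_K\in P_s(K)^3+x\times P_s(K)^3\ \forall K\in\mathcal{T}_h\}$ (Nedelec, first kind), $F_h=\{f\in L^2(\Omega): f|_K\in P_m(K)\ \forall K\in\mathcal{T}_h\}$, $Q_h=\{f\in L^2_{\int=0}(\Omega): f|_K\in P_s(K)\ \forall K\in\mathcal{T}_h\}$. On a face $e=K_1\cap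 K_2\in\mathcal{E}_h$, a piecewise smooth scalar $f$ with $f_i=f|_{K_i}$ has jump $[\![ f]\!]=f_1n_1+f_2n_2$ and average $\{f\}=\frac{f_1+f_2}{2}$, where $n_1$ is the unit normal to $e$ pointing from $K_1$ to $K_2$ and $n_2=-n_1$. Let $\pi_h^{\mathrm{curl}}:L^2(\Omega)^3\to U_h^{\mathrm{curl}}$ and $\pi_h:L^2(\Omega)\to F_h$ be the $L^2$-orthogonal projectors. The trilinear forms $a_h:L^2(\Omega)^3\times L^4(\Omega)^3\times L^4(\Omega)^3\to\mathbb{R}$ and $b_h:L^2(\Omega)\times L^2(\Omega)\times U_h^{\mathrm{div}}\to\mathbb{R}$ are $$a_h(w,u,v)=\int_\Omega w\cdot\nabla\times\pi_h^{\mathrm{curl}}(u\times v)\,dx,$$ $$b_h(f,g,u)=-\sum_{K\in\mathcal{T}_h}\int_K(u\cdot\nabla\pi_hf)\,\pi_hg\,dx+\sum_{e\in\mathcal{E}_h}\int_e u\cdot[\![ \pi_hf]\!]\{\pi_hg\}\,ds.$$ *)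

(* Defs.v *)
From HB Require Import structures.
From mathcomp Require Import all_boot all_order all_algebra.
From mathcomp Require Import all_classical all_reals all_analysis.
From mathcomp Require Import -(notations) mpoly.
Import Order.TTheory GRing.Theory Num.Theory.
Import numFieldNormedType.Exports.

Set Implicit Arguments.
Unset Strict Implicit.
Unset Printing Implicit Defensive.

Local Open Scope classical_set_scope.
Local Open Scope ring_scope.

(* Elements of L^2(Omega) are represented by functions defined on the whole
   space R^3 = 'rV[R]_3; their values outside Omega are irrelevant.           *)

Section VectorCalculus.
Context {R : realType}.
Implicit Types (u v w x : 'rV[R]_3).

Definition dot u v : R := \sum_(i < 3) u 0 i * v 0 i.

Definition enorm u : R := Num.sqrt (dot u u).

(* The indices i + 1 and i + 2 are taken modulo 3 (ring structure of 'I_3). *)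
Definition cross u v : 'rV[R]_3 :=
  \row_(i < 3) (u 0 (i + 1) * v 0 (i + 2%:R) - u 0 (i + 2%:R) * v 0 (i + 1)).

Definition component (i : 'I_3) (F : 'rV[R]_3 -> 'rV[R]_3) : 'rV[R]_3 -> R :=
  fun x => F x 0 i.

Definition partial (i : 'I_3) (f : 'rV[R]_3 -> R) : 'rV[R]_3 -> R :=
  fun x => 'D_(delta_mx 0 i) f x.

Definition grad (f : 'rV[R]_3 -> R) (x : 'rV[R]_3) : 'rV[R]_3 :=
  \row_(i < 3) partial i f x.

Definition curl (F : 'rV[R]_3 -> 'rV[R]_3) (x : 'rV[R]_3) : 'rV[R]_3 :=
  \row_(i < 3) (partial (i + 1) (component (i + 2%:R) F) x
                - partial (i + 2%:R) (component (i + 1) F) x).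

(* C^infinity: all iterated partial derivatives exist and are continuous. *)
Definition smooth (f : 'rV[R]_3 -> R) : Prop :=
  forall s : seq 'I_3, let g := foldr partial f s in
  continuous g /\ forall (i : 'I_3) x, derivable g x (delta_mx 0 i).

Definition smoothv (F : 'rV[R]_3 -> 'rV[R]_3) : Prop :=
  forall i : 'I_3, smooth (component i F).

Definition compactly_supported {V : zmodType} (Omega : set 'rV[R]_3)
    (f : 'rV[R]_3 -> V) : Prop :=
  exists2 C : set 'rV[R]_3, compact C /\ C `<=` Omega
                          & forall x, ~ C x -> f x = 0.

End VectorCalculus.

Section Lebesgue.
Context {R : realType}.
Implicit Types (Omega A : set 'rV[R]_3) (f g : 'rV[R]_3 -> R).
Implicit Types (F G : 'rV[R]_3 -> 'rV[R]_3).

(* The library has no Lebesgue measure on 'rV[R]_3: we transport the product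
   Lebesgue measure of R * R * R along the coordinate bijection pt.           *)
Definition pt (z : R * R * R) : 'rV[R]_3 :=
  \row_(i < 3) [:: z.1.1; z.1.2; z.2]`_i.

Definition leb2 :
    {measure set (measurableTypeR R * measurableTypeR R)%type -> \bar R} :=
  (lebesgue_measure \x lebesgue_measure)%E.

Definition leb3 :
    {measure
      set (measurableTypeR R * measurableTypeR R * measurableTypeR R)%type -> \bar R} :=
  ((lebesgue_measure \x lebesgue_measure) \x lebesgue_measure)%E.

Definition vint A f : R := \int[leb3]_(z in pt @^-1` A) f (pt z).

Definition ae_eq_on {V : Type} A (f g : 'rV[R]_3 -> V) : Prop :=
  {ae leb3, forall z, A (pt z) -> f (pt z) = g (pt z)}.

Definition L2 Omega f : Prop := (f \_ Omega) \o pt \in Lfun leb3 2%:E.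

Definition L2norm Omega f : \bar R :=
  'N[leb3]_(2%:E)[EFin \o ((f \_ Omega) \o pt)].

Definition L2v Omega F : Prop := forall i : 'I_3, L2 Omega (component i F).

Definition inner Omega f g : R := vint Omega (fun x => f x * g x).

Definition innerv Omega F G : R := vint Omega (fun x => dot (F x) (G x)).

End Lebesgue.

Section HdivHcurl.
Context {R : realType}.
Variable Omega : set 'rV[R]_3.
Implicit Types (f g phi : 'rV[R]_3 -> R) (u w psi : 'rV[R]_3 -> 'rV[R]_3).

(* div and curl on L^2(Omega)^3 are understood in the sense of distributions;
   the weak derivative, when it exists, is unique up to a null set, and
   wdiv, wcurl pick a representative.                                         *)
Definition is_weak_div u g : Prop :=
  L2 Omega g /\
  forall phi, smooth phi -> compactly_supported Omega phi ->
    innerv Omega u (grad phi) = - inner Omega g phi.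

Definition wdiv u : 'rV[R]_3 -> R := xget (fun=> 0) [set g | is_weak_div u g].

Definition is_weak_curl u w : Prop :=
  L2v Omega w /\
  forall psi, smoothv psi -> compactly_supported Omega psi ->
    innerv Omega u (curl psi) = innerv Omega w psi.

Definition wcurl u : 'rV[R]_3 -> 'rV[R]_3 :=
  xget (fun=> 0) [set w | is_weak_curl u w].

(* The traces u . n and u x n are the usual functionals given by Green's
   formula, tested with the restrictions to Omega of smooth functions on R^3:
   \int_{\partial Omega} (u . n) phi
     = \int_Omega (u . grad phi + (div u) phi),
   \int_{\partial Omega} (u x n) . psi
     = \int_Omega (u . curl psi - (curl u) . psi).                            *)
Definition zero_normal_trace u : Prop :=
  forall phi, smooth phi ->
    innerv Omega u (grad phi) + inner Omega (wdiv u) phi = 0.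

Definition zero_tangential_trace u : Prop :=
  forall psi, smoothv psi ->
    innerv Omega u (curl psi) - innerv Omega (wcurl u) psi = 0.

Definition H0div u : Prop :=
  [/\ L2v Omega u, exists g, is_weak_div u g & zero_normal_trace u].

Definition H0curl u : Prop :=
  [/\ L2v Omega u, exists w, is_weak_curl u w & zero_tangential_trace u].

End HdivHcurl.

(* Cells are given by their sets of vertices. *)
Record mesh (R : realType) := Mesh {
  nvert : nat;
  vert : 'I_nvert -> 'rV[R]_3;
  cells : {set {set 'I_nvert}} }.

Section Mesh.
Context {R : realType}.
Variable M : mesh R.
Implicit Types (A K e : {set 'I_(nvert M)}).

Definition hull A : set 'rV[R]_3 :=
  [set x | exists l : 'I_(nvert M) -> R,
    [/\ forall i, 0 <= l i, \sum_(i in A) l i = 1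
      & x = \sum_(i in A) l i *: vert i]].

Definition affinely_independent A : Prop :=
  forall l : 'I_(nvert M) -> R,
    \sum_(i in A) l i = 0 -> \sum_(i in A) l i *: vert i = 0 ->
    forall i, i \in A -> l i = 0.

(* The last condition implies that the closure of Omega is the union of the
   cells; taking the interior of that union excludes a domain with slits, or
   one that omits a set of positive measure.                                  *)
Definition triangulation (Omega : set 'rV[R]_3) : Prop :=
  [/\ forall K, K \in cells M -> #|K| = 4%N /\ affinely_independent K,
      forall K L, K \in cells M -> L \in cells M ->
        hull K `&` hull L = hull (K :&: L)
    & Omega = (\bigcup_(K in [set K | K \in cells M]) hull K)°].

Definition face_cells e : seq {set 'I_(nvert M)} :=
  [seq K : {set 'I_(nvert M)} <- enum (cells M) | e \subset K].

Definition interior_faces : {set {set 'I_(nvert M)}} :=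
  [set e : {set 'I_(nvert M)} | (#|e| == 3%N) && (1 < size (face_cells e))%N].

Definition is_outer_normal K e (n : 'rV[R]_3) : Prop :=
  [/\ enorm n = 1,
      forall i j, i \in e -> j \in e -> dot n (vert i - vert j) = 0
    & forall i j, i \in e -> j \in K :\: e -> dot n (vert j - vert i) < 0].

Definition outer_normal K e : 'rV[R]_3 := xget 0 [set n | is_outer_normal K e n].

(* Surface integral over the triangle with vertices a, b, c, through its affine
   parametrization by the unit triangle.                                      *)
Definition unit_triangle : set (R * R) :=
  [set z | [/\ 0 <= z.1, 0 <= z.2 & z.1 + z.2 <= 1]].

Definition face_int e (f : 'rV[R]_3 -> R) : R :=
  let a := nth 0 [seq vert i | i <- enum e] 0 in
  let b := nth 0 [seq vert i | i <- enum e] 1 in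
  let c := nth 0 [seq vert i | i <- enum e] 2 in
  enorm (cross (b - a) (c - a)) *
  \int[leb2]_(z in unit_triangle) f (a + z.1 *: (b - a) + z.2 *: (c - a)).

(* The value at a boundary point x of K of the restriction of f to K. *)
Definition trace {V : normedModType R} K (f : 'rV[R]_3 -> V) (x : 'rV[R]_3) : V :=
  lim (f y @[y --> within (hull K)° (nbhs x)]).

Definition cell1 e := nth finset.set0 (face_cells e) 0.
Definition cell2 e := nth finset.set0 (face_cells e) 1.

Definition jump e (f : 'rV[R]_3 -> R) (x : 'rV[R]_3) : 'rV[R]_3 :=
  let n1 := outer_normal (cell1 e) e in
  let n2 := - n1 in
  trace (cell1 e) f x *: n1 + trace (cell2 e) f x *: n2.

Definition average {V : normedModType R} e (f : 'rV[R]_3 -> V)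
    (x : 'rV[R]_3) : V :=
  2^-1 *: (trace (cell1 e) f x + trace (cell2 e) f x).

End Mesh.

Section FiniteElements.
Context {R : realType}.
Variables (Omega : set 'rV[R]_3) (M : mesh R).
Implicit Types (f g : 'rV[R]_3 -> R) (u v w : 'rV[R]_3 -> 'rV[R]_3).
Implicit Types (K : {set 'I_(nvert M)}).

Definition poly_eval (p : mpoly.mpoly 3 R) (x : 'rV[R]_3) : R :=
  mpoly.meval (fun i => x 0 i) p.

(* Polynomials of degree at most s; msize is the total degree plus one. *)
Definition is_poly (s : nat) (q : 'rV[R]_3 -> R) : Prop :=
  exists2 p : mpoly.mpoly 3 R, (mpoly.msize p <= s.+1)%N & q = poly_eval p.

Definition is_polyv (s : nat) (q : 'rV[R]_3 -> 'rV[R]_3) : Prop :=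
  forall i : 'I_3, is_poly s (component i q).

(* f|_K is q. Only the interior of K counts: an element of a finite element
   space may be two-valued on the faces, which form a null set.               *)
Definition restricts_to {V : Type} K (f q : 'rV[R]_3 -> V) : Prop :=
  forall x, (hull K)° x -> f x = q x.

Definition Udiv (s : nat) u : Prop :=
  H0div Omega u /\
  forall K, K \in cells M -> exists q r,
    [/\ is_polyv s q, is_poly s r
      & restricts_to K u (fun x => q x + r x *: x)].

Definition Ucurl (s : nat) u : Prop :=
  H0curl Omega u /\
  forall K, K \in cells M -> exists q r,
    [/\ is_polyv s q, is_polyv s r
      & restricts_to K u (fun x => q x + cross x (r x))].

Definition piecewise_poly (s : nat) f : Prop :=
  forall K, K \in cells M -> exists2 q, is_poly s q & restricts_to K f q.

Definition Fh (m : nat) f : Prop := L2 Omega f /\ piecewise_poly m f.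

Definition Qh (s : nat) f : Prop :=
  [/\ L2 Omega f, vint Omega f = 0 & piecewise_poly s f].

Definition proj_curl (s : nat) u : 'rV[R]_3 -> 'rV[R]_3 :=
  xget (fun=> 0) [set w | Ucurl s w /\
    forall v, Ucurl s v -> innerv Omega (fun x => u x - w x) v = 0].

Definition proj_F (m : nat) f : 'rV[R]_3 -> R :=
  xget (fun=> 0) [set g | Fh m g /\
    forall h, Fh m h -> inner Omega (fun x => f x - g x) h = 0].

Definition ah (s : nat) w u v : R :=
  innerv Omega w (wcurl Omega (proj_curl s (fun x => cross (u x) (v x)))).

(* On a face, only the normal component of u enters; it is single-valued since
   u belongs to H(div), so that the average of u has the normal component of u. *)
Definition bh (m : nat) f g u : R :=
  - (\sum_(K in cells M)
       vint (hull K) (fun x => dot (u x) (grad (proj_F m f) x) * proj_F m g x))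
  + \sum_(e in interior_faces M)
      face_int e (fun x => dot (average e u x) (jump e (proj_F m f) x)
                           * average e (proj_F m g) x).

End FiniteElements.

Section TimeDerivative.
Context {R : realType}.
Variables (Omega : set 'rV[R]_3) (T : R).

(* Derivative of a curve [0, T] -> L^2(Omega), one-sided at the endpoints. For
   curves in a finite-dimensional space the choice of the norm is immaterial. *)
Definition has_dt (f : R -> 'rV[R]_3 -> R) (t : R) (g : 'rV[R]_3 -> R) : Prop :=
  L2 Omega g /\
  L2norm Omega (fun x => (r - t)^-1 * (f r x - f t x) - g x)
    @[r --> within `[0, T] t^'] --> 0%E.

Definition time_differentiable (f : R -> 'rV[R]_3 -> R) : Prop :=
  forall t, t \in `[0, T] -> exists g, has_dt f t g.

Definition dt (f : R -> 'rV[R]_3 -> R) (t : R) : 'rV[R]_3 -> R :=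
  xget (fun=> 0) [set g | has_dt f t g].

Definition time_differentiablev (u : R -> 'rV[R]_3 -> 'rV[R]_3) : Prop :=
  forall i : 'I_3, time_differentiable (fun t => component i (u t)).

Definition dtv (u : R -> 'rV[R]_3 -> 'rV[R]_3) (t : R) (x : 'rV[R]_3) :
    'rV[R]_3 :=
  \row_(i < 3) dt (fun r => component i (u r)) t x.

End TimeDerivative.

(* Main.v *)
From HB Require Import structures.
Require Import Defs.
From mathcomp Require Import all_boot all_order all_algebra all_fingroup.
From mathcomp Require Import all_classical all_reals all_analysis.
From mathcomp Require Import -(notations) mpoly.
From mathcomp Require Import measurable_realfun.
From mathcomp Require Import ring lra.
Import Order.TTheory GRing.Theory Num.Theory.
Import numFieldNormedType.Exports.
Set Implicit Arguments.
Unset Strict Implicit.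
Unset Printing Implicit Defensive.
Local Open Scope classical_set_scope.
Local Open Scope ring_scope.

(** Each law is the scheme tested with one admissible function, combined with
    the symmetries of the two trilinear forms.

    The form [bh] is antisymmetric in its first two arguments when the
    transporting field is a divergence free face element ([bh_antisym]). Weak
    divergence in L^2 and vanishing normal trace force the normal component of
    a piecewise polynomial field to be continuous across interior faces and zero
    on boundary faces ([jump_free]: a jump would be seen by a bump function
    concentrated near a point of the face). On a face the jump of a product is
    the sum of both mixed products of jump and average, so the face terms of
    [bh m f g u + bh m g f u] are those of Green's formula on every cell
    ([cells_green]) for the product of the projections; its volume terms cancel
    the remaining ones because [u] has no divergence. For the velocity this last
    property is incompressibility tested with the divergence of the velocity,
    an admissible multiplier since it has degree [s] and mean zero
    ([solenoidal]). For the magnetic field it is propagated from time 0: the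
    curl of an edge element is again a face element, with weak divergence zero
    because the curl of a gradient vanishes ([curl_in_Udiv]), so the induction
    equation says that the derivative of [B] is minus such a curl ([B_curve])
    and the products of [B] with gradients do not change ([B_weak_div]).

    The form [ah] only depends on the cross product of its last two arguments;
    hence it vanishes when these coincide ([ah_self]) and changes sign when they
    are exchanged ([wcurl_projN]).

    The tests are as follows. For the mass the density is tested with 1, whose
    gradient and jumps vanish. For the square of the density it is tested with
    itself. For the energy the momentum is tested with [u], the magnetic field
    with [B], and the density with the projection of [dot u u]: the two
    contributions of [ah] cancel each other, those of [bh] as well, and the
    pressure term vanishes by incompressibility ([energy_balance]). For the
    cross helicity the momentum is tested with [B] and the magnetic field with
    [u]: the pressure term and [bh] vanish since [B] has no divergence and the
    density is constant, and the contributions of [ah] are opposite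
    ([helicity_balance]).

    The time derivatives of the hypotheses are limits in L^2. In an orthonormal
    basis of the space of piecewise polynomials ([pw_basis]) such a limit is the
    derivative of finitely many coefficients ([dt_curve]). Curves of this form
    are stable under products ([curve_derM]), which yields the product rule for
    [rho u], and can be integrated term by term ([curve_vint]); a conserved
    quantity is then a function on [[0, T]] with zero derivative
    ([wder0_cst]).

    What remains is calculus in three dimensions: the fundamental lemma of the
    calculus of variations ([ae0_open]), affine changes of variables
    ([scales_affine]), and the divergence theorem on a tetrahedron
    ([cell_div]), which is the fundamental theorem of calculus along its
    edges. *)

(** * Coordinates and open sets of space *)

Lemma ord3P (i : 'I_3) : [\/ i = 0, i = 1 | i = 2%:R].
Proof.
case: i => -[|[|[|//]]] lti; [constructor 1|constructor 2|constructor 3];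
  exact/val_inj.
Qed.

Lemma sum3E (V : nmodType) (F : 'I_3 -> V) :
  \sum_(i < 3) F i = F 0 + F 1 + F 2%:R.
Proof.
rewrite !big_ord_recr big_ord0 /= add0r.
by congr (F _ + F _ + F _); exact/val_inj.
Qed.

Section Coordinates.
Context {R : realType}.
Implicit Types (x y : 'rV[R]_3).

Definition unpt x : R * R * R := (x 0 0, x 0 1, x 0 2%:R).

Lemma pt0 (z : R * R * R) : pt z 0 0 = z.1.1. Proof. by rewrite mxE. Qed.
Lemma pt1 (z : R * R * R) : pt z 0 1 = z.1.2. Proof. by rewrite mxE. Qed.
Lemma pt2 (z : R * R * R) : pt z 0 2%:R = z.2. Proof. by rewrite mxE. Qed.

Lemma ptK : cancel (@pt R) unpt.
Proof. by case=> [[a b] c]; rewrite /unpt pt0 pt1 pt2. Qed.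

Lemma rV3P x y :
  x 0 0 = y 0 0 -> x 0 1 = y 0 1 -> x 0 2%:R = y 0 2%:R -> x = y.
Proof.
move=> e0 e1 e2; apply/rowP => i.
by case: (ord3P i) => ->.
Qed.

Lemma unptK : cancel unpt (@pt R).
Proof. by move=> x; apply: rV3P; rewrite ?pt0 ?pt1 ?pt2. Qed.

Lemma measurable_coord (i : 'I_3) D :
  measurable_fun D (fun z : measurableTypeR R * measurableTypeR R * measurableTypeR R
                    => pt z 0 i).
Proof.
apply: measurable_funTS.
case: (ord3P i) => ->.
- rewrite (_ : (fun _ => _) = fst \o fst); last by apply/funext => z; rewrite pt0.
  exact: measurableT_comp.
- rewrite (_ : (fun _ => _) = snd \o fst); last by apply/funext => z; rewrite pt1.
  exact: measurableT_comp.
- rewrite (_ : (fun _ => _) = snd); last by apply/funext => z; rewrite pt2.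
  exact: measurable_snd.
Qed.

Definition cube (c : 'rV[R]_3) (r : R) : set 'rV[R]_3 :=
  [set x | forall i, `|x 0 i - c 0 i| < r].
Definition ccube (c : 'rV[R]_3) (r : R) : set 'rV[R]_3 :=
  [set x | forall i, `|x 0 i - c 0 i| <= r].

Lemma measurable_cube c r : measurable (@pt R @^-1` cube c r :
   set (measurableTypeR R * measurableTypeR R * measurableTypeR R)).
Proof.
have -> : @pt R @^-1` cube c r =
  \bigcap_(i in [set: 'I_3]) ((fun z => pt z 0 i) @^-1` ball (c 0 i) r).
  apply/seteqP; split=> z /= zc i; first by move=> _; rewrite /ball/= distrC.
  by have := zc i I; rewrite /ball /= distrC.
apply: fin_bigcap_measurable => // i _.
rewrite -[X in measurable X]setTI.
apply: measurable_coord => //; apply: open_measurable; exact: ball_open.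
Qed.

(** Cubes with rational centre and radius [1 / (n + 1)], indexed by a countable
    type: every open set is a countable union of them. *)
Definition rcenter (q : rat * rat * rat * nat) : 'rV[R]_3 :=
  pt (ratr q.1.1.1, ratr q.1.1.2, ratr q.1.2).
Definition rradius (q : rat * rat * rat * nat) : R := q.2.+1%:R^-1.

Lemma cube_ball c r : 0 < r -> cube c r = ball c r.
Proof.
move=> r0; apply/seteqP; split=> x xc.
  split=> // i j; rewrite [i]ord1; have := xc j.
  by rewrite /ball /= distrC.
by move=> i; case: xc => _ /(_ 0 i); rewrite /ball /= distrC.
Qed.

(** Asking for the closed cubes to lie in [A] leaves room, around each open cube,
    for the compact supports of test functions. *)
Lemma open_cubes (A : set 'rV[R]_3) : open A ->
  A = \bigcup_(q in [set q | ccube (rcenter q) (rradius q) `<=` A])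
        cube (rcenter q) (rradius q).
Proof.
move=> oA; apply/seteqP; split; last first.
  move=> x [q /= qA xq]; apply: qA => i; exact/ltW/xq.
move=> x Ax.
have : nbhs x A by exact: open_nbhs_nbhs.
move/nbhs_ballP => [e /= e0 eA].
have [n ne] : exists n : nat, n.+1%:R^-1 < e / 2.
  have e20 : 0 < e / 2 by rewrite divr_gt0.
  have := near_infty_natSinv_lt (PosNum e20).
  by move=> [N _ /(_ N (leqnn N))]; exists N.
have n0 : (0:R) < n.+1%:R^-1 by rewrite invr_gt0.
have rq (i : 'I_3) : exists q : rat, `|x 0 i - ratr q| < n.+1%:R^-1.
  have /rat_in_itvoo [q] : x 0 i - n.+1%:R^-1 < x 0 i + n.+1%:R^-1.
    by rewrite ltrBlDr -addrA ltrDl addr_gt0.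
  rewrite in_itv/= => /andP[q1 q2]; exists q.
  by rewrite distrC ltr_distl q1 q2.
have [q0 h0] := rq 0; have [q1 h1] := rq 1; have [q2 h2] := rq 2%:R.
exists (q0, q1, q2, n) => /=.
  move=> y yq; apply: eA; split=> // k i; rewrite [k]ord1; rewrite /ball/=.
  have := yq i; rewrite /rcenter /rradius /=.
  have H : `|x 0 i - rcenter (q0,q1,q2,n) 0 i| < n.+1%:R^-1.
    by case: (ord3P i) => ->; rewrite /rcenter ?pt0 ?pt1 ?pt2.
  move: H; rewrite /rcenter /=.
  set c := pt _ 0 i => H1 H2.
  rewrite (_ : x 0 i - y 0 i = (x 0 i - c) - (y 0 i - c)); last by ring.
  apply: (le_lt_trans (ler_normB _ _)).
  rewrite (splitr e); apply: ltrD; first exact: lt_trans ne.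
  exact: le_lt_trans ne.
by move=> i; case: (ord3P i) => ->; rewrite /rcenter ?pt0 ?pt1 ?pt2.
Qed.

Lemma measurable_open (A : set 'rV[R]_3) : open A ->
  measurable (@pt R @^-1` A :
   set (measurableTypeR R * measurableTypeR R * measurableTypeR R)).
Proof.
move=> oA; rewrite (open_cubes oA) preimage_bigcup.
rewrite bigcup_mkcond.
apply: countable_bigcupT_measurable => // q.
by case: ifP => _; [exact: measurable_cube|exact: measurable0].
Qed.

End Coordinates.

(** * Null sets and square integrable functions *)

Notation prod3 R := (measurableTypeR R * measurableTypeR R * measurableTypeR R)%type.

Section NullSets.
Context d (T : measurableType d) (R : realType) (mu : {measure set T -> \bar R}).
Local Open Scope ereal_scope.
Import HBNNSimple.

(** The integral is a supremum of integrals of simple functions below [f]; such a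
    function may be multiplied by the indicator of the complement of [N]. *)
Lemma ge0_integral_setD_null (D N : set T) (f : T -> \bar R) :
  measurable N -> mu N = 0 -> (forall x, 0 <= f x) ->
  \int[mu]_(x in D) f x = \int[mu]_(x in D `\` N) f x.
Proof.
move=> mN N0 f0.
have p0 E : forall x, 0 <= (f \_ E) x.
  by move=> x; rewrite patchE; case: ifP => // _.
rewrite [LHS]integral_mkcond [RHS]integral_mkcond !ge0_integralTE//.
apply/eqP; rewrite eq_le; apply/andP; split; last first.
  apply: le_ereal_sup => _ [h /= hf <-]; exists h => //= x.
  apply: (le_trans (hf x)); rewrite !patchE.
  case: ifPn => [|_]; first by rewrite in_setD => /andP[-> _].
  by case: ifPn.
apply: ge_ereal_sup => _ [h /= hf <-].
apply: (@le_trans _ _ (sintegral mu (proj_nnsfun h (measurableC mN)))).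
  rewrite -!integralT_nnsfun.
  rewrite [leLHS](ge0_negligible_integral mN)//; last 2 first.
  - exact/measurable_EFinP.
  - by move=> x _; rewrite lee_fin fun_ge0.
  rewrite [leRHS](ge0_negligible_integral mN)//; last 2 first.
  - exact/measurable_EFinP.
  - by move=> x _; rewrite lee_fin fun_ge0.
  rewrite le_eqVlt; apply/orP; left; apply/eqP; apply: eq_integral => x.
  rewrite in_setD => /andP[_ xN].
  by rewrite /= mindicE in_setC xN /= mulr1.
apply: ereal_sup_ubound; exists (proj_nnsfun h (measurableC mN)) => //= x.
rewrite mindicE in_setC; case: (boolP (x \in N)) => xN /=.
  by rewrite mulr0 p0.
by rewrite mulr1; apply: (le_trans (hf x)); rewrite !patchE in_setD xN andbT.
Qed.

(** The integrands over closed cells are under control only off the faces, which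
    are null; deleting them leaves a continuous function. *)
Lemma integral_setD_null (D N : set T) (f : T -> \bar R) :
  measurable N -> mu N = 0 ->
  \int[mu]_(x in D) f x = \int[mu]_(x in D `\` N) f x.
Proof.
move=> mN N0; rewrite integralE [RHS]integralE.
by congr (_ - _); exact: ge0_integral_setD_null.
Qed.

End NullSets.

Section L2space.
Context {R : realType}.
Variable Omega : set 'rV[R]_3.
Hypothesis Omega_open : open Omega.
Hypothesis Omega_bounded : bounded_set Omega.
Implicit Types (f g h : 'rV[R]_3 -> R) (F G : 'rV[R]_3 -> 'rV[R]_3).

Notation D := (@pt R @^-1` Omega : set (prod3 R)).
Notation mu := (@leb3 R).

Lemma ae_imp (P Q : R * R * R -> Prop) : (forall z, P z -> Q z) ->
  {ae mu, forall z, P z} -> {ae mu, forall z, Q z}.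
Proof. by move=> PQ; exact: (@filterS _ _ (ae_filter_ringOfSetsType mu)). Qed.

Lemma ae_imp2 (P Q S : R * R * R -> Prop) : (forall z, P z -> Q z -> S z) ->
  {ae mu, forall z, P z} -> {ae mu, forall z, Q z} -> {ae mu, forall z, S z}.
Proof. by move=> PQ; exact: (@filterS2 _ _ (ae_filter_ringOfSetsType mu)). Qed.

Lemma measurable_dom : measurable D.
Proof. exact: measurable_open. Qed.

Lemma leb3_cubeE c r : 0 < r -> mu (@pt R @^-1` cube c r) = ((r *+ 2) ^+ 3)%:E.
Proof.
move=> r0.
have -> : @pt R @^-1` cube c r = (ball (c 0 0) r `*` ball (c 0 1) r) `*` ball (c 0 2%:R) r.
  apply/seteqP; split=> z /=.
    move=> zc; have := zc 0; have := zc 1; have := zc 2%:R.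
    by rewrite pt0 pt1 pt2 /ball /= ![`|_ - c _ _|]distrC => *; do !split.
  move=> [[]]; rewrite /ball /= ![`|c _ _ - _|]distrC => z0 z1 z2 i.
  by case: (ord3P i) => ->; rewrite ?pt0 ?pt1 ?pt2.
have mb x : measurable (ball x r : set (measurableTypeR R)).
  by apply: open_measurable; exact: ball_open.
move: (c 0 0) (c 0 1) (c 0 2%:R) => c0 c1 c2.
have -> : mu ((ball c0 r `*` ball c1 r) `*` ball c2 r) =
  (lebesgue_measure (ball c0 r : set (measurableTypeR R)) *
   lebesgue_measure (ball c1 r : set (measurableTypeR R)) *
   lebesgue_measure (ball c2 r : set (measurableTypeR R)))%E.
  apply: etrans; first by apply: product_measure1E => //; exact: measurableX.
  by congr (_ * _)%E; apply: product_measure1E.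
by rewrite !lebesgue_measure_ball ?ltW// -!EFinM exprS expr2 mulrA.
Qed.

Lemma leb3_cube c r : (mu (@pt R @^-1` cube c r) < +oo)%E.
Proof.
have [r0|r0] := ltP 0 r; first by rewrite leb3_cubeE// ltry.
rewrite (_ : cube c r = set0) ?preimage_set0 ?measure0//.
by apply/seteqP; split=> // x /(_ 0) /(le_lt_trans (normr_ge0 _)); rewrite ltNge r0.
Qed.

Lemma bounded_cube : exists r : R, Omega `<=` cube 0 r.
Proof.
have [M [_ bM]] := Omega_bounded.
exists (`|M| + 1 + 1) => x Ox i.
have MM : M < `|M| + 1 by rewrite (le_lt_trans (ler_norm _))// ltrDl.
have /= xM := bM _ MM _ Ox; rewrite mxE subr0; apply: le_lt_trans (le_lt_trans xM _); last by rewrite ltrDl.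
rewrite /Num.Def.normr /= mx_normrE.
by rewrite (le_trans _ (le_bigmax _ _ (0, i)))//.
Qed.

Lemma leb3_dom : (mu D < +oo)%E.
Proof.
have [r Or] := bounded_cube.
apply: le_lt_trans (leb3_cube 0 r); apply: le_measure; rewrite ?inE.
- exact: measurable_dom.
- exact: measurable_cube.
- by move=> z; exact: Or.
Qed.

Lemma patch_pt f : (f \_ Omega) \o @pt R = (f \o @pt R) \_ D.
Proof.
by apply/funext => z /=; rewrite !patchE.
Qed.

Lemma L2P f : L2 Omega f <->
  measurable_fun D (f \o @pt R) /\
  mu.-integrable D (EFin \o (fun z => f (pt z) ^+ 2)).
Proof.
rewrite /L2 patch_pt; split.
  move=> fL; have iL := Lfun2_integrable_sqr fL.
  move: fL => /sub_Lfun_mfun; rewrite inE => /= mf; split.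
    by apply/(measurable_restrictT _ _).2 => //; exact: measurable_dom.
  apply/(integrable_mkcond _ measurable_dom); move: iL; congr (integrable _ _ _).
  by apply/funext => z /=; rewrite !patchE; case: ifP => //=; rewrite expr0n.
move=> [mf if2].
apply/andP; split; rewrite inE /=.
  by apply/(measurable_restrictT _ _).1 => //; exact: measurable_dom.
rewrite /finite_norm unlock /Lnorm.
apply: poweR_lty.
move/(integrable_mkcond _ measurable_dom): if2 => /integrableP[_].
congr (_ < _)%E; apply: eq_integral => z _.
rewrite /= !patchE; case: ifPn => //= _.
  by rewrite powR_mulrn// real_normK ?num_real// ger0_norm// sqr_ge0.
by rewrite !normr0 powR0.
Qed.

Lemma L2_int f g : L2 Omega f -> L2 Omega g ->
  mu.-integrable D (EFin \o (fun z => f (pt z) * g (pt z))).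
Proof.
move=> fL gL; have /Lfun1_integrable := Lfun2_mul_Lfun1 fL gL.
rewrite !patch_pt => H; apply/(integrable_mkcond _ measurable_dom); move: H; congr (integrable _ _ _).
by apply/funext => z /=; rewrite !patchE /=; case: ifP => //= _; rewrite mulr0.
Qed.

Lemma measurable_L2 f : L2 Omega f -> measurable_fun D (f \o @pt R).
Proof. by move/L2P => []. Qed.

Lemma L2_lin a f g : L2 Omega f -> L2 Omega g -> L2 Omega (fun x => a * f x + g x).
Proof.
move=> fL gL; rewrite /L2.
have -> : ((fun x => a * f x + g x) \_ Omega) \o @pt R =
   a *: ((f \_ Omega) \o @pt R) + ((g \_ Omega) \o @pt R).
  apply/funext => z; rewrite /= !fctE !patchE /=; case: ifP => //= _.
  by rewrite scaler0 addr0.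
have l12 : (1 <= 2%:E :> \bar R)%E by rewrite lee_fin ler1n.
have [_ H] := Lfun_submod_closed mu l12.
exact: H.
Qed.

Lemma L2_bounded f M : measurable_fun D (f \o @pt R) ->
  (forall x, Omega x -> `|f x| <= M) -> L2 Omega f.
Proof.
move=> mf fM; apply/L2P; split=> //.
apply: measurable_bounded_integrable.
- exact: measurable_dom.
- exact: leb3_dom.
- exact: measurable_funX.
exists (M ^+ 2); split => [|y My z Dz]; first exact: num_real.
apply: le_trans (ltW My).
by rewrite normrX lerXn2r ?nnegrE// ?fM// (le_trans _ (fM _ Dz)).
Qed.

Lemma L2_0 : L2 Omega (fun=> 0).
Proof.
apply: (@L2_bounded _ 0) => [|x _]; last by rewrite normr0.
exact: measurable_cst.
Qed.

Lemma L2Z a f : L2 Omega f -> L2 Omega (fun x => a * f x).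
Proof.
move=> fL; have := L2_lin a fL L2_0; congr L2.
by apply/funext => x; rewrite addr0.
Qed.

Lemma L2D f g : L2 Omega f -> L2 Omega g -> L2 Omega (fun x => f x + g x).
Proof.
move=> fL gL; have := L2_lin 1 fL gL; congr L2.
by apply/funext => x; rewrite mul1r.
Qed.

Lemma L2N f : L2 Omega f -> L2 Omega (fun x => - f x).
Proof.
move=> fL; have := L2Z (-1) fL; congr L2.
by apply/funext => x; rewrite mulN1r.
Qed.

Lemma L2B f g : L2 Omega f -> L2 Omega g -> L2 Omega (fun x => f x - g x).
Proof. by move=> fL /L2N; exact: L2D. Qed.

Lemma L2_sum (I : Type) (r : seq I) (P : pred I) (f : I -> 'rV[R]_3 -> R) :
  (forall i, P i -> L2 Omega (f i)) -> L2 Omega (fun x => \sum_(i <- r | P i) f i x).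
Proof.
move=> fL; elim: r => [|i r IH].
  by have := L2_0; congr L2; apply/funext => x; rewrite big_nil.
case: (boolP (P i)) => Pi.
  have := L2D (fL i Pi) IH; congr L2; apply/funext => x; by rewrite big_cons Pi.
by move: IH; congr L2; apply/funext => x; rewrite big_cons (negbTE Pi).
Qed.

Lemma eq_L2 f g : (forall x, Omega x -> f x = g x) -> L2 Omega f -> L2 Omega g.
Proof.
move=> fg; rewrite /L2 (_ : f \_ Omega = g \_ Omega)//.
by apply/eq_restrictP => x /[!inE]; exact: fg.
Qed.

Lemma innerC f g : inner Omega f g = inner Omega g f.
Proof. by apply: eq_Rintegral => z _; rewrite mulrC. Qed.

Lemma eq_vint A f g : (forall x, A x -> f x = g x) -> vint A f = vint A g.
Proof. by move=> fg; apply: eq_Rintegral => z; rewrite inE => /fg. Qed.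

Lemma eq_inner f g f' g' : (forall x, Omega x -> f x = f' x) ->
  (forall x, Omega x -> g x = g' x) -> inner Omega f g = inner Omega f' g'.
Proof. by move=> ff gg; apply: eq_vint => x Ox; rewrite ff// gg. Qed.

Lemma innerDl f g h : L2 Omega f -> L2 Omega g -> L2 Omega h ->
  inner Omega (fun x => f x + g x) h = inner Omega f h + inner Omega g h.
Proof.
move=> fL gL hL; rewrite /inner /vint -RintegralD//; last 2 first.
- exact: L2_int.
- exact: L2_int.
  by apply: eq_Rintegral => z _; rewrite mulrDl.
exact: measurable_dom.
Qed.

Lemma innerZl a f h : L2 Omega f -> L2 Omega h ->
  inner Omega (fun x => a * f x) h = a * inner Omega f h.
Proof.
move=> fL hL; rewrite /inner /vint -RintegralZl//; last 1 first.
- exact: L2_int.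
  by apply: eq_Rintegral => z _; rewrite mulrA.
exact: measurable_dom.
Qed.

Lemma innerNl f h : L2 Omega f -> L2 Omega h ->
  inner Omega (fun x => - f x) h = - inner Omega f h.
Proof.
move=> fL hL; rewrite -mulN1r -innerZl//.
by apply: eq_inner => // x _; rewrite mulN1r.
Qed.

Lemma innerBl f g h : L2 Omega f -> L2 Omega g -> L2 Omega h ->
  inner Omega (fun x => f x - g x) h = inner Omega f h - inner Omega g h.
Proof. by move=> fL gL hL; rewrite innerDl ?innerNl//; exact: L2N. Qed.

Lemma inner0l h : inner Omega (fun=> 0) h = 0.
Proof.
rewrite /inner (@eq_vint _ _ (fun=> 0)); last by move=> x _; rewrite mul0r.
by rewrite /vint /Rintegral integral0.
Qed.

Lemma inner_suml (I : Type) (r : seq I) (P : pred I) (f : I -> 'rV[R]_3 -> R) h :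
  (forall i, P i -> L2 Omega (f i)) -> L2 Omega h ->
  inner Omega (fun x => \sum_(i <- r | P i) f i x) h =
  \sum_(i <- r | P i) inner Omega (f i) h.
Proof.
move=> fL hL; elim: r => [|i r IH].
  rewrite big_nil -[RHS](inner0l h).
  by apply: eq_inner => // x _; rewrite big_nil.
rewrite big_cons; case: ifPn => Pi; rewrite -IH.
  rewrite -innerDl//; [|exact: fL|exact: L2_sum].
  by apply: eq_inner => // x _; rewrite big_cons Pi.
by apply: eq_inner => // x _; rewrite big_cons (negbTE Pi).
Qed.

Lemma innerDr f g h : L2 Omega f -> L2 Omega g -> L2 Omega h ->
  inner Omega h (fun x => f x + g x) = inner Omega h f + inner Omega h g.
Proof. by move=> *; rewrite innerC innerDl// !(innerC h). Qed.

Lemma innerZr a f h : L2 Omega f -> L2 Omega h ->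
  inner Omega h (fun x => a * f x) = a * inner Omega h f.
Proof. by move=> *; rewrite innerC innerZl// !(innerC h). Qed.

Lemma inner_ge0 f : 0 <= inner Omega f f.
Proof. by apply: Rintegral_ge0 => z _; rewrite -expr2 sqr_ge0. Qed.

Lemma inner_eq0 f : L2 Omega f -> inner Omega f f = 0 -> ae_eq_on Omega f (fun=> 0).
Proof.
move=> fL f0.
have [mf if2] := (L2P f).1 fL.
have i0 : (\int[mu]_(z in D) `|(EFin \o (fun z => (f (pt z) ^+ 2)%R)) z| = 0)%E.
  transitivity ((inner Omega f f)%:E); last by rewrite f0.
  have := integrable_fin_num measurable_dom (L2_int fL fL) => /fineK H.
  rewrite /inner /vint /Rintegral H; apply: eq_integral => z _ /=.
  by rewrite ger0_norm ?sqr_ge0// expr2.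
have [H _] := ae_eq_integral_abs mu measurable_dom (measurable_int mu if2).
have := H i0.
apply: ae_imp => z /= {}H /H /= [] /eqP.
by rewrite sqrf_eq0 => /eqP.
Qed.

Lemma ae_vint f g : measurable_fun D (f \o @pt R) -> measurable_fun D (g \o @pt R) ->
  ae_eq_on Omega f g -> vint Omega f = vint Omega g.
Proof.
move=> mf mg fg; congr fine; apply: ae_eq_integral => //.
- exact: measurable_dom.
- exact/measurable_EFinP.
- exact/measurable_EFinP.
by move: fg; apply: ae_imp => z /= H /H /= ->.
Qed.

Lemma ae_inner f g h : L2 Omega f -> L2 Omega g -> L2 Omega h ->
  ae_eq_on Omega f g -> inner Omega f h = inner Omega g h.
Proof.
move=> fL gL hL fg; apply: ae_vint.
- by apply: measurable_funM; exact: measurable_L2.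
- by apply: measurable_funM; exact: measurable_L2.
by move: fg; apply: ae_imp => z /= H /H /= ->.
Qed.

Lemma inner_CauchySchwarz f g : L2 Omega f -> L2 Omega g ->
  inner Omega f g ^+ 2 <= inner Omega f f * inner Omega g g.
Proof.
move=> fL gL.
have H a b : 0 <= a ^+ 2 * inner Omega f f + 2 * a * b * inner Omega f g
               + b ^+ 2 * inner Omega g g.
  have afL := L2Z a fL; have bgL := L2Z b gL; have abL := L2D afL bgL.
  have := inner_ge0 (fun x => a * f x + b * g x).
  rewrite innerDl// !innerDr// !innerZl// !innerZr// (innerC g f).
  by move=> H0; apply: le_trans H0 _; rewrite le_eqVlt; apply/orP; left; apply/eqP; ring.
have f0 := inner_ge0 f; have g0 := inner_ge0 g.
set A := inner Omega f f in H f0 *; set B := inner Omega f g in H *.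
set C := inner Omega g g in H g0 *.
have [C0|C0] := eqVneq C 0.
  have [->|B0] := eqVneq B 0; first by rewrite expr0n /= mulr_ge0.
  have := H 1 (- (A + 1) / (2 * B)); rewrite C0 => {}H; exfalso.
  have : (0:R) <= -1.
    apply: le_trans H _; rewrite le_eqVlt; apply/orP; left; apply/eqP.
    by field.
  by rewrite ler0N1.
have Cp : 0 < C by rewrite lt_def C0.
have := H C (- B).
have -> : C ^+ 2 * A + 2 * C * - B * B + (- B) ^+ 2 * C = C * (A * C - B ^+ 2) by ring.
by rewrite pmulr_rge0// subr_ge0.
Qed.

Lemma L2normE f : L2 Omega f -> L2norm Omega f = (Num.sqrt (inner Omega f f))%:E.
Proof.
move=> fL; rewrite /L2norm unlock /Lnorm.
have -> : (\int[mu]_x `|(EFin \o ((f \_ Omega) \o @pt R)) x| `^ 2)%E =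
          (inner Omega f f)%:E.
  have := integrable_fin_num measurable_dom (L2_int fL fL).
  move=> /fineK => H; rewrite /inner /vint /Rintegral H.
  rewrite [RHS]integral_mkcond; apply: eq_integral => z _.
  rewrite patch_pt /= !patchE; case: ifPn => //= _.
    by rewrite powR_mulrn// real_normK ?num_real// expr2.
  by rewrite normr0 powR0.
by rewrite poweR_EFin powR12_sqrt// inner_ge0.
Qed.

Lemma ae_eq_sym f g : ae_eq_on Omega f g -> ae_eq_on Omega g f.
Proof. by apply: ae_imp => z H /H ->. Qed.

Lemma inner_cancel f g : L2 Omega f -> L2 Omega g ->
  (forall h, L2 Omega h -> inner Omega f h = inner Omega g h) -> ae_eq_on Omega f g.
Proof.
move=> fL gL fg; have fgL := L2B fL gL.
have := inner_eq0 fgL; rewrite innerBl// fg// subrr => /(_ erefl).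
by apply: ae_imp => z H /H /eqP; rewrite subr_eq0 => /eqP.
Qed.

Lemma innervE F G : L2v Omega F -> L2v Omega G ->
  innerv Omega F G = \sum_(i < 3) inner Omega (component i F) (component i G).
Proof.
move=> FL GL; rewrite sum3E /innerv /inner /vint.
have int i := L2_int (FL i) (GL i).
have int01 : mu.-integrable D (EFin \o (fun z => component 0 F (pt z) *
    component 0 G (pt z) + component 1 F (pt z) * component 1 G (pt z))).
  have := integrableD measurable_dom (int 0) (int 1).
  by congr (integrable _ _ _); apply/funext => z; rewrite /= EFinD.
rewrite -(RintegralD measurable_dom (int 0) (int 1)).
rewrite -(RintegralD measurable_dom int01 (int 2%:R)).
by apply: eq_Rintegral => z _; rewrite /dot sum3E.
Qed.

End L2space.

(** * Differentiable functions and polynomials *)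

Notation poly3 R := (mpoly.mpoly 3 R).

Section Smoothness.
Context {R : realType}.
Implicit Types (f g : 'rV[R]_3 -> R) (x w : 'rV[R]_3).

Lemma continuous_measurable f D : continuous f ->
  measurable_fun D (f \o @pt R : prod3 R -> R).
Proof.
move=> cf; apply: measurable_funTS.
apply: (measurability _ (RGenOInfty.measurableE R)) => //.
move=> _ [_ [a ->] <-]; rewrite setTI.
rewrite -[X in measurable X]/(@pt R @^-1` (f @^-1` `]a, +oo[%classic)).
apply: measurable_open; move: f cf => f /continuousP; apply.
exact: interval_open.
Qed.

Lemma row_delta w : w = \sum_(i < 3) w 0 i *: delta_mx 0 i.
Proof.
by rewrite {1}[w]matrix_sum_delta big_ord1.
Qed.

Lemma derive_partial f x w : differentiable f x ->
  'D_w f x = \sum_(i < 3) w 0 i * partial i f x.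
Proof.
move=> df; rewrite deriveE// {1}[w]row_delta linear_sum /=.
by apply: eq_bigr => i _; rewrite linearZ /= /partial deriveE.
Qed.

(** Test functions for Green's formula. Differentiability is asked for, besides
    continuous partial derivatives, to have the chain rule at once. *)
Definition C1 f := (forall x, differentiable f x) /\
  forall i, continuous (partial i f).

Lemma C1_continuous f : C1 f -> continuous f.
Proof. by move=> [df _] x; exact: differentiable_continuous. Qed.

Lemma partialM i f g : (forall x, differentiable f x) ->
  (forall x, differentiable g x) ->
  partial i (fun x => f x * g x) =
  (fun x => f x * partial i g x + g x * partial i f x).
Proof.
move=> df dg; apply/funext => x; rewrite /partial.
rewrite (_ : (fun x => f x * g x) = f * g)//.
by rewrite deriveM; [|exact: diff_derivable..].
Qed.

Lemma partialD i f g : (forall x, differentiable f x) ->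
  (forall x, differentiable g x) ->
  partial i (fun x => f x + g x) = (fun x => partial i f x + partial i g x).
Proof.
move=> df dg; apply/funext => x; rewrite /partial.
rewrite (_ : (fun x => f x + g x) = f + g)//.
by rewrite deriveD; [|exact: diff_derivable..].
Qed.

Lemma C1M f g : C1 f -> C1 g -> C1 (fun x => f x * g x).
Proof.
move=> fC gC; have [df cf] := fC; have [dg cg] := gC; split.
  by move=> x; exact: differentiableM.
move=> i; rewrite partialM// => x.
have cM (a b : 'rV[R]_3 -> R) : continuous a -> continuous b ->
  {for x, continuous (fun y => a y * b y)}.
  by move=> ca cb; exact: (@continuousM _ _ a b x (ca x) (cb x)).
apply: (@continuousD _ _ _ (fun y => f y * _) (fun y => g y * _)); apply: cM => //;
  exact: C1_continuous.
Qed.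

Lemma differentiable_rVcoord i x : differentiable (fun y : 'rV[R]_3 => y 0 i) x.
Proof. exact: differentiable_coord. Qed.

Lemma partial_coord i j x : partial i (fun y : 'rV[R]_3 => y 0 j) x = (i == j)%:R.
Proof.
rewrite /partial deriveE; last exact: differentiable_rVcoord.
pose c := fun y : 'rV[R]_3 => y 0 j.
have lc : linear c by move=> a u v; rewrite /c !mxE.
pose C : {linear 'rV[R]_3 -> R} :=
  HB.pack c (@GRing.isLinear.Build _ _ _ _ c lc).
rewrite -[fun y => _]/(C : _ -> _) diff_lin; last exact: coord_continuous.
by rewrite -[C _]/(delta_mx 0 i 0 j : R) mxE eqxx /= eq_sym.
Qed.

End Smoothness.

Section Polynomials.
Context {R : realType}.
Implicit Types (x : 'rV[R]_3) (p q : poly3 R).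

(** Polynomials are generated by constants and variables; properties of their
    evaluation follow without looking at monomials. *)
Lemma mpoly_alg_ind (P : poly3 R -> Prop) :
  (forall c, P (mpolyC 3 c)) -> (forall i, P (mpolyX R (mnm1 i))) ->
  (forall p q, P p -> P q -> P (p + q)) ->
  (forall p q, P p -> P q -> P (p * q)) -> forall p, P p.
Proof.
move=> PC PX PD PM; elim/mpolyind => [|c m p _ _ Pp]; first by rewrite -mpolyC0.
apply: PD => //; rewrite -mul_mpolyC; apply: (PM) => //.
rewrite mpolyXE_id.
elim/big_ind : _ => [||i _]; [by rewrite -mpolyC1|by move=> ? ?; exact: PM|].
elim: (fun_of_multinom m i) => [|k IH]; first by rewrite expr0 -mpolyC1.
by rewrite exprS; apply: PM.
Qed.

Lemma peD p q x : poly_eval (p + q) x = poly_eval p x + poly_eval q x.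
Proof. exact: mevalD. Qed.
Lemma peN p x : poly_eval (- p) x = - poly_eval p x.
Proof. exact: mevalN. Qed.
Lemma peB p q x : poly_eval (p - q) x = poly_eval p x - poly_eval q x.
Proof. exact: mevalB. Qed.
Lemma peM p q x : poly_eval (p * q) x = poly_eval p x * poly_eval q x.
Proof. exact: mevalM. Qed.
Lemma peZ c p x : poly_eval (c *: p) x = c * poly_eval p x.
Proof. exact: mevalZ. Qed.
Lemma peC c x : poly_eval (mpolyC 3 c) x = c.
Proof. exact: mevalC. Qed.
Lemma pe0 x : poly_eval 0 x = 0.
Proof. exact: meval0. Qed.
Lemma pe1 x : poly_eval 1 x = 1.
Proof. exact: meval1. Qed.
Lemma peX i x : poly_eval (mpolyX R (mnm1 i)) x = x 0 i.
Proof. exact: mevalXU. Qed.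
Lemma peXn p n x : poly_eval (p ^+ n) x = poly_eval p x ^+ n.
Proof. by elim: n => [|n IH]; rewrite ?expr0 ?pe1// !exprS peM IH. Qed.
Lemma pe_sum I (r : seq I) (P : pred I) (F : I -> poly3 R) x :
  poly_eval (\sum_(i <- r | P i) F i) x = \sum_(i <- r | P i) poly_eval (F i) x.
Proof. by apply: (big_morph (fun p => poly_eval p x)) => [p q|]; rewrite ?peD ?pe0. Qed.

Definition peE := (peD, peN, peB, peM, peZ, peC, pe0, pe1, peX, peXn).

Lemma pe_diff p : (forall x, differentiable (poly_eval p) x) /\
  forall i, partial i (poly_eval p) = poly_eval (mderiv i p).
Proof.
elim/mpoly_alg_ind: p => [c|j|p q [dp pp] [dq pq]|p q [dp pp] [dq pq]].
- rewrite (_ : poly_eval (mpolyC 3 c) = cst c); last by apply/funext => x; rewrite peC.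
  split=> [x|i]; first exact: differentiable_cst.
  by apply/funext => x; rewrite /partial derive_cst mderivC pe0.
- rewrite (_ : poly_eval _ = fun x : 'rV[R]_3 => x 0 j); last by apply/funext => x; rewrite peX.
  split=> [x|i]; first exact: differentiable_rVcoord.
  apply/funext => x; rewrite partial_coord mderivX peZ mnm1E eq_sym.
  have [->|_] := eqVneq i j; last by rewrite mul0r.
  have -> : mnm_sub (mnm1 j) (mnm1 j) = @mnm0 3.
    by apply/mnmP => k; rewrite mnmBE mnm0E subnn.
  by rewrite mpolyX0 pe1 mul1r.
- rewrite (_ : poly_eval (p + q) = fun x => poly_eval p x + poly_eval q x); last first.
    by apply/funext => x; rewrite peD.
  split=> [x|i]; first exact: differentiableD.
  by rewrite partialD//; apply/funext => x; rewrite pp pq mderivD peD.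
- rewrite (_ : poly_eval (p * q) = fun x => poly_eval p x * poly_eval q x); last first.
    by apply/funext => x; rewrite peM.
  split=> [x|i]; first exact: differentiableM.
  rewrite partialM//; apply/funext => x; rewrite pp pq mderivM peD !peM.
  by rewrite addrC [poly_eval q x * _]mulrC.
Qed.

Lemma differentiable_poly p x : differentiable (poly_eval p) x.
Proof. by case: (pe_diff p). Qed.

Lemma partial_poly i p : partial i (poly_eval p) = poly_eval (mderiv i p).
Proof. by case: (pe_diff p). Qed.

Lemma continuous_poly p : continuous (poly_eval p).
Proof. by move=> x; apply: differentiable_continuous; exact: differentiable_poly. Qed.

Lemma C1_poly p : C1 (poly_eval p).
Proof.
split; first exact: differentiable_poly.
by move=> i; rewrite partial_poly; exact: continuous_poly.
Qed.

Lemma smooth_poly p : smooth (poly_eval p).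
Proof.
move=> s; have -> : foldr partial (poly_eval p) s = poly_eval (foldr (@mderiv 3 R) p s).
  by elim: s => //= i s ->; rewrite partial_poly.
split=> [|i x]; first exact: continuous_poly.
by apply: diff_derivable; exact: differentiable_poly.
Qed.

Lemma measurable_mpoly p D : measurable_fun D (poly_eval p \o @pt R : prod3 R -> R).
Proof. by apply: continuous_measurable; exact: continuous_poly. Qed.

Definition deg_le s p := (msize p <= s.+1)%N.

Lemma deg_leW s t p : (s <= t)%N -> deg_le s p -> deg_le t p.
Proof. by move=> st /leq_trans; apply. Qed.

Lemma deg_leC s c : deg_le s (mpolyC 3 c).
Proof. by rewrite /deg_le msizeC (leq_trans (leq_b1 _)). Qed.

Lemma deg_le0 s : deg_le s 0.
Proof. by rewrite /deg_le msize0. Qed.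

Lemma deg_leX s i : deg_le s.+1 (mpolyX R (mnm1 i)).
Proof. by rewrite /deg_le msizeX mdeg1. Qed.

Lemma deg_leD s p q : deg_le s p -> deg_le s q -> deg_le s (p + q).
Proof.
by rewrite /deg_le => ps qs; rewrite (leq_trans (msizeD_le _ _))// geq_max ps.
Qed.

Lemma deg_leZ s c p : deg_le s p -> deg_le s (c *: p).
Proof. by move=> ps; rewrite /deg_le (leq_trans (msizeZ_le _ _)). Qed.

Lemma deg_leN s p : deg_le s p -> deg_le s (- p).
Proof. by rewrite /deg_le msizeN. Qed.

Lemma deg_leB s p q : deg_le s p -> deg_le s q -> deg_le s (p - q).
Proof. by move=> ps /deg_leN; exact: deg_leD. Qed.

Lemma deg_leM s t p q : deg_le s p -> deg_le t q -> deg_le (s + t) (p * q).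
Proof.
rewrite /deg_le => ps qt.
have [->|p0] := eqVneq p 0; first by rewrite mul0r msize0.
have [->|q0] := eqVneq q 0; first by rewrite mulr0 msize0.
rewrite msizeM//; case: (msize p) ps => [|a] /= ps; last by rewrite -addnS leq_add.
by rewrite add0n (leq_trans (leq_pred _))// (leq_trans qt)// ltnS leq_addl.
Qed.

Lemma deg_le_sum I (r : seq I) (P : pred I) (F : I -> poly3 R) s :
  (forall i, P i -> deg_le s (F i)) -> deg_le s (\sum_(i <- r | P i) F i).
Proof.
by move=> H; elim/big_ind : _ => //; [exact: deg_le0|exact: deg_leD].
Qed.

Lemma msize_mderiv i p : (msize (mderiv i p) <= (msize p).-1)%N.
Proof.
rewrite [in leqLHS]msizeE; apply/bigmax_leqP_seq => m mp _.
have : mcoeff (mnm_add m (mnm1 i)) p != 0.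
  move: mp; rewrite mcoeff_msupp mcoeff_mderiv; apply: contraNneq => ->.
  by rewrite mul0rn.
rewrite -mcoeff_msupp => /msize_mdeg_lt; rewrite mdegD mdeg1 addn1.
by case: (msize p).
Qed.

Lemma deg_le_mderiv s i p : deg_le s p -> deg_le s.-1 (mderiv i p).
Proof.
move=> ps; rewrite /deg_le (leq_trans (msize_mderiv _ _))//.
by move: ps; rewrite /deg_le; case: s; case: (msize p) => [|[|]].
Qed.

Lemma is_polyvP s (F : 'rV[R]_3 -> 'rV[R]_3) : is_polyv s F <->
  exists2 P : 'I_3 -> poly3 R, (forall i, deg_le s (P i)) &
    forall i, component i F = poly_eval (P i).
Proof.
split=> [FP|[P Ps FP] i]; last by exists (P i); [exact: Ps|].
have /choice[P PE] : forall i : 'I_3, exists p, deg_le s p /\ component i F = poly_eval p.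
  by move=> i; have [p ps pE] := FP i; exists p.
by exists P => i; have [] := PE i.
Qed.

End Polynomials.

(** * Smooth bump functions *)

Section ExpBump.
Context {R : realType}.
Implicit Types (p q : {poly R}) (s t : R).

(** The power series of the exponential dominates each of its terms. *)
Lemma poly_expRN_bounded q : exists C, forall s, 0 <= s ->
  `|q.[s]| * expR (- s) <= C.
Proof.
exists (\sum_(i < size q) `|q`_i| * i`!%:R) => s s0.
rewrite horner_coef; apply: (@le_trans _ _ (\sum_(i < size q) `|q`_i * s ^+ i| * expR (- s))).
  by rewrite -mulr_suml ler_wpM2r ?expR_ge0// ler_norm_sum.
apply: ler_sum => i _; rewrite normrM -mulrA ler_wpM2l//.
rewrite ger0_norm ?exprn_ge0// expRN ler_pdivrMr ?expR_gt0//.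
case: (nat_of_ord i) => [|n].
  rewrite expr0 fact0 mul1r; apply: le_trans (expR_ge1Dx s); by rewrite lerDl.
rewrite -ler_pdivrMl ?ltr0n ?fact_gt0// mulrC.
by apply: le_trans (expR_ge1Dxn n s0); rewrite lerDr.
Qed.

(** The flat functions [p(1/t) exp(-1/t)], extended by 0 to [t <= 0]. Allowing a
    polynomial factor makes the family stable under differentiation: [p] is
    replaced by [X^2 (p - p')]. *)
Definition eta p t := if 0 < t then p.[t^-1] * expR (- t^-1) else 0.

Definition eta' p : {poly R} := 'X^2 * (p - p^`()).

Lemma is_derive_etaV p t : 0 < t ->
  is_derive t 1 (fun t => p.[t^-1] * expR (- t^-1)) ((eta' p).[t^-1] * expR (- t^-1)).
Proof.
move=> t0; have tn0 : t != 0 by rewrite gt_eqF.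
have dV : is_derive t 1 (fun t : R => t^-1) (- t ^- 2).
  have H := is_deriveV tn0 (is_derive_id t (1:R)).
  apply: is_derive_eq H _ => /=; by rewrite /GRing.scale /= mulr1.
have dp : is_derive t 1 (fun t : R => p.[t^-1]) (p^`().[t^-1] * - t ^- 2).
  exact: (@is_derive1_comp R (horner p) (fun t => t^-1) t _ _ _ dV).
have dN : is_derive t 1 (fun t : R => - t^-1) (t ^- 2).
  by apply: is_derive_eq (@is_deriveN _ _ _ _ _ _ _ dV) _; rewrite opprK.
have de : is_derive t 1 (fun t : R => expR (- t^-1)) (expR (- t^-1) * t ^- 2).
  by apply: is_derive_eq (@is_derive1_comp R expR (fun t => - t^-1) t _ _ _ _) _.
apply: is_derive_eq (@is_deriveM _ _ _ _ _ _ _ _ dp de) _.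
rewrite /eta' hornerM hornerXn hornerD hornerN exprVn /GRing.scale /=.
by ring.
Qed.

Lemma is_derive_eta p t : is_derive t 1 (eta p) (eta (eta' p) t).
Proof.
have [t0|t0|<-] := ltrgtP 0 t.
- rewrite /eta t0.
  apply: near_eq_is_derive (is_derive_etaV p t0).
  near=> s; rewrite /eta (_ : 0 < s)//.
  near: s; exact: lt_nbhsr.
- rewrite {2}/eta ltNge (ltW t0) /=.
  have H : is_derive t 1 (cst (0:R)) 0 := is_derive_cst _ _ _.
  apply: near_eq_is_derive H.
  near=> s; rewrite /eta ltNge (_ : s <= 0)//.
  near: s; apply: filterS (lt_nbhsl t0) => s; exact: ltW.
rewrite {2}/eta ltxx.
have [C HC] := poly_expRN_bounded ('X^2 * p).
have H0 : (fun h => h^-1 *: ((eta p \o shift 0) (h *: (1:R)) - eta p 0)) @ 0^' --> (0:R).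
  apply/cvgr0Pnorm_le => e e0.
  near=> h; rewrite /= addr0 /eta ltxx subr0 /GRing.scale /= mulr1.
  case: ifPn => h0; last by rewrite mulr0 normr0 ltW.
  have hi0 : 0 <= h^-1 by rewrite invr_ge0 ltW.
  have := HC _ hi0; rewrite hornerM hornerXn normrM => H.
  have -> : `|h^-1 * (p.[h^-1] * expR (- h^-1))| =
     h * (`|h^-1 ^+ 2| * `|p.[h^-1]| * expR (- h^-1)).
    rewrite normrX normrM (normrM p.[_]) (ger0_norm hi0) (ger0_norm (expR_ge0 _)).
    by field; rewrite gt_eqF.
  apply: (@le_trans _ _ (h * C)); first by rewrite ler_wpM2l// ltW.
  (* Adding 1 avoids a division by zero. *)
  apply: (@le_trans _ _ (h * (`|C| + 1))).
    by rewrite ler_wpM2l ?(ltW h0)// (le_trans (ler_norm _))// lerDl.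
  rewrite -ler_pdivlMr ?ltr_pwDr//.
  have : `|h| <= e / (`|C| + 1); last by move=> /(le_trans (ler_norm _)).
  near: h; apply: dnbhs0_le; by rewrite divr_gt0// ltr_pwDr.
by apply: DeriveDef; [exact: cvgP H0|exact: (cvg_lim _ H0)].
Unshelve. all: by end_near. Qed.

(** One-variable functions closed under differentiation: the class contains
    [t |-> eta p (c * t + d)] and is stable under sums and products. *)
Inductive bumpy : (R -> R) -> Prop :=
| bumpy_eta p c d : bumpy (fun t => eta p (c * t + d))
| bumpy_cst c : bumpy (fun=> c)
| bumpy_add f g : bumpy f -> bumpy g -> bumpy (fun t => f t + g t)
| bumpy_mul f g : bumpy f -> bumpy g -> bumpy (fun t => f t * g t).

Lemma bumpy_derive f : bumpy f ->
  exists2 g, bumpy g & forall t, is_derive t 1 f (g t).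
Proof.
elim=> [p c d|c|{}f g bf [f' bf' Hf] bg [g' bg' Hg]|{}f g bf [f' bf' Hf] bg [g' bg' Hg]].
- exists (fun t => c * eta (eta' p) (c * t + d)).
    by apply: bumpy_mul; [exact: bumpy_cst|exact: bumpy_eta].
  move=> t.
  have da : is_derive t 1 (fun t : R => c * t + d) c.
    have H := @is_deriveD _ _ _ _ _ t 1 _ _
      (@is_deriveZ _ _ _ _ c t 1 _ (@is_derive_id _ _ t 1)) (is_derive_cst d t 1).
    apply: is_derive_eq H _; by rewrite addr0 /GRing.scale /= mulr1.
  apply: is_derive_eq (@is_derive1_comp R (eta p) (fun t => c * t + d) t _ _ (is_derive_eta p _) da) _.
  by rewrite mulrC.
- exists (fun=> 0); first exact: bumpy_cst.
  by move=> t; exact: is_derive_cst.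
- exists (fun t => f' t + g' t); first exact: bumpy_add.
  by move=> t; exact: (@is_deriveD _ _ _ _ _ _ _ _ _ (Hf t) (Hg t)).
- exists (fun t => f t * g' t + g t * f' t).
    by apply: bumpy_add; exact: bumpy_mul.
  by move=> t; exact: (@is_deriveM _ _ _ _ _ _ _ _ (Hf t) (Hg t)).
Qed.

End ExpBump.

Section Bumps.
Context {R : realType}.
Implicit Types (x a b : 'rV[R]_3).

Lemma diff_coord_comp (h : R -> R) (h' : R -> R) (j : 'I_3) :
  (forall t : R, is_derive t 1 h (h' t)) ->
  (forall x, differentiable (fun x : 'rV[R]_3 => h (x 0 j)) x) /\
  forall i, partial i (fun x : 'rV[R]_3 => h (x 0 j)) =
            (fun x => (i == j)%:R * h' (x 0 j)).
Proof.
move=> hh'.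
have dh t : differentiable h t by apply/derivable1_diffP; have [] := hh' t.
have dc x : differentiable (fun x : 'rV[R]_3 => x 0 j) x := differentiable_rVcoord j x.
split=> [x|i].
  by apply: (@differentiable_comp _ _ _ _ (fun x : 'rV[R]_3 => x 0 j) h).
apply/funext => x; rewrite /partial deriveE; last first.
  by apply: (@differentiable_comp _ _ _ _ (fun x : 'rV[R]_3 => x 0 j) h).
have E : 'd (fun x : 'rV[R]_3 => x 0 j) x (delta_mx 0 i) = (i == j)%:R.
  by rewrite -deriveE// -/(partial _ _ _) partial_coord.
rewrite (@diff_comp _ _ _ _ (fun x : 'rV[R]_3 => x 0 j) h)//= E.
rewrite deriv1E; last by have [] := hh' (x 0 j).
by rewrite derive1E; have [_ ->] := hh' (x 0 j).
Qed.

Definition tensor (h0 h1 h2 : R -> R) (x : 'rV[R]_3) : R :=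
  h0 (x 0 0) * h1 (x 0 1) * h2 (x 0 2%:R).

Lemma tensor_diff h0 h1 h2 h0' h1' h2' :
  (forall t : R, is_derive t 1 h0 (h0' t)) -> (forall t : R, is_derive t 1 h1 (h1' t)) ->
  (forall t : R, is_derive t 1 h2 (h2' t)) ->
  (forall x, differentiable (tensor h0 h1 h2) x) /\
  forall i, partial i (tensor h0 h1 h2) =
    if i == 0 then tensor h0' h1 h2 else
    if i == 1 then tensor h0 h1' h2 else tensor h0 h1 h2'.
Proof.
move=> /(diff_coord_comp 0)[d0 p0] /(diff_coord_comp 1)[d1 p1] /(diff_coord_comp 2%:R)[d2 p2].
have d01 x : differentiable (fun x : 'rV[R]_3 => h0 (x 0 0) * h1 (x 0 1)) x.
  exact: differentiableM.
split=> [x|i]; first exact: differentiableM.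
rewrite /tensor partialM// partialM// p0 p1 p2.
case: (ord3P i) => ->; apply/funext => x /=.
- by rewrite mul1r !mul0r !mulr0 add0r add0r mulrC (mulrC (h1 _)).
- by rewrite mul1r !mul0r !mulr0 add0r addr0 mulrC.
- by rewrite mul1r !mul0r !mulr0 addr0 mulr0 addr0.
Qed.

Definition bump_fun (f : 'rV[R]_3 -> R) := exists h0 h1 h2,
  [/\ bumpy h0, bumpy h1, bumpy h2 & f = tensor h0 h1 h2].

(** Tensor products of [bumpy] functions have partial derivatives of the same
    form, hence are smooth. *)
Lemma bump_fun_diff f : bump_fun f -> (forall x, differentiable f x) /\
  forall i, bump_fun (partial i f).
Proof.
move=> [h0 [h1 [h2 [b0 b1 b2 ->]]]].
have [h0' b0' d0] := bumpy_derive b0; have [h1' b1' d1] := bumpy_derive b1.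
have [h2' b2' d2] := bumpy_derive b2.
have [df pf] := tensor_diff d0 d1 d2.
split=> // i; rewrite pf; case: ifP => _; last case: ifP => _.
- by exists h0', h1, h2.
- by exists h0, h1', h2.
- by exists h0, h1, h2'.
Qed.

Lemma bump_fun_C1 f : bump_fun f -> C1 f.
Proof.
move=> /bump_fun_diff[df pf]; split=> // i x.
by apply: differentiable_continuous; have [] := bump_fun_diff (pf i).
Qed.

Lemma bump_fun_smooth f : bump_fun f -> smooth f.
Proof.
move=> bf s /=; have : bump_fun (foldr partial f s).
  by elim: s => //= i s IH; have [] := bump_fun_diff IH.
move=> /bump_fun_diff[df _]; split=> [x|i x].
  exact: differentiable_continuous.
exact: diff_derivable.
Qed.

(** The function [boxbump n a b] is [exp (-1/(n (x_i - a_i)) - 1/(n (b_i - x_i)))],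
    multiplied over [i], inside the box of corners [a], [b]; letting [n] grow
    gives the indicator function of the open box. *)
Definition bump1 (n : nat) (a b t : R) : R :=
  eta 1 (n%:R * t + - n%:R * a) * eta 1 (- n%:R * t + n%:R * b).

Definition boxbump n a b : 'rV[R]_3 -> R :=
  tensor (bump1 n (a 0 0) (b 0 0)) (bump1 n (a 0 1) (b 0 1))
         (bump1 n (a 0 2%:R) (b 0 2%:R)).

Definition box a b : set 'rV[R]_3 := [set x | forall i, a 0 i < x 0 i < b 0 i].
Definition cbox a b : set 'rV[R]_3 := [set x | forall i, a 0 i <= x 0 i <= b 0 i].

Lemma bump_is_bump n a b : bump_fun (boxbump n a b).
Proof.
by exists (bump1 n (a 0 0) (b 0 0)), (bump1 n (a 0 1) (b 0 1)),
  (bump1 n (a 0 2%:R) (b 0 2%:R)); split=> //; apply: bumpy_mul; exact: bumpy_eta.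
Qed.

Lemma eta1_itv (t : R) : 0 <= eta 1 t <= 1.
Proof.
rewrite /eta; case: ifPn => t0; last by rewrite lexx ler01.
by rewrite hornerE mul1r expR_ge0 /= -expR0 ler_expR oppr_le0 invr_ge0 ltW.
Qed.

Lemma bump1_itv n (a b t : R) : 0 <= bump1 n a b t <= 1.
Proof.
rewrite /bump1; have /andP[? ?] := eta1_itv (n%:R * t + - n%:R * a).
have /andP[? ?] := eta1_itv (- n%:R * t + n%:R * b).
by rewrite mulr_ge0//= mulr_ile1.
Qed.

Lemma bump_itv n a b x : 0 <= boxbump n a b x <= 1.
Proof.
rewrite /boxbump /tensor.
have /andP[? ?] := bump1_itv n (a 0 0) (b 0 0) (x 0 0).
have /andP[? ?] := bump1_itv n (a 0 1) (b 0 1) (x 0 1).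
have /andP[? ?] := bump1_itv n (a 0 2%:R) (b 0 2%:R) (x 0 2%:R).
apply/andP; split; first by apply: mulr_ge0 => //; exact: mulr_ge0.
by apply: mulr_ile1 => //; [exact: mulr_ge0|exact: mulr_ile1].
Qed.

Lemma bump1_out n (a b t : R) : ~ (a < t < b) -> bump1 n a b t = 0.
Proof.
move=> atb; rewrite /bump1 /eta.
case: ifPn => [at0|]; last by rewrite mul0r.
case: ifPn => [tb0|]; last by rewrite mulr0.
exfalso; apply: atb.
have n0 : 0 < n%:R :> R.
  rewrite lt_def ler0n andbT; apply: contraTN at0 => /eqP ->.
  by rewrite oppr0 !mul0r addr0 ltxx.
move: at0 tb0; rewrite mulNr -mulrBr pmulr_rgt0// subr_gt0 => ->.
by rewrite mulNr addrC -mulrBr pmulr_rgt0// subr_gt0 => ->.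
Qed.

Lemma bump_out n a b x : ~ box a b x -> boxbump n a b x = 0.
Proof.
move=> xab; rewrite /boxbump /tensor.
have [h0|h0] := boolP (a 0 0 < x 0 0 < b 0 0); last by rewrite bump1_out ?mul0r//; exact/negP.
have [h1|h1] := boolP (a 0 1 < x 0 1 < b 0 1); last by rewrite [X in _ * X * _]bump1_out ?mulr0 ?mul0r//; exact/negP.
have [h2|h2] := boolP (a 0 2%:R < x 0 2%:R < b 0 2%:R); last by rewrite [X in _ * X]bump1_out ?mulr0//; exact/negP.
by exfalso; apply: xab => i; case: (ord3P i) => ->.
Qed.

Lemma eta1_cvg (c : R) : 0 < c -> eta 1 (n%:R * c) @[n --> \oo] --> (1 : R).
Proof.
move=> c0.
have H : expR (- (n%:R * c)^-1) @[n --> \oo] --> expR (- 0 : R).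
  apply: continuous_cvg; first exact: continuous_expR.
  apply: cvgN; rewrite -(mul0r c^-1).
  under eq_fun do rewrite invfM.
  apply: cvgMl; rewrite -(cvg_shiftS (fun n => n%:R^-1 : R)).
  exact: cvg_harmonic.
rewrite oppr0 expR0 in H.
apply: cvg_trans H; apply: near_eq_cvg; near=> n.
rewrite /eta hornerE mul1r mulr_gt0//.
by rewrite ltr0n; near: n; exists 1%N.
Unshelve. all: by end_near. Qed.

Lemma bump1_cvg (a b t : R) : a < t < b -> bump1 n a b t @[n --> \oo] --> (1:R).
Proof.
move=> /andP[at0 tb]; rewrite -[1]mulr1; apply: cvgM.
  under eq_fun do rewrite mulNr -mulrBr.
  by apply: eta1_cvg; rewrite subr_gt0.
under eq_fun do rewrite mulNr addrC -mulrBr.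
by apply: eta1_cvg; rewrite subr_gt0.
Qed.

Lemma bump_cvg a b x : boxbump n a b x @[n --> \oo] --> (\1_(box a b) x : R).
Proof.
have [xab|xab] := pselect (box a b x).
  rewrite indicE mem_set// -[true%:R]mulr1 -[X in X * _]mulr1.
  by apply: cvgM; [apply: cvgM|]; exact: bump1_cvg.
rewrite indicE memNset//; under eq_fun do rewrite bump_out//.
exact: cvg_cst.
Qed.

Lemma cbox_compact a b : compact (cbox a b).
Proof.
apply: bounded_closed_compact.
  exists (\sum_(i < 3) (`|a 0 i| + `|b 0 i|)); split; first exact: num_real.
  move=> y yM x xab /=; apply: ltW; apply: le_lt_trans yM.
  rewrite [leLHS]/Num.Def.normr /= mx_normrE.
  apply: bigmax_le => [|[i j] _].
    by apply: sumr_ge0 => i _; rewrite addr_ge0.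
  rewrite [i]ord1 /= (bigD1 j)//= ler_wpDr//.
    by apply: sumr_ge0 => k _; rewrite addr_ge0.
  have /andP[h1 h2] := xab j; rewrite ler_norml; apply/andP; split.
    apply: le_trans h1; rewrite lerNl; apply: le_trans (ler_norm _) _.
    by rewrite normrN lerDl.
  by apply: le_trans h2 _; apply: le_trans (ler_norm _) _; rewrite lerDr.
rewrite (_ : cbox a b = \bigcap_(i in [set: 'I_3])
   ((fun x : 'rV[R]_3 => x 0 i) @^-1` [set` `[a 0 i, b 0 i]])); last first.
  apply/seteqP; split=> x /=.
    by move=> xab i _; rewrite /= in_itv/=; exact: xab.
  by move=> xab i; have := xab i I; rewrite /= in_itv.
apply: closed_bigI => i _; apply: closed_comp; last exact: interval_closed.
by move=> x _; exact: coord_continuous.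
Qed.

Lemma box_sub_cbox a b : box a b `<=` cbox a b.
Proof. by move=> x xab i; have /andP[/ltW -> /ltW ->] := xab i. Qed.

Lemma bump_supp U n a b : cbox a b `<=` U -> compactly_supported U (boxbump n a b).
Proof.
move=> abU; exists (cbox a b); first by split => //; exact: cbox_compact.
by move=> x xab; apply: bump_out => /box_sub_cbox.
Qed.

End Bumps.

(** * The fundamental lemma of the calculus of variations *)

Section VanishingIntegrals.
Context {R : realType}.
Notation mu := (@leb3 R).
Local Open Scope ereal_scope.

(** The sets over which the integral of [g] vanishes are closed under complements
    and countable disjoint unions. Taking preimages under [p] allows to enlarge
    the class of sets one factor of a product at a time. *)
Lemma dynkin_preimage d (T : measurableType d) (p : prod3 R -> T)
  (Q E0 : set (prod3 R)) (g : prod3 R -> \bar R) (G : set (set T)) :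
  measurable_fun setT p -> measurable Q -> measurable E0 -> mu.-integrable Q g ->
  @measurable _ T = <<s G >> -> setI_closed G ->
  \int[mu]_(z in E0 `&` Q) g z = 0 ->
  (forall S, G S -> \int[mu]_(z in (E0 `&` p @^-1` S) `&` Q) g z = 0) ->
  forall S, measurable S -> \int[mu]_(z in (E0 `&` p @^-1` S) `&` Q) g z = 0.
Proof.
move=> mp mQ mE0 ig GE GI h0 hG S mS.
have mpre A : measurable A -> measurable (p @^-1` A).
  by move=> mA; rewrite -[X in measurable X]setTI; exact: mp.
have mA A : measurable A -> measurable ((E0 `&` p @^-1` A) `&` Q).
  by move=> /mpre ?; apply: measurableI => //; exact: measurableI.
have iA A : measurable A -> A `<=` Q -> mu.-integrable A g.
  by move=> ? AQ; exact: (integrableS mQ _ AQ ig).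
have := mS; rewrite GE => sGS.
apply: (@dynkin_induction _ T G (fun S => \int[mu]_(z in (E0 `&` p @^-1` S) `&` Q) g z = 0)) => //.
- by rewrite preimage_setT setIT.
- move=> A mA' hA.
  have E : E0 `&` Q = ((E0 `&` p @^-1` A) `&` Q) `|` ((E0 `&` p @^-1` (~` A)) `&` Q).
    rewrite -setIUl -setIUr preimage_setC setUv setIT//.
  have dAC : [disjoint (E0 `&` p @^-1` A) `&` Q & (E0 `&` p @^-1` (~` A)) `&` Q].
    by apply/disj_setPS => z [[[_ zA] _] [[_ /(_ zA)]]].
  move: h0; rewrite E integral_setU//.
  + by rewrite hA add0e.
  + exact: mA.
  + by apply: mA; exact: measurableC.
  + rewrite -E; apply: (measurable_int mu); apply: iA; last exact: subIsetr.
    exact: measurableI.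
- move=> F mF tF hF.
  rewrite preimage_bigcup setI_bigcupr setI_bigcupl integral_bigcup//.
  + by rewrite eseries0.
  + apply/trivIsetP => i j _ _ ij.
    move/trivIsetP : tF => /(_ i j I I ij) Fij.
    apply/seteqP; split=> // z [[[_ zi] _] [[_ zj] _]].
    by rewrite -[set0 z]/(set0 (p z)) -Fij.
  + by move=> k; exact: mA.
  + apply: iA; last by move=> z [k _] [].
    by apply: bigcupT_measurable => k; exact: mA.
Qed.

End VanishingIntegrals.

Section FundamentalLemma.
Context {R : realType}.
Variable Omega : set 'rV[R]_3.
Hypothesis Omega_open : open Omega.
Hypothesis Omega_bounded : bounded_set Omega.
Notation mu := (@leb3 R).
Notation D := (@pt R @^-1` Omega : set (prod3 R)).

Section OneFunction.
Variables (U : set 'rV[R]_3) (g : 'rV[R]_3 -> R).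
Hypothesis UO : U `<=` Omega.
Hypothesis gL : L2 Omega g.
Hypothesis gU : forall phi, bump_fun phi -> compactly_supported U phi ->
  inner Omega g phi = 0.

Let g' : prod3 R -> \bar R := EFin \o (g \o @pt R).

Lemma L2_integrable h : L2 Omega h -> mu.-integrable D (EFin \o (h \o @pt R)).
Proof.
move=> hL.
have oneL : L2 Omega (fun=> 1).
  apply: (L2_bounded Omega_open Omega_bounded (M := 1)) => [|x _]; last by rewrite normr1.
  exact: measurable_cst.
have := L2_int Omega_open hL oneL; congr (integrable _ _ _).
by apply/funext => z /=; rewrite mulr1.
Qed.

(** Dominated convergence: the bumps of the box are bounded by 1 and converge to
    its indicator function. *)
Lemma integral_box0 a b : cbox a b `<=` U ->
  (\int[mu]_(z in @pt R @^-1` box a b) g' z = 0)%E.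
Proof.
move=> abU.
have mD := measurable_dom Omega_open.
have mb n : measurable_fun D (boxbump n a b \o @pt R).
  apply: continuous_measurable; apply: C1_continuous.
  by apply: bump_fun_C1; exact: bump_is_bump.
have ig := L2_integrable gL.
have mg : measurable_fun D (g \o @pt R) by exact: measurable_L2.
have H n : (\int[mu]_(z in D) (g (pt z) * boxbump n a b (pt z))%:E = 0)%E.
  have bL : L2 Omega (boxbump n a b).
    apply: (L2_bounded Omega_open Omega_bounded (M := 1)) => // x _.
    by have /andP[b0 b1] := bump_itv n a b x; rewrite ger0_norm.
  have H0 := gU (bump_is_bump n a b) (bump_supp n abU).
  rewrite -[LHS]fineK; first by congr EFin; exact: H0.
  exact: (integrable_fin_num mD (L2_int Omega_open gL bL)).
have C : (\int[mu]_(z in D) (g (pt z) * boxbump n a b (pt z))%:E)%E @[n --> \oo] -->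
   (\int[mu]_(z in D) (g (pt z) * \1_(box a b) (pt z))%:E)%E.
  apply: (@dominated_cvg _ _ _ mu D mD _ _ (fun z => `|g (pt z)|%:E)).
  - by move=> n; apply/measurable_EFinP; exact: measurable_funM mg (mb n).
  - move=> z Dz; apply: cvg_EFin; first by near=> n.
    by apply: cvgMr; exact: bump_cvg.
  - by [].
  - exact: (integrable_abse ig).
  - move=> n z Dz; rewrite /= lee_fin normrM ler_piMr//.
    by have /andP[b0 b1] := bump_itv n a b (pt z); rewrite ger0_norm.
have : (\int[mu]_(z in D) (g (pt z) * \1_(box a b) (pt z))%:E = 0)%E.
  rewrite -(cvg_lim _ C)//; under eq_fun do rewrite H; exact: lim_cst.
move=> <-; rewrite (_ : @pt R @^-1` box a b = D `&` @pt R @^-1` box a b); last first.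
  by apply/seteqP; split=> z /=; [move=> zb; split=> //; apply/UO/abU/box_sub_cbox|case].
rewrite integral_mkcondr; apply: eq_integral => z _.
rewrite patchE indicE -[z \in _]/(pt z \in box a b).
by case: (pt z \in box a b); rewrite ?mulr1 ?mulr0.
Unshelve. all: by end_near. Qed.

Lemma prod_box (a b : 'rV[R]_3) : @pt R @^-1` box a b =
  (`]a 0 0, b 0 0[ `*` `]a 0 1, b 0 1[) `*` `]a 0 2%:R, b 0 2%:R[.
Proof.
apply/seteqP; split=> z /=; rewrite !in_itv /=.
  by move=> zb; have := zb 0; have := zb 1; have := zb 2%:R; rewrite pt0 pt1 pt2.
by move=> [[z0 z1] z2] i; case: (ord3P i) => ->; rewrite ?pt0 ?pt1 ?pt2.
Qed.

(** The integral of [g] over a box is zero, hence by Dynkin's theorem over every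
    measurable part of the cube. *)
Lemma ae0_cube c r : ccube c r `<=` U ->
  ae_eq mu (@pt R @^-1` cube c r) g' (cst 0%E).
Proof.
move=> cU; set Q := @pt R @^-1` cube c r.
have mQ : measurable Q by exact: measurable_cube.
have QD : Q `<=` D by move=> z zQ; apply/UO/cU => i; exact/ltW/zQ.
have ig : mu.-integrable Q g'.
  exact: (integrableS (measurable_dom Omega_open) mQ QD (L2_integrable gL)).
have Hbox a b : (\int[mu]_(z in @pt R @^-1` box a b `&` Q) g' z = 0)%E.
  rewrite (_ : _ `&` _ = @pt R @^-1` box (\row_i Num.max (a 0 i) (c 0 i - r))
     (\row_i Num.min (b 0 i) (c 0 i + r))).
    apply: integral_box0 => x xb; apply: cU => i; have := xb i.
    rewrite !mxE ge_max le_min => /andP[/andP[_ h1] /andP[_ h2]].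
    by rewrite ler_distl h1.
  apply/seteqP; split=> z /=.
    move=> [zb zQ] i; have /andP[h1 h2] := zb i; move: h1 h2 (zQ i); move: (pt z) => x h1 h2.
    by rewrite ltr_distl !mxE gt_max lt_min h1 h2.
  move=> zb; split=> i; have := zb i; move: (pt z) => x; rewrite !mxE gt_max lt_min.
    by move=> /andP[/andP[-> _] /andP[-> _]].
  by move=> /andP[/andP[_ h1] /andP[_ h2]]; rewrite ltr_distl h1.
pose I3 (a0 b0 a1 b1 a2 b2 : R) : set (prod3 R) :=
  (`]a0, b0[ `*` `]a1, b1[) `*` `]a2, b2[.
have H0 a0 b0 a1 b1 a2 b2 : (\int[mu]_(z in I3 a0 b0 a1 b1 a2 b2 `&` Q) g' z = 0)%E.
  have := Hbox (pt (a0, a1, a2)) (pt (b0, b1, b2)).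
  by rewrite prod_box !pt0 !pt1 !pt2.
have Qin z : Q z -> (z.1.1 \in `]c 0 0 - r, c 0 0 + r[) /\
   (z.1.2 \in `]c 0 1 - r, c 0 1 + r[) /\ (z.2 \in `]c 0 2%:R - r, c 0 2%:R + r[).
  move=> zQ; rewrite !in_itv /= -!ltr_distl.
  by have := zQ 0; have := zQ 1; have := zQ 2%:R; rewrite pt0 pt1 pt2 => -> -> ->.
have GR : @measurable _ (measurableTypeR R) = <<s @RGenOpens.G R >>.
  exact: RGenOpens.measurableE.
have GRI : setI_closed (@RGenOpens.G R).
  move=> _ _ [x [y ->]] [x' [y' ->]]; exists (Num.max x x'), (Num.min y y').
  apply/seteqP; split=> z /=; rewrite !in_itv /= gt_max lt_min.
    by move=> [/andP[-> ->] /andP[-> ->]].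
  by move=> /andP[/andP[-> ->] /andP[-> ->]].
have mT1 : measurable_fun setT (fun z : prod3 R => z.1.1) by exact: measurableT_comp.
have mT2 : measurable_fun setT (fun z : prod3 R => z.1.2) by exact: measurableT_comp.
have mI x y : measurable (`]x, y[ : set (measurableTypeR R)) by exact: measurable_itv.
have mX3 (A B C : set (measurableTypeR R)) : measurable A -> measurable B -> measurable C ->
   measurable ((A `*` B) `*` C).
  by move=> *; apply: measurableX => //; exact: measurableX.
(* The intervals of a box become measurable sets one after the other; then
   products of such sets become measurable sets of the plane and of space. *)
have S1 (A : set (measurableTypeR R)) a1 b1 a2 b2 : measurable A ->
   (\int[mu]_(z in ((A `*` `]a1, b1[) `*` `]a2, b2[) `&` Q) g' z = 0)%E.
  move=> mA.
  have := @dynkin_preimage R _ _ _ Q ((setT `*` `]a1, b1[) `*` `]a2, b2[) g' _ mT1 mQ _ ig GR GRI _ _ _ mA.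
  rewrite (_ : _ `&` (fun z : prod3 R => z.1.1) @^-1` A = (A `*` `]a1, b1[) `*` `]a2, b2[); last first.
    by apply/seteqP; split=> z /=; tauto.
  apply.
  - exact: mX3.
  - rewrite -(H0 (c 0 0 - r) (c 0 0 + r) a1 b1 a2 b2); congr (integral _ _ _).
    by rewrite /I3; apply/seteqP; split=> z /=; have := @Qin z; tauto.
  - move=> _ [x [y ->]]; rewrite -(H0 x y a1 b1 a2 b2) /I3; congr (integral _ _ _).
    by apply/seteqP; split=> z /=; tauto.
have S2 (A B : set (measurableTypeR R)) a2 b2 : measurable A -> measurable B ->
   (\int[mu]_(z in ((A `*` B) `*` `]a2, b2[) `&` Q) g' z = 0)%E.
  move=> mA mB.
  have := @dynkin_preimage R _ _ _ Q ((A `*` setT) `*` `]a2, b2[) g' _ mT2 mQ _ ig GR GRI _ _ _ mB.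
  rewrite (_ : _ `&` (fun z : prod3 R => z.1.2) @^-1` B = (A `*` B) `*` `]a2, b2[); last first.
    by apply/seteqP; split=> z /=; tauto.
  apply.
  - exact: mX3.
  - rewrite -(S1 A (c 0 1 - r) (c 0 1 + r) a2 b2 mA); congr (integral _ _ _).
    by apply/seteqP; split=> z /=; have := @Qin z; tauto.
  - move=> _ [x [y ->]]; rewrite -(S1 A x y a2 b2 mA); congr (integral _ _ _).
    by apply/seteqP; split=> z /=; tauto.
have S3 (A B C : set (measurableTypeR R)) : measurable A -> measurable B -> measurable C ->
   (\int[mu]_(z in ((A `*` B) `*` C) `&` Q) g' z = 0)%E.
  move=> mA mB mC.
  have := @dynkin_preimage R _ _ _ Q ((A `*` B) `*` setT) g' _ (@measurable_snd _ _ _ _) mQ _ ig GR GRI _ _ _ mC.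
  rewrite (_ : _ `&` snd @^-1` C = (A `*` B) `*` C); last first.
    by apply/seteqP; split=> z /=; tauto.
  apply.
  - exact: mX3.
  - rewrite -(S2 A B (c 0 2%:R - r) (c 0 2%:R + r) mA mB); congr (integral _ _ _).
    by apply/seteqP; split=> z /=; have := @Qin z; tauto.
  - move=> _ [x [y ->]]; rewrite -(S2 A B x y mA mB); congr (integral _ _ _).
    by apply/seteqP; split=> z /=; tauto.
have rectI d1 d2 (T1 : measurableType d1) (T2 : measurableType d2) :
  setI_closed [set A `*` B | A in @measurable _ T1 & B in @measurable _ T2].
  move=> _ _ [A mA [B mB <-]] [A' mA' [B' mB' <-]].
  exists (A `&` A'); first exact: measurableI.
  exists (B `&` B'); first exact: measurableI.
  by rewrite setXI.
have S4 (S : set (measurableTypeR R * measurableTypeR R)) (C : set (measurableTypeR R)) :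
   measurable S -> measurable C -> (\int[mu]_(z in (S `*` C) `&` Q) g' z = 0)%E.
  move=> mS mC.
  have := @dynkin_preimage R _ _ _ Q (setT `*` C) g' _ (@measurable_fst _ _ _ _) mQ _ ig
    (measurable_prod_measurableType _ _) (rectI _ _ _ _) _ _ _ mS.
  rewrite (_ : _ `&` fst @^-1` S = S `*` C); last first.
    by apply/seteqP; split=> z /=; tauto.
  apply.
  - exact: measurableX.
  - by rewrite -(S3 setT setT C)//; congr (integral _ _ _); rewrite setXTT.
  - move=> _ [A mA [B mB <-]]; rewrite -(S3 A B C)//; congr (integral _ _ _).
    by apply/seteqP; split=> z /=; tauto.
have S5 (S : set (prod3 R)) : measurable S -> (\int[mu]_(z in S `&` Q) g' z = 0)%E.
  move=> mS.
  have := @dynkin_preimage R _ _ _ Q setT g' _ (@measurable_id _ _ _) mQ _ ig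
    (measurable_prod_measurableType _ _) (rectI _ _ _ _) _ _ _ mS.
  move=> H; rewrite -[X in X `&` Q]setTI; apply: H.
  - exact: measurableT.
  - by rewrite -(S4 setT setT)//; congr (integral _ _ _); rewrite setXTT.
  - by move=> _ [A mA [B mB <-]]; rewrite setTI; exact: S4.
apply: integral_ae_eq => // E EQ mE.
by rewrite -[in LHS](setIidl EQ) S5// integral0.
Qed.

(** The fundamental lemma of the calculus of variations, from cubes to an open set
    by countable union. *)
Lemma ae0_open : open U -> {ae mu, forall z, U (pt z) -> g (pt z) = 0}.
Proof.
move=> oU.
have H (n : nat) : mu.-negligible (~` [set z | forall q, @unpickle (rat * rat * rat * nat)%type n = Some q ->
   ccube (rcenter q) (rradius q : R) `<=` U -> cube (rcenter q) (rradius q) (pt z) -> g (pt z) = 0]).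
  case E : (unpickle n) => [q|]; last first.
    by rewrite [X in ~` X](_ : _ = setT) ?setCT; [exact: negligible_set0|apply/seteqP; split].
  have [qU|qU] := pselect (ccube (rcenter q) (rradius q : R) `<=` U); last first.
    rewrite [X in ~` X](_ : _ = setT) ?setCT; first exact: negligible_set0.
    by apply/seteqP; split=> // z _ q' [<-].
  have := ae0_cube qU; apply: negligibleS => z /= H1 H2; apply: H1 => q' [<-] _ zq.
  by have := H2 zq => -[].
have := negligible_bigcup H; apply: negligibleS => z /= zU.
apply: contrapT => Hz; apply: zU => Uz.
move: (Uz); rewrite {1}(open_cubes oU) => -[q qU zq].
have [//|H2] := pselect (g (pt z) = 0); exfalso; apply: Hz.
exists (pickle q) => //= /(_ q); rewrite pickleK => /(_ erefl qU zq).
exact: H2.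
Qed.

End OneFunction.

End FundamentalLemma.

(** * Lebesgue measure under shears and swaps of the axes *)

Section LineMaps.
Context {R : realType}.
Local Open Scope ereal_scope.

(** Uniqueness of the Lebesgue measure: both sides agree on half-open intervals. *)
Lemma lebesgue_measure_affine (a b : R) (A : set (measurableTypeR R)) :
  a != 0%R -> measurable A ->
  lebesgue_measure ((fun t : R => a * t + b)%R @^-1` A) =
  (`|a|^-1)%:E * lebesgue_measure A.
Proof.
move=> a0 mA.
have mf : measurable_fun setT (fun t : measurableTypeR R => (a * t + b)%R : measurableTypeR R).
  by apply: measurable_funD => //; exact: measurable_funM.
have na : (0 <= `|a|)%R by [].
pose k : {nonneg R} := NngNum na.
have a1 : (`|a| != 0)%R by rewrite normr_eq0.
suff H : lebesgue_measure A = mscale k (pushforward lebesgue_measure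
    (fun t : measurableTypeR R => (a * t + b)%R : measurableTypeR R)) A.
  by rewrite (H mf) /mscale /= muleA -EFinM mulVf// mul1e.
move=> ?; apply: (@lebesgue_measure_unique R (mscale k (pushforward lebesgue_measure
    (fun t : measurableTypeR R => (a * t + b)%R : measurableTypeR R)))) => //.
move=> _ [[c d]] _ <- /=; rewrite /mscale /= /pushforward.
rewrite lebesgue_measure_itv /= lte_fin.
case: (ltrgtP a 0%R) (a0) => // a0' _.
- have -> : (fun t : R => a * t + b)%R @^-1` `]c, d]%classic =
     `[((d - b) / a)%R, ((c - b) / a)%R[%classic.
    by apply/seteqP; split=> t /=; rewrite !in_itv /= ler_ndivrMr// ltr_ndivlMr//
      lerBrDr ltrBlDr [(t * a)%R]mulrC andbC.
  rewrite lebesgue_measure_itv /= lte_fin ltr_ndivlMr// divfK// ltrD2r.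
  case: ifPn => cd; last by rewrite mule0.
  rewrite -!EFinB -EFinM ltr0_norm//; congr _%:E; field.
  by rewrite lt_eqF.
- have -> : (fun t : R => a * t + b)%R @^-1` `]c, d]%classic =
     `]((c - b) / a)%R, ((d - b) / a)%R]%classic.
    by apply/seteqP; split=> t /=; rewrite !in_itv /= ltr_pdivrMr// ler_pdivlMr//
      ltrBlDr lerBrDr [(t * a)%R]mulrC.
  rewrite lebesgue_measure_itv /= lte_fin ltr_pdivrMr// divfK ?gt_eqF// ltrD2r.
  case: ifPn => cd; last by rewrite mule0.
  rewrite -!EFinB -EFinM gtr0_norm//; congr _%:E; field.
  by rewrite gt_eqF.
Qed.

End LineMaps.

Section ProductPushforward.
Context d1 d2 (T1 : measurableType d1) (T2 : measurableType d2) (R : realType).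
Variables (m1 : {sigma_finite_measure set T1 -> \bar R})
  (m2 : {sigma_finite_measure set T2 -> \bar R}).

(** Uniqueness of the product measure. *)
Lemma product_pushforward (f : T1 * T2 -> T1 * T2) : measurable_fun setT f ->
  (forall A B, measurable A -> measurable B ->
     ((m1 \x m2) (f @^-1` (A `*` B)) = m1 A * m2 B)%E) ->
  forall E, measurable E -> ((m1 \x m2) (f @^-1` E) = (m1 \x m2) E)%E.
Proof.
move=> mf H E mE; apply/esym.
by apply: (@product_measure_unique _ _ _ _ R m1 m2
  (pushforward (m1 \x m2)%E f)) => //.
Qed.

End ProductPushforward.

Section PlaneMeasure.
Context {R : realType}.
Notation lam := (@lebesgue_measure R).

(** The measure of the plane under a name of its own, to be registered as
    sigma-finite and used as a factor in turn. *)
Definition mlam2 : set (measurableTypeR R * measurableTypeR R) -> \bar R := (lam \x lam)%E.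
HB.instance Definition _ := measure_function.Measure.on mlam2.
Lemma mlam2_sigma_finite : sigma_finite setT mlam2.
Proof.
have /sigma_finiteP[F [TF ndF Foo]] := sigma_finiteT lam.
exists (fun n => F n `*` F n).
  rewrite -setXTT {1 2}TF predeqE => -[x y]; split.
    move=> [/= [n _ Fnx] [k _ Gky]]; exists (maxn n k) => //; split.
    - by move: x Fnx; exact/subsetPset/ndF/leq_maxl.
    - by move: y Gky; exact/subsetPset/ndF/leq_maxr.
  by move=> [n _ []/= ? ?]; split; exists n.
move=> k; have [? ?] := Foo k.
split; first exact: measurableX.
rewrite /mlam2 product_measure1E// lte_mul_pinfty// ge0_fin_numE//.
Qed.
HB.instance Definition _ := Measure_isSigmaFinite.Build _ _ _ mlam2 mlam2_sigma_finite.

End PlaneMeasure.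

Section Scaling.
Context {R : realType}.
Notation mu := (@leb3 R).
Notation mu2 := (@mlam2 R).
Notation lam := (@lebesgue_measure R).
Implicit Types (T : 'rV[R]_3 -> 'rV[R]_3) (A : 'M[R]_3) (c : R).

Definition coordmap T : prod3 R -> prod3 R := fun z => unpt (T (pt z)).

(** The constants multiply under composition, so a linear map can be treated through
    a factorization; with preimages no measurability of images is involved. *)
Definition scales T c := measurable_fun setT (coordmap T) /\
  forall E, measurable E -> mu (coordmap T @^-1` E) = (c%:E * mu E)%E.

Lemma coordmap_comp T1 T2 : coordmap (T1 \o T2) = coordmap T1 \o coordmap T2.
Proof. by apply/funext => z; rewrite /coordmap /= unptK. Qed.

Lemma scales_comp T1 T2 c1 c2 : scales T1 c1 -> scales T2 c2 ->
  scales (T1 \o T2) (c1 * c2).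
Proof.
move=> [m1 h1] [m2 h2]; rewrite /scales coordmap_comp; split.
  exact: measurableT_comp.
move=> E mE; rewrite comp_preimage h2 ?h1 ?EFinM ?muleA 1?[(c2%:E * _)%E]muleC//.
by rewrite -[X in measurable X]setTI; exact: m1.
Qed.

Lemma eq_scales T1 T2 c1 c2 : T1 =1 T2 -> c1 = c2 -> scales T1 c1 -> scales T2 c2.
Proof. by move=> /funext -> ->. Qed.

Lemma scales_id : scales id 1.
Proof.
rewrite /scales (_ : coordmap id = id); last by apply/funext => z; rewrite /coordmap ptK.
by split=> // E mE; rewrite mul1e.
Qed.

Lemma leb3E (E : set (prod3 R)) :
  mu E = (\int[mu2]_w lam (xsection E w))%E.
Proof. by []. Qed.

Lemma measurable_coordmap T : (forall i, measurable_fun setT (fun z : prod3 R => T (pt z) 0 i)) ->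
  measurable_fun setT (coordmap T).
Proof.
move=> H; apply: measurable_fun_pair; last exact: (H 2%:R).
by apply: measurable_fun_pair; [exact: (H 0)|exact: (H 1)].
Qed.

Definition shear2 (w : 'rV[R]_3) (b : R) (x : 'rV[R]_3) : 'rV[R]_3 :=
  \row_i (if i == 2%:R then dot x w + b else x 0 i).

Lemma dot3 (x w : 'rV[R]_3) : dot x w = x 0 0 * w 0 0 + x 0 1 * w 0 1 + x 0 2%:R * w 0 2%:R.
Proof. by rewrite /dot sum3E. Qed.

(** Tonelli's theorem: on the lines parallel to the last axis the map is affine of
    slope [w 0 2]. *)
Lemma scales_shear2 (w : 'rV[R]_3) (b : R) : w 0 2%:R != 0 -> scales (shear2 w b) `|w 0 2%:R|^-1.
Proof.
move=> w0.
have mT : measurable_fun setT (coordmap (shear2 w b)).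
  apply: measurable_coordmap => i.
  case: (eqVneq i 2%:R) => [->|i2]; last first.
    under eq_fun do rewrite mxE (negbTE i2); exact: measurable_coord.
  under eq_fun do rewrite mxE eqxx dot3.
  apply: measurable_funD => //.
  by do 2?[apply: measurable_funD]; apply: measurable_funM => //; exact: measurable_coord.
split=> // E mE.
rewrite !leb3E -ge0_integralZl//; last exact: measurable_fun_xsection.
apply: eq_integral => -[x y] _.
rewrite -(@lebesgue_measure_affine _ (w 0 2%:R) (x * w 0 0 + y * w 0 1 + b))//; last first.
  exact: measurable_xsection.
congr (lam _); apply/seteqP; split=> t; rewrite /xsection /= !inE /=;
  rewrite /coordmap /unpt /= ![shear2 _ _ _ _ _]mxE /= dot3 !pt0 !pt1 !pt2 /=;
  by rewrite (_ : x * w 0 0 + y * w 0 1 + t * w 0 2%:R + b =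
                  w 0 2%:R * t + (x * w 0 0 + y * w 0 1 + b))//; ring.
Qed.

Definition swap01 (x : 'rV[R]_3) : 'rV[R]_3 := pt (x 0 1, x 0 0, x 0 2%:R).
Definition swap12 (x : 'rV[R]_3) : 'rV[R]_3 := pt (x 0 0, x 0 2%:R, x 0 1).

Definition swap2 (w : measurableTypeR R * measurableTypeR R) := (w.2, w.1).

Lemma measurable_swap2 : measurable_fun setT swap2.
Proof. exact: measurable_fun_pair. Qed.

Lemma leb2_swap (A : set (measurableTypeR R * measurableTypeR R)) : measurable A ->
  mu2 (swap2 @^-1` A) = mu2 A.
Proof.
move=> mA.
apply: (@product_pushforward _ _ _ _ R lam lam _ measurable_swap2 _ A mA).
move=> A1 A2 mA1 mA2.
rewrite (_ : _ @^-1` _ = A2 `*` A1); last by apply/seteqP; split=> -[? ?] /=; tauto.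
by rewrite muleC; exact: product_measure1E.
Qed.

Lemma scales_swap01 : scales swap01 1.
Proof.
have mT : measurable_fun setT (coordmap swap01).
  by apply: measurable_coordmap => i; case: (ord3P i) => ->; rewrite /swap01;
  [under eq_fun do rewrite pt0|under eq_fun do rewrite pt1|under eq_fun do rewrite pt2];
  exact: measurable_coord.
split=> // E mE; rewrite mul1e.
apply: (@product_pushforward _ _ _ _ R (@mlam2 R) lam _ mT _ E mE).
move=> A B mA mB; rewrite -[LHS]/(mu _).
have -> : coordmap swap01 @^-1` (A `*` B) = (swap2 @^-1` A) `*` B.
  by apply/seteqP; split=> -[[x y] t]; rewrite /coordmap /swap01 /unpt /= ?(pt0,pt1,pt2) /=.
transitivity (mu2 (swap2 @^-1` A) * lam B)%E; last first.
  by congr (_ * _)%E; exact: leb2_swap.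
apply: product_measure1E => //.
by rewrite -[X in measurable X]setTI; exact: measurable_swap2.
Qed.

(** The last axis is the outer factor of the triple product, so that this swap
    does not act on a single factor; Tonelli's theorem evaluates it on products
    of measurable sets. *)
Lemma scales_swap12 : scales swap12 1.
Proof.
have mT : measurable_fun setT (coordmap swap12).
  by apply: measurable_coordmap => i; case: (ord3P i) => ->; rewrite /swap12;
  [under eq_fun do rewrite pt0|under eq_fun do rewrite pt1|under eq_fun do rewrite pt2];
  exact: measurable_coord.
split=> // E mE; rewrite mul1e.
apply: (@product_pushforward _ _ _ _ R (@mlam2 R) lam _ mT _ E mE).
move=> A B mA mB; rewrite -[LHS]/(mu _) leb3E.
have -> : (\int[mu2]_w lam (xsection (coordmap swap12 @^-1` (A `*` B)) w) =
   \int[mu2]_w ((\1_B w.2)%:E * lam (xsection A w.1)))%E.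
  apply: eq_integral => -[x y] _ /=.
  rewrite indicE; have [yB|yB] := boolP (y \in B).
    rewrite mul1e; congr (lam _); apply/seteqP; split=> t; rewrite /xsection /= !inE /=;
      rewrite /coordmap /swap12 /unpt /= ?(pt0,pt1,pt2) /= inE in yB *; tauto.
  rewrite mul0e (_ : xsection _ _ = set0) ?measure0//.
  apply/seteqP; split=> t //; rewrite /xsection /= !inE /=.
  rewrite /coordmap /swap12 /unpt /= ?(pt0,pt1,pt2) /= => -[_ yB'].
  by move: yB; rewrite notin_setE.
have mxs : measurable_fun setT (fun x => lam (xsection A x)) by exact: measurable_fun_xsection.
have mi : measurable_fun setT (fun w : measurableTypeR R * measurableTypeR R => ((\1_B w.2)%:E : \bar R)).
  by apply/measurable_EFinP; apply: measurableT_comp => //; exact: measurable_indic.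
rewrite /mlam2 fubini_tonelli1//; last 2 first.
- apply: emeasurable_funM => //.
  by apply: (measurableT_comp mxs); exact: measurable_fst.
- by move=> w; rewrite mule_ge0// lee_fin indicE.
rewrite /fubini_F /=.
under eq_integral => x _.
  rewrite ge0_integralZr//; last first.
    by apply/measurable_EFinP; exact: measurable_indic.
  rewrite integral_indic// setIT.
  over.
rewrite ge0_integralZl//.
by rewrite muleC.
Qed.

End Scaling.

(** * Lebesgue measure under affine maps *)

Lemma lup_decomposition (F : fieldType) n (A : 'M[F]_n.+1) : exists P L U : 'M[F]_n.+1,
  [/\ is_perm_mx P, P *m A = L *m U, \det L = 1,
     forall i j : 'I_n.+1, (i <= j)%N -> L i j = (i == j)%:R
   & forall i j : 'I_n.+1, (j < i)%N -> U i j = 0].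
Proof.
have := cormen_lup_perm A; have := cormen_lup_correct A.
have := cormen_lup_detL A; have := @cormen_lup_lower _ _ A; have := @cormen_lup_upper _ _ A.
by case: (cormen_lup A) => [[P L] U] /= *; exists P, L, U.
Qed.

Lemma Rintegral_scaled d (X : measurableType d) (R : realType)
  (nu : {measure set X -> \bar R}) (T : X -> X) (c : R) (E : set X) (f : X -> R) :
  0 <= c -> measurable_fun setT T ->
  (forall A, measurable A -> nu (T @^-1` A) = (c%:E * nu A)%E) ->
  measurable E -> nu.-integrable E (EFin \o f) ->
  \int[nu]_(z in T @^-1` E) f (T z) = c * \int[nu]_(z in E) f z.
Proof.
move=> c0 mT hT mE intf.
have mf : measurable_fun E (EFin \o f) := measurable_int nu intf.
have H g : measurable_fun E g -> (forall z, (0 <= g z)%E) ->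
  (\int[nu]_(z in T @^-1` E) g (T z) = c%:E * \int[nu]_(z in E) g z)%E.
  move=> mg g0; pose k : {nonneg R} := NngNum c0.
  rewrite -[c]/(k%:num) -ge0_integral_mscale// -(ge0_integral_pushforward mT _ mE mg)//.
  by apply: eq_measure_integral => A mA _; exact: hT.
rewrite /Rintegral.
rewrite (eq_integral ((EFin \o f) \o T)); last by [].
rewrite integralE [in RHS]integralE.
have Ep := H _ (measurable_funepos mf) (funepos_ge0 _).
have En := H _ (measurable_funeneg mf) (funeneg_ge0 _).
under eq_integral do rewrite funepos_comp.
under [X in (_ - X)%E]eq_integral do rewrite funeneg_comp.
rewrite Ep En.
have fp := integrable_pos_fin_num mE intf.
have fn := integrable_neg_fin_num mE intf.
rewrite -(fineK fp) -(fineK fn) -!EFinM -!EFinB /=.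
by rewrite mulrBr.
Qed.

Section LinearMaps.
Context {R : realType}.
Notation mu := (@leb3 R).
Implicit Types (T : 'rV[R]_3 -> 'rV[R]_3) (A : 'M[R]_3) (c : R).

(** [T] acts on row vectors, so that [x *m A] replaces [A x]. *)
Definition lin A : 'rV[R]_3 -> 'rV[R]_3 := fun x => x *m A.

Lemma linE A x i : lin A x 0 i = \sum_(j < 3) x 0 j * A j i.
Proof. by rewrite mxE. Qed.

Definition scaling A := scales (lin A) `|\det A|^-1.

Lemma scaling_mul A B : scaling A -> scaling B -> scaling (A *m B).
Proof.
move=> hA hB; apply: eq_scales (scales_comp hB hA) => [x|].
  by rewrite /= /lin mulmxA.
by rewrite det_mulmx normrM invfM mulrC.
Qed.

Lemma swap01E : swap01 =1 lin (tperm_mx 0 1).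
Proof.
move=> x; apply/rowP => i; rewrite /lin -xcolE [RHS]mxE /swap01.
by case: (ord3P i) => ->; rewrite ?pt0 ?pt1 ?pt2 ?tpermL ?tpermR ?tpermD.
Qed.

Lemma swap12E : swap12 =1 lin (tperm_mx 1 2%:R).
Proof.
move=> x; apply/rowP => i; rewrite /lin -xcolE [RHS]mxE /swap12.
by case: (ord3P i) => ->; rewrite ?pt0 ?pt1 ?pt2 ?tpermL ?tpermR ?tpermD.
Qed.

Lemma scaling_perm (s : 'S_3) : scaling (perm_mx s).
Proof.
have h1 (t : 'S_3) : `|\det (perm_mx t : 'M[R]_3)|^-1 = 1.
  by rewrite det_perm normrX normrN1 expr1n invr1.
have h01 : scaling (tperm_mx 0 1).
  by apply: eq_scales scales_swap01; [exact: swap01E|rewrite h1].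
have h12 : scaling (tperm_mx 1 2%:R).
  by apply: eq_scales scales_swap12; [exact: swap12E|rewrite h1].
have htp (i j : 'I_3) : i != j -> scaling (tperm_mx i j).
  have h02 : scaling (tperm_mx 0 2%:R).
    have := scaling_mul (scaling_mul h01 h12) h01.
    rewrite /tperm_mx -!perm_mxM; congr (scaling (perm_mx _)).
    by apply/perm.permP => k; case: (ord3P k) => ->; rewrite !permE /= !permE /= ?permE.
  by case: (ord3P i) => ->; case: (ord3P j) => ->; rewrite ?eqxx// => _;
    rewrite // /tperm_mx tpermC.
have [ts -> dts] := prod_tpermP s.
elim: ts dts => [_|[i j] ts IH /= /andP[ij /IH h]].
  rewrite big_nil perm_mx1; apply: eq_scales scales_id => [x|].
    by rewrite /lin mulmx1.
  by rewrite det1 normr1 invr1.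
by rewrite big_cons perm_mxM; apply: scaling_mul => //; exact: htp.
Qed.

(** Multiplication by this matrix changes the [k]-th coordinate only; a triangular
    matrix is a product of three such matrices. *)
Definition colmx (k : 'I_3) (w : 'rV[R]_3) : 'M[R]_3 :=
  \matrix_(i, j) (if j == k then w 0 i else (i == j)%:R).

Lemma lin_colmx k w x i : lin (colmx k w) x 0 i = if i == k then dot x w else x 0 i.
Proof.
rewrite linE; case: ifPn => [/eqP ->|ik].
  by apply: eq_bigr => j _; rewrite mxE eqxx.
rewrite (bigD1 i)//= mxE (negbTE ik) eqxx mulr1 big1 ?addr0// => j ji.
by rewrite mxE (negbTE ik) (negbTE ji) mulr0.
Qed.

Lemma det_colmx k w : \det (colmx k w) = w 0 k.
Proof.
rewrite (expand_det_row _ k) (bigD1 k)//= big1 => [|j jk]; last first.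
  by rewrite mxE (negbTE jk) eq_sym (negbTE jk) mul0r.
rewrite mxE eqxx addr0 /cofactor.
rewrite (_ : row' k (col' k (colmx k w)) = 1%:M).
  by rewrite det1 mulr1 -signr_odd addnn odd_double expr0 mulr1.
by apply/matrixP => i j; rewrite !mxE [lift k j == k]eq_sym (negbTE (neq_lift k j)) (inj_eq lift_inj).
Qed.

(** Conjugation by a transposition brings the coordinate [k] to the last place. *)
Lemma scaling_colmx k (w : 'rV[R]_3) : w 0 k != 0 -> scaling (colmx k w).
Proof.
have h2 (v : 'rV[R]_3) : v 0 2%:R != 0 -> scaling (colmx 2%:R v).
  move=> v2; apply: eq_scales (scales_shear2 0 v2); last by rewrite det_colmx.
  by move=> x; apply/rowP => i; rewrite lin_colmx mxE addr0.
have [->|k2] := eqVneq k 2%:R; first exact: h2.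
move=> wk; pose v := w *m tperm_mx k 2%:R.
have v2 : v 0 2%:R != 0 by rewrite /v -xcolE mxE tpermR.
have := scaling_mul (scaling_mul (scaling_perm (tperm k 2%:R)) (h2 _ v2)) (scaling_perm (tperm k 2%:R)).
congr scaling; apply/matrixP => i j.
rewrite -/(tperm_mx _ _) -xcolE mxE -xrowE mxE mxE /v -xcolE mxE.
have -> : (tperm k 2%:R j == 2%:R) = (j == k).
  by rewrite -{2}(tpermL k 2%:R) (inj_eq perm_inj).
rewrite mxE tpermK; case: ifPn => // jk; by rewrite (inj_eq perm_inj).
Qed.

(** Gaussian elimination: permutation matrices preserve the volume, and a
    triangular matrix is a product of maps changing one coordinate. *)
Lemma scaling_unitmx A : \det A != 0 -> scaling A.
Proof.
move=> dA.
have [P [L [U [/is_perm_mxP[s Ps] PA dL Ll Uu]]]] := lup_decomposition A.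
have dU : \det U != 0.
  apply: contraNneq dA => dU.
  have : \det (P *m A) = 0 by rewrite PA det_mulmx dU mulr0.
  move/eqP; rewrite det_mulmx mulf_eq0 Ps det_perm => /orP[|/eqP ->//].
  by rewrite signr_eq0.
have Udiag k : U k k != 0.
  apply: contraNneq dU => Ukk; rewrite -det_tr det_trig; last first.
    by apply/is_trig_mxP => i j ij; rewrite mxE Uu.
  by rewrite (bigD1 k)//= mxE Ukk mul0r.
have hL : scaling L.
  have h k : scaling (colmx k (col k L)^T) by apply: scaling_colmx; rewrite !mxE Ll// eqxx oner_neq0.
  apply: eq_scales (scales_comp (h 2%:R) (scales_comp (h 1) (h 0))) => [x|]; last first.
    by rewrite !det_colmx !mxE !Ll// !eqxx dL normr1 invr1 !mulr1.
  have e01 : L 0 1 = 0 by rewrite Ll.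
  have e02 : L 0 2%:R = 0 by rewrite Ll.
  have e12 : L 1 2%:R = 0 by rewrite Ll.
  by apply: rV3P; rewrite /= !(lin_colmx, linE) /= ?dot3 ?lin_colmx /= ?dot3 ?sum3E
     ?lin_colmx /= ?mxE ?e01 ?e02 ?e12 ?mulr0 ?add0r.
have hU : scaling U.
  have h k : scaling (colmx k (col k U)^T) by apply: scaling_colmx; rewrite !mxE.
  apply: eq_scales (scales_comp (h 0) (scales_comp (h 1) (h 2%:R))) => [x|]; last first.
    rewrite !det_colmx !mxE -[\det U]det_tr det_trig; last first.
      by apply/is_trig_mxP => i j ij; rewrite mxE Uu.
    by rewrite !big_ord_recl big_ord0 !mxE mulr1 !normrM !invfM; congr (_^-1 * (_^-1 * _^-1));
      congr `|U _ _|; exact/val_inj.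
  have e10 : U 1 0 = 0 by rewrite Uu.
  have e20 : U 2%:R 0 = 0 by rewrite Uu.
  have e21 : U 2%:R 1 = 0 by rewrite Uu.
  by apply: rV3P; rewrite /= !(lin_colmx, linE) /= ?dot3 ?lin_colmx /= ?dot3 ?sum3E
     ?lin_colmx /= ?mxE ?e10 ?e20 ?e21 ?mulr0 ?addr0.
have -> : A = perm_mx s^-1 *m (L *m U).
  by rewrite -PA Ps mulmxA -perm_mxM mulVg perm_mx1 mul1mx.
by apply: scaling_mul; [exact: scaling_perm|exact: scaling_mul].
Qed.

Lemma scales_translation (a : 'rV[R]_3) : scales (fun x => x + a) 1.
Proof.
pose e : 'rV[R]_3 := delta_mx 0 2%:R.
have e2 : e 0 2%:R != 0 by rewrite mxE !eqxx oner_neq0.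
have h2 b : scales (fun x => x + b *: e) 1.
  apply: eq_scales (scales_shear2 b e2); last by rewrite mxE !eqxx normr1 invr1.
  move=> x; apply: rV3P; rewrite !mxE /= ?mulr0 ?addr0//.
  by rewrite dot3 !mxE /= !mulr0 !add0r !mulr1.
have h (k : 'I_3) (b : R) : scales (fun x => x + b *: delta_mx 0 k) 1.
  have hp := scaling_perm (tperm k 2%:R).
  apply: eq_scales (scales_comp hp (scales_comp (h2 b) hp)) => [x|]; last first.
    by rewrite det_perm normrX normrN1 expr1n invr1 !mul1r.
  rewrite /= /lin mulmxDl -mulmxA -perm_mxM tperm2 perm_mx1 mulmx1 -scalemxAl.
  congr (_ + _ *: _); rewrite /e -rowE; apply/rowP => j; rewrite !mxE /= tpermR.
  by rewrite eq_sym.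
apply: eq_scales (scales_comp (h 0 (a 0 0)) (scales_comp (h 1 (a 0 1)) (h 2%:R (a 0 2%:R)))) => [x|].
  by rewrite /= [in RHS](row_delta a) sum3E -!addrA; congr (_ + _); rewrite addrC -addrA addrCA addrC -!addrA; congr (_ + _); rewrite addrC.
by rewrite !mul1r.
Qed.

Lemma scales_affine a A : \det A != 0 -> scales (fun x => a + x *m A) `|\det A|^-1.
Proof.
move=> /scaling_unitmx hA; apply: eq_scales (scales_comp (scales_translation a) hA) => [x|].
  by rewrite /= addrC.
by rewrite mul1r.
Qed.

Lemma scales_integral T c (E : set 'rV[R]_3) (f : 'rV[R]_3 -> R) : 0 <= c -> scales T c ->
  measurable (@pt R @^-1` E : set (prod3 R)) ->
  mu.-integrable (@pt R @^-1` E) (EFin \o (f \o @pt R)) ->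
  vint (T @^-1` E) (f \o T) = c * vint E f.
Proof.
move=> c0 [mT hT] mE intf; rewrite /vint.
rewrite -(Rintegral_scaled c0 mT hT mE intf).
rewrite (_ : @pt R @^-1` (T @^-1` E) = coordmap T @^-1` (@pt R @^-1` E)).
  by apply: eq_Rintegral => z _; rewrite /coordmap /= unptK.
by apply/seteqP; split=> z; rewrite /coordmap /= unptK.
Qed.

End LinearMaps.

(** * Integrals over triangles and tetrahedra *)

Section BoundedIntegrals.
Context {R : realType}.
Notation mu := (@leb3 R).
Notation mu2 := (@mlam2 R).
Notation lam := (@lebesgue_measure R).
Implicit Types (F : 'rV[R]_3 -> R) (a b c d : 'rV[R]_3).

Lemma contD (f g : 'rV[R]_3 -> R) : continuous f -> continuous g ->
  continuous (fun x => f x + g x).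
Proof. by move=> cf cg x; exact: (@continuousD _ _ _ f g x (cf x) (cg x)). Qed.

Lemma contB (f g : 'rV[R]_3 -> R) : continuous f -> continuous g ->
  continuous (fun x => f x - g x).
Proof. by move=> cf cg x; exact: (@continuousB _ _ _ f g x (cf x) (cg x)). Qed.

Lemma contM (f g : 'rV[R]_3 -> R) : continuous f -> continuous g ->
  continuous (fun x => f x * g x).
Proof. by move=> cf cg x; exact: (@continuousM _ _ f g x (cf x) (cg x)). Qed.

Lemma continuous_derive (w : 'rV[R]_3) F : C1 F -> continuous (fun x => 'D_w F x).
Proof.
move=> [dF cpF].
rewrite (_ : (fun x => _) = fun x => \sum_(i < 3) w 0 i * partial i F x); last first.
  by apply/funext => x; exact: derive_partial.
rewrite (_ : (fun x => _) = fun x => w 0 0 * partial 0 F x + w 0 1 * partial 1 F x + w 0 2%:R * partial 2%:R F x); last first.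
  by apply/funext => x; rewrite sum3E.
by do 2?[apply: contD]; apply: contM => //; exact: cst_continuous.
Qed.

Lemma continuous_bounded F (r : R) : continuous F ->
  exists M, forall x, ccube 0 r x -> `|F x| <= M.
Proof.
move=> cF.
have cc : compact (ccube (0 : 'rV[R]_3) r).
  rewrite (_ : ccube 0 r = cbox (const_mx (- r)) (const_mx r)); first exact: cbox_compact.
  by apply/seteqP; split=> x xr i; have := xr i; rewrite !mxE subr0 ler_norml.
have cFF : compact (F @` ccube 0 r).
  by apply: continuous_compact => //; apply: continuous_subspaceT.
have [M [_ HM]] := compact_bounded cFF.
exists (M + 1) => x xr; apply: (HM (M + 1)); first by rewrite ltrDl.
by exists x.
Qed.

Lemma bounded_integrable3 (E : set 'rV[R]_3) (r M : R) (f : 'rV[R]_3 -> R) :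
  measurable (@pt R @^-1` E : set (prod3 R)) -> E `<=` ccube 0 r ->
  measurable_fun (@pt R @^-1` E) (f \o @pt R : prod3 R -> R) ->
  (forall x, E x -> `|f x| <= M) ->
  mu.-integrable (@pt R @^-1` E) (EFin \o (f \o @pt R)).
Proof.
move=> mE Er mf fM; apply: measurable_bounded_integrable => //.
  apply: le_lt_trans (leb3_cube (0 : 'rV[R]_3) (`|r| + 1)); apply: le_measure; rewrite ?inE//.
    exact: measurable_cube.
  move=> z /Er zr i; apply: le_lt_trans (zr i) _.
  by rewrite (le_lt_trans (ler_norm r))// ltrDl.
exists M; split => [|y My z Ez]; first exact: num_real.
by apply: le_trans (ltW My); exact: fM.
Qed.

Lemma continuous_integrable3 (E : set 'rV[R]_3) (r : R) F :
  measurable (@pt R @^-1` E : set (prod3 R)) -> E `<=` ccube 0 r -> continuous F ->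
  mu.-integrable (@pt R @^-1` E) (EFin \o (F \o @pt R)).
Proof.
move=> mE Er cF; have [M HM] := continuous_bounded r cF.
apply: (bounded_integrable3 (M := M) mE Er); first exact: continuous_measurable.
by move=> x /Er; exact: HM.
Qed.

Lemma measurable_closed (E : set 'rV[R]_3) : closed E ->
  measurable (@pt R @^-1` E : set (prod3 R)).
Proof.
by rewrite -openC => /measurable_open /measurableC; rewrite -preimage_setC setCK.
Qed.

Lemma unit_triangle_closed : measurable (@unit_triangle R : set (measurableTypeR R * measurableTypeR R)).
Proof.
have -> : @unit_triangle R = [set z | [&& 0 <= z.1, 0 <= z.2 & z.1 + z.2 <= 1]].
  apply/seteqP; split=> z /=; first by move=> [-> -> ->].
  by move=> /and3P[].
have mle (f g : measurableTypeR R * measurableTypeR R -> R) :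
    measurable_fun setT f -> measurable_fun setT g -> measurable [set z | f z <= g z].
  move=> mf mg; have H := measurable_fun_ler mf mg.
  by have := H measurableT [set true] I; rewrite setTI.
have m1 : measurable_fun setT (fun z : measurableTypeR R * measurableTypeR R => z.1) by exact: measurable_fst.
have m2 : measurable_fun setT (fun z : measurableTypeR R * measurableTypeR R => z.2) by exact: measurable_snd.
have m3 : measurable_fun setT (fun z : measurableTypeR R * measurableTypeR R => z.1 + z.2) by exact: measurable_funD.
have mc (k : R) : measurable_fun setT (fun z : measurableTypeR R * measurableTypeR R => k) by exact: measurable_cst.
have -> : [set z : R * R | [&& 0 <= z.1, 0 <= z.2 & z.1 + z.2 <= 1]] =
   [set z | 0 <= z.1] `&` ([set z | 0 <= z.2] `&` [set z | z.1 + z.2 <= 1]).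
  by apply/seteqP; split=> z /=; [move=> /and3P[]|move=> [-> [-> ->]]].
by apply: measurableI; [exact: mle (mc 0) m1|apply: measurableI; [exact: mle (mc 0) m2|exact: mle m3 (mc 1)]].
Qed.

Lemma mlam2_triangle : (mu2 (@unit_triangle R) < +oo)%E.
Proof.
apply: (@le_lt_trans _ _ (mu2 (`[0, 1]%classic `*` `[0, 1]%classic))).
  apply: le_measure; rewrite ?inE.
  - exact: unit_triangle_closed.
  - by apply: measurableX; exact: measurable_itv.
  - move=> z [z1 z2 z12] /=; rewrite !in_itv /= z1 z2 /=.
    by split; apply: le_trans z12; rewrite ?lerDl ?lerDr.
have -> : mu2 (`[0, 1]%classic `*` `[0, 1]%classic) =
    (lam `[0%R, 1%R]%classic * lam `[0%R, 1%R]%classic)%E.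
  by apply: product_measure1E; exact: measurable_itv.
by rewrite lebesgue_measure_itv /= lte_fin ltr01 -EFinB -EFinM ltry.
Qed.

Definition tripoint a b c (z : R * R) := a + z.1 *: (b - a) + z.2 *: (c - a).

Definition triI a b c F := \int[@leb2 R]_(z in @unit_triangle R) F (tripoint a b c z).

Lemma measurable_tripoint a b c F : continuous F ->
  measurable_fun setT (fun z : measurableTypeR R * measurableTypeR R => F (tripoint a b c z)).
Proof.
move=> cF.
have m : measurable_fun setT (fun z : measurableTypeR R * measurableTypeR R => unpt (tripoint a b c z)).
  have mi (i : 'I_3) : measurable_fun setT
     (fun z : measurableTypeR R * measurableTypeR R => tripoint a b c z 0 i).
    under eq_fun do rewrite !mxE.
    apply: measurable_funD; last exact: measurable_funM.
    by apply: measurable_funD => //; exact: measurable_funM.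
  by apply: measurable_fun_pair; [apply: measurable_fun_pair|]; exact: mi.
have := measurableT_comp (@continuous_measurable _ _ setT cF) m.
by congr (measurable_fun _ _); apply/funext => z /=; rewrite unptK.
Qed.

Lemma tripoint_bounded a b c : exists r, forall z, unit_triangle z -> ccube 0 r (tripoint a b c z).
Proof.
exists (`|a| + `|b - a| + `|c - a|) => z [z1 z2 z12] i.
have n1 (x : 'rV[R]_3) : `|x 0 i| <= `|x|.
  by rewrite [leRHS]/Num.Def.normr /= mx_normrE (le_trans _ (le_bigmax _ _ (0, i))).
have -> : tripoint a b c z 0 i - (0 : 'rV[R]_3) 0 i = a 0 i + z.1 * (b - a) 0 i + z.2 * (c - a) 0 i.
  by rewrite !mxE subr0.
apply: le_trans (ler_normD _ _) _; apply: lerD; last first.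
  rewrite normrM -[leRHS]mul1r; apply: ler_pM => //.
  by rewrite ger0_norm// (le_trans _ z12)// lerDr.
apply: le_trans (ler_normD _ _) _; apply: lerD; first exact: n1.
rewrite normrM -[leRHS]mul1r; apply: ler_pM => //.
by rewrite ger0_norm// (le_trans _ z12)// lerDl.
Qed.

Lemma tri_integrable a b c F : continuous F ->
  (@mlam2 R).-integrable (@unit_triangle R) (EFin \o (fun z => F (tripoint a b c z))).
Proof.
move=> cF; have [r Hr] := tripoint_bounded a b c.
have [M HM] := continuous_bounded r cF.
apply: measurable_bounded_integrable.
- exact: unit_triangle_closed.
- exact: mlam2_triangle.
- by apply: measurable_funTS; exact: measurable_tripoint.
exists M; split => [|y My z Ez]; first exact: num_real.
by apply: le_trans (ltW My); exact/HM/Hr.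
Qed.

Lemma triI_swap a b c F : continuous F -> triI a c b F = triI a b c F.
Proof.
move=> cF; rewrite /triI.
have H A : measurable A -> mu2 (@swap2 R @^-1` A) = (1%:E * mu2 A)%E.
  by move=> mA; rewrite mul1e; exact: leb2_swap.
have := Rintegral_scaled ler01 (@measurable_swap2 R) H unit_triangle_closed (tri_integrable a b c cF).
rewrite mul1r => <-; rewrite (_ : swap2 @^-1` _ = @unit_triangle R).
  by apply: eq_Rintegral => z _; rewrite /tripoint /= -!addrA [in RHS](addrC (z.2 *: _)).
by apply/seteqP; split=> z [] /= z1 z2 z12; split=> //=; rewrite addrC.
Qed.

(** The affine reflection of the unit triangle that exchanges the vertices (0, 0)
    and (0, 1). *)
Definition refl2 (w : measurableTypeR R * measurableTypeR R) : measurableTypeR R * measurableTypeR R :=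
  (w.1, 1 - w.1 - w.2).

Lemma triI_rot a b c F : continuous F -> triI c b a F = triI a b c F.
Proof.
move=> cF; rewrite /triI.
have mT : measurable_fun setT refl2.
  apply: measurable_fun_pair; first exact: measurable_fst.
  by apply: measurable_funB; [apply: measurable_funB => //; exact: measurable_fst|exact: measurable_snd].
have H A : measurable A -> mu2 (refl2 @^-1` A) = (1%:E * mu2 A)%E.
  move=> mA; rewrite mul1e /mlam2 /product_measure1; apply: eq_integral => x _ /=.
  have := @lebesgue_measure_affine R (-1) (1 - x) (xsection A x).
  rewrite oppr_eq0 oner_eq0 normrN1 invr1 mul1e => /(_ isT (measurable_xsection _ mA)) <-.
  congr (lam _); apply/seteqP; split=> t; rewrite /xsection /= !inE /=;
  by rewrite (_ : -1 * t + (1 - x) = 1 - x - t)//; ring.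
have := Rintegral_scaled ler01 mT H unit_triangle_closed (tri_integrable a b c cF).
rewrite mul1r => <-; rewrite (_ : refl2 @^-1` _ = @unit_triangle R).
  apply: eq_Rintegral => z _; congr F; rewrite /tripoint /=; apply/rowP => i; rewrite !mxE; ring.
by apply/seteqP; split=> z [] /= z1 z2 z12; split=> //=; lra.
Qed.

Definition reftet : set 'rV[R]_3 :=
  [set x | [/\ 0 <= x 0 0, 0 <= x 0 1, 0 <= x 0 2%:R & x 0 0 + x 0 1 + x 0 2%:R <= 1]].

Lemma reftet_bounded : reftet `<=` ccube 0 1.
Proof.
move=> x [x0 x1 x2 x3] i; rewrite mxE subr0.
by case: (ord3P i) => ->; rewrite ger0_norm//; lra.
Qed.

Lemma closed_affine_ge0 (f : 'rV[R]_3 -> R) : continuous f -> closed [set x | 0 <= f x].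
Proof.
move=> cf; rewrite (_ : [set x | 0 <= f x] = f @^-1` [set` `[0, +oo[]); last first.
  by apply/seteqP; split=> x /=; rewrite in_itv /= andbT.
by apply: (closed_comp (fun x _ => cf x)); exact: interval_closed.
Qed.

Lemma measurable_reftet : measurable (@pt R @^-1` reftet : set (prod3 R)).
Proof.
have -> : reftet = [set x | 0 <= x 0 0] `&` [set x | 0 <= x 0 1] `&` [set x | 0 <= x 0 2%:R]
   `&` [set x | 0 <= 1 - (x 0 0 + x 0 1 + x 0 2%:R)].
  by apply/seteqP; split=> x /=; rewrite subr_ge0; [move=> []|move=> [[[]]]].
have cc i : continuous (fun x : 'rV[R]_3 => x 0 i) by move=> x; exact: coord_continuous.
apply: measurable_closed.
do 3?[apply: closedI]; apply: closed_affine_ge0 => //.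
by apply: contB; [exact: cst_continuous|apply: contD => //; exact: contD].
Qed.

Lemma partial2_line (H : 'rV[R]_3 -> R) (x y t : R) : C1 H ->
  is_derive t 1 (fun t => H (pt (x, y, t))) (partial 2%:R H (pt (x, y, t))).
Proof.
move=> [dH _].
have dv : derivable H (pt (x, y, t)) (delta_mx 0 2%:R) by exact: diff_derivable.
have E : (fun h : R => h^-1 *: (((fun t => H (pt (x, y, t))) \o shift t) (h *: (1:R)) - H (pt (x, y, t)))) =
  (fun h : R => h^-1 *: ((H \o shift (pt (x, y, t))) (h *: delta_mx 0 2%:R) - H (pt (x, y, t)))).
  apply/funext => h; congr (_ *: (H _ - _)).
  apply: rV3P; rewrite !mxE /= ?mulr0 ?add0r// mulr1.
by apply: DeriveDef; rewrite /derivable /partial /derive /= E.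
Qed.

(** Tonelli's theorem and the fundamental theorem of calculus on the segments
    parallel to the last axis; they run from the base of the tetrahedron to its
    slanted face. *)
Lemma reftet_partial2 (H : 'rV[R]_3 -> R) : C1 H ->
  vint reftet (partial 2%:R H) =
  triI (delta_mx 0 2%:R) (delta_mx 0 0) (delta_mx 0 1) H - triI 0 (delta_mx 0 0) (delta_mx 0 1) H.
Proof.
move=> HC; have cH := C1_continuous HC; have [dH cpH] := HC.
set e0 := delta_mx 0 0; set e1 := delta_mx 0 1; set e2 := delta_mx 0 2%:R.
have ip := continuous_integrable3 measurable_reftet reftet_bounded (cpH 2%:R).
rewrite /triI -RintegralB; [|exact: unit_triangle_closed|exact: tri_integrable..].
rewrite /vint /Rintegral; congr fine.
rewrite integral_mkcond [RHS]integral_mkcond.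
have ip' := (integrable_mkcond _ measurable_reftet).1 ip.
have := @integral12_prod_meas1 _ _ _ _ R mu2 lam _ ip'.
set L := (\int[_]_z _)%E => HL; set L' := (\int[_]_z _)%E.
have -> : L' = L by exact: esym HL.
rewrite /L; apply: eq_integral => -[x y] _.
rewrite /fubini_F patchE; case: ifPn => [|xy].
  rewrite inE => -[/= x0 y0 xy1].
  have Et1 : tripoint 0 e0 e1 (x, y) = pt (x, y, 0).
    by apply: rV3P; rewrite !mxE /= ?subr0 ?mulr0 ?mulr1 ?addr0 ?add0r.
  have Et2 : tripoint e2 e0 e1 (x, y) = pt (x, y, 1 - x - y).
    by apply: rV3P; rewrite !mxE /=; ring.
  rewrite Et1 Et2.
  under eq_integral.
    move=> t _; rewrite (_ : patch _ _ _ _ = (EFin \o (fun t => partial 2%:R H (pt (x, y, t)))) \_ `[0, 1 - x - y] t).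
      over.
    rewrite !patchE /=; congr (if _ then _ else _).
    apply/idP/idP; rewrite !inE /= in_itv /= /reftet /= pt0 pt1 pt2 /=.
      by move=> [_ _ t0 t1]; apply/andP; split=> //; lra.
    by move=> /andP[t0 t1]; split=> //; lra.
  rewrite -integral_mkcond.
  have : 0 <= 1 - x - y by lra.
  rewrite le_eqVlt => /predU1P[<-|p0].
    by rewrite set_itv1 integral_set1 subrr.
  have cl : continuous (fun t => partial 2%:R H (pt (x, y, t))).
    move=> t; apply: continuous_comp; last exact: cpH.
    have -> : (fun t => pt (x, y, t)) = (fun t => pt (x, y, 0) + t *: e2).
      by apply/funext => s; apply: rV3P; rewrite !mxE /= ?mulr0 ?mulr1 ?addr0 ?add0r.
    by apply: cvgD; [exact: cvg_cst|apply: cvgZr_tmp; exact: cvg_id].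
  have dl (t : R) : is_derive t 1 (fun t => H (pt (x, y, t))) (partial 2%:R H (pt (x, y, t))).
    exact: partial2_line.
  have cHl : continuous (fun t => H (pt (x, y, t))).
    by move=> t; apply/differentiable_continuous/derivable1_diffP; have [] := dl t.
  apply: (@continuous_FTC2 _ (fun t => partial 2%:R H (pt (x, y, t))) (fun t => H (pt (x, y, t)))) => //.
  - exact: continuous_subspaceT.
  - split=> [t _||]; first by have [] := dl t.
      by apply: cvg_at_right_filter; exact: cHl.
    by apply: cvg_at_left_filter; exact: cHl.
  - by move=> t _; rewrite derive1E; have [_ ->] := dl t.
rewrite integral0_eq// => t _; rewrite patchE memNset// => -[].
rewrite pt0 pt1 pt2 /= => x0 y0 t0 t1; move: xy; rewrite notin_setE; apply.
by split=> //=; lra.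
Qed.

Lemma reftet_volume : 0 < vint reftet (fun=> 1).
Proof.
pose c : 'rV[R]_3 := const_mx (8%:R^-1).
have cS : cube c (8%:R^-1) `<=` reftet.
  move=> x xc; have := xc 0; have := xc 1; have := xc 2%:R.
  rewrite !mxE !ltr_norml => /andP[? ?] /andP[? ?] /andP[? ?]; split; lra.
have mc := measurable_cube c (8%:R^-1).
have : (mu (@pt R @^-1` cube c (8%:R^-1)) <= mu (@pt R @^-1` reftet))%E.
  apply: le_measure; rewrite ?inE//; first exact: measurable_reftet.
  by move=> z /cS.
rewrite /vint /Rintegral.
have -> : (\int[mu]_(z in @pt R @^-1` reftet) 1%:E = mu (@pt R @^-1` reftet))%E.
  by rewrite integral_cst ?mul1e//; exact: measurable_reftet.
have fS : (mu (@pt R @^-1` reftet) < +oo)%E.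
  have := continuous_integrable3 measurable_reftet reftet_bounded (@cst_continuous _ _ (1:R)).
  move=> /integrableP[_]; under eq_integral do rewrite /= normr1.
  by rewrite integral_cst ?mul1e//; exact: measurable_reftet.
move=> le; apply: fine_gt0; rewrite fS andbT; apply: lt_le_trans le.
have p8 : (0 : R) < 8%:R^-1 by rewrite invr_gt0 ltr0n.
by rewrite leb3_cubeE// lte_fin exprn_gt0// mulrn_wgt0.
Qed.

(** The map [a + x *m edges (b - a) (c - a) (d - a)] sends the reference
    tetrahedron onto the one with vertices [a], [b], [c], [d]. *)
Definition edges b c d : 'M[R]_3 :=
  \matrix_(i < 3) (if i == 0 then b else if i == 1 then c else d).

Lemma edgesE b c d (x : 'rV[R]_3) : x *m edges b c d = x 0 0 *: b + x 0 1 *: c + x 0 2%:R *: d.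
Proof. by apply/rowP => i; rewrite !mxE sum3E !mxE /=. Qed.

Section AffineSubstitution.
Variables (a b c d : 'rV[R]_3).
Let A := edges b c d.
Let T (x : 'rV[R]_3) := a + x *m A.

Lemma affine_diff x : differentiable T x.
Proof.
rewrite (_ : T = fun x => a + (x 0 0 *: b + x 0 1 *: c + x 0 2%:R *: d)); last first.
  by apply/funext => y; rewrite /T edgesE.
have dz (k : 'I_3) (w : 'rV[R]_3) : differentiable (fun y : 'rV[R]_3 => y 0 k *: w) x.
  by apply: differentiableZl; exact: differentiable_rVcoord.
apply: differentiableD; first exact: differentiable_cst.
by apply: differentiableD => //; exact: differentiableD.
Qed.

Lemma affine_continuous : continuous T.
Proof. by move=> x; apply: differentiable_continuous; exact: affine_diff. Qed.

Lemma partial_affine F k x : partial k (F \o T) x = 'D_(row k A) F (T x).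
Proof.
rewrite /partial /derive.
have E : (fun h : R => h^-1 *: (((F \o T) \o shift x) (h *: delta_mx 0 k) - (F \o T) x)) =
  (fun h : R => h^-1 *: ((F \o shift (T x)) (h *: row k A) - F (T x))).
  apply/funext => h; congr (_ *: (F _ - _)).
  by rewrite /= /T mulmxDl -scalemxAl -rowE addrA addrC addrA addrAC -addrA addrC addrA.
by rewrite E.
Qed.

Lemma C1_affine F : C1 F -> C1 (F \o T).
Proof.
move=> FC; have [dF cpF] := FC; split=> [x|k].
  by apply: differentiable_comp; [exact: affine_diff|exact: dF].
rewrite (_ : partial k _ = (fun y => 'D_(row k A) F y) \o T); last first.
  by apply/funext => x; rewrite partial_affine.
move=> x; apply: continuous_comp; first exact: affine_continuous.
exact: continuous_derive.
Qed.

End AffineSubstitution.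

Lemma tetra_change a A F (E : set 'rV[R]_3) (r : R) : \det A != 0 ->
  measurable (@pt R @^-1` E : set (prod3 R)) -> E `<=` ccube 0 r -> continuous F ->
  vint [set x | E (a + x *m A)] (fun x => F (a + x *m A)) = `|\det A|^-1 * vint E F.
Proof.
move=> dA mE Er cF.
apply: (scales_integral _ (scales_affine a dA) mE); first by rewrite invr_ge0.
exact: continuous_integrable3 mE Er cF.
Qed.

(** The lines parallel to the edge from [a] to [d] enter the tetrahedron through
    the face opposite [d] and leave it through the face opposite [a]. *)
Lemma tetra_edge a b c d F (E : set 'rV[R]_3) (r : R) :
  \det (edges (b - a) (c - a) (d - a)) != 0 ->
  measurable (@pt R @^-1` E : set (prod3 R)) -> E `<=` ccube 0 r -> C1 F ->
  [set x | E (a + x *m edges (b - a) (c - a) (d - a))] = reftet ->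
  vint E (fun x => 'D_(d - a) F x) =
  `|\det (edges (b - a) (c - a) (d - a))| * (triI d b c F - triI a b c F).
Proof.
set A := edges _ _ _ => dA mE Er FC EA.
have := tetra_change a dA mE Er (continuous_derive (w := d - a) FC); rewrite EA => H.
have n0 : `|\det A| != 0 by rewrite normr_eq0.
apply: (mulfI (invr_neq0 n0)); rewrite -H mulKf//.
have rowA : row 2%:R A = d - a by apply/rowP => i; rewrite !mxE.
rewrite (@eq_vint _ _ _ (partial 2%:R (F \o (fun x => a + x *m A)))); last first.
  by move=> x _; rewrite partial_affine rowA.
rewrite reftet_partial2; last exact: C1_affine.
by rewrite /triI; congr (_ - _); apply: eq_Rintegral => z _; rewrite /= /tripoint edgesE;
  congr F; apply/rowP => i; rewrite !mxE /=; ring.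
Qed.

End BoundedIntegrals.

(** * Barycentric coordinates *)

Lemma near_seq (T : eqType) (X : Type) (F : set_system X) (FF : Filter F) (s : seq T)
    (P : T -> X -> Prop) :
  (forall a, a \in s -> \forall y \near F, P a y) ->
  \forall y \near F, forall a, a \in s -> P a y.
Proof.
elim: s => [|a s IH] H; first exact: nearW.
have Ha := H a (mem_head _ _).
have Hs : \forall y \near F, forall b, b \in s -> P b y.
  by apply: IH => b bs; apply: H; rewrite inE bs orbT.
by apply: filterS2 Ha Hs => y ya ys b; rewrite inE => /predU1P[->|/ys].
Qed.

Section DotProduct.
Context {R : realType}.
Implicit Types (u v w x : 'rV[R]_3).

Lemma dotDl u v w : dot (u + v) w = dot u w + dot v w.
Proof. by rewrite /dot -big_split; apply: eq_bigr => i _; rewrite mxE mulrDl. Qed.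
Lemma dotNl u w : dot (- u) w = - dot u w.
Proof. by rewrite /dot -sumrN; apply: eq_bigr => i _; rewrite mxE mulNr. Qed.
Lemma dotBl u v w : dot (u - v) w = dot u w - dot v w.
Proof. by rewrite dotDl dotNl. Qed.
Lemma dotZl a u w : dot (a *: u) w = a * dot u w.
Proof. by rewrite /dot mulr_sumr; apply: eq_bigr => i _; rewrite mxE mulrA. Qed.
Lemma dotC u v : dot u v = dot v u.
Proof. by apply: eq_bigr => i _; rewrite mulrC. Qed.
Lemma dotDr u v w : dot w (u + v) = dot w u + dot w v.
Proof. by rewrite !(dotC w) dotDl. Qed.
Lemma dotNr u w : dot w (- u) = - dot w u.
Proof. by rewrite !(dotC w) dotNl. Qed.
Lemma dotBr u v w : dot w (u - v) = dot w u - dot w v.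
Proof. by rewrite !(dotC w) dotBl. Qed.
Lemma dotZr a u w : dot w (a *: u) = a * dot w u.
Proof. by rewrite !(dotC w) dotZl. Qed.
Lemma dot0l w : dot 0 w = 0.
Proof. by rewrite -(scale0r 0) dotZl mul0r. Qed.
Lemma dot0r w : dot w 0 = 0.
Proof. by rewrite dotC dot0l. Qed.
Lemma dot_suml (I : Type) (r : seq I) (P : pred I) (F : I -> 'rV[R]_3) w :
  dot (\sum_(i <- r | P i) F i) w = \sum_(i <- r | P i) dot (F i) w.
Proof. by apply: (big_morph (fun u => dot u w)) => [u v|]; rewrite ?dotDl ?dot0l. Qed.

Lemma dot_inj v : (forall u, dot u v = 0) -> v = 0.
Proof.
move=> H; apply/rowP => i; rewrite mxE; have := H (delta_mx 0 i).
rewrite /dot (bigD1 i)//= big1 ?addr0 => [|j ji]; rewrite !mxE eqxx ?eqxx ?mul1r//.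
by rewrite (negbTE ji) mul0r.
Qed.

Lemma continuous_dot w : continuous (fun x => dot x w).
Proof.
rewrite (_ : (fun x => _) = fun x => x 0 0 * w 0 0 + x 0 1 * w 0 1 + x 0 2%:R * w 0 2%:R); last first.
  by apply/funext => x; rewrite dot3.
have cc i : continuous (fun x : 'rV[R]_3 => x 0 i) by move=> x; exact: coord_continuous.
by do 2?[apply: contD]; apply: contM => //; exact: cst_continuous.
Qed.

End DotProduct.

Section Barycentric.
Context {R : realType}.
Variable M : mesh R.
Notation n := (nvert M).
Notation v := (@vert R M).
Implicit Types (K e : {set 'I_n}) (i j k l : 'I_n) (x y w : 'rV[R]_3).
Notation mu := (@leb3 R).

Definition is_cell K := #|K| = 4%N /\ affinely_independent K.

(** Enumerating a cell with two prescribed vertices at the ends turns sums over its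
    vertices into explicit sums of four terms. *)
Lemma cell_order K i j : #|K| = 4%N -> i \in K -> j \in K -> i != j ->
  exists k l, [/\ uniq [:: j; k; l; i], K = [set j; k; l; i]%SET
    & forall (V : nmodType) (F : 'I_n -> V), \sum_(t in K) F t = F j + F k + F l + F i].
Proof.
move=> K4 iK jK ij.
have jKi : j \in K :\ i by rewrite !inE eq_sym ij.
have : #|K :\ i :\ j| == 2%N.
  by have := cardsD1 i K; rewrite (cardsD1 j (K :\ i)) iK jKi K4 !add1n => -[<-].
move/cards2P => [k [l [kl E]]].
have [kj ki kK] : [/\ k != j, k != i & k \in K].
  by apply/and3P; rewrite -!in_setD1 E !inE eqxx.
have [lj li lK] : [/\ l != j, l != i & l \in K].
  by apply/and3P; rewrite -!in_setD1 E !inE eqxx orbT.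
exists k, l; split.
- by rewrite /= !inE !negb_or eq_sym kj (eq_sym j l) lj (eq_sym j i) ij kl ki li.
- apply/setP => t; rewrite !inE.
  have := congr1 (fun A : {set 'I_n} => t \in A) E; rewrite !inE.
  have [->|tj] := eqVneq t j; first by rewrite jK.
  have [->|ti] := eqVneq t i; first by rewrite iK !orbT.
  by rewrite /= orbF => ->.
- move=> V F; rewrite (big_setD1 i)//= (big_setD1 j)//= E.
  rewrite big_setU1 ?inE//= big_set1 addrC -!addrA; congr (_ + _).
Qed.

Definition edgemx (j k l i : 'I_n) := edges (v k - v j) (v l - v j) (v i - v j).

Lemma edgemx_det K i j k l : affinely_independent K -> uniq [:: j; k; l; i] ->
  K = [set j; k; l; i]%SET ->
  (forall (V : nmodType) (F : 'I_n -> V), \sum_(t in K) F t = F j + F k + F l + F i) ->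
  \det (edgemx j k l i) != 0.
Proof.
move=> aiK uK KE KS; apply/det0P => -[u u0 uA].
move: uK; rewrite /= !inE !negb_or => /andP[/and3P[jk jl ji] /andP[/andP[kl ki] /andP[li _]]].
pose c (t : 'I_n) : R := if t == k then u 0 0 else if t == l then u 0 1 else
  if t == i then u 0 2%:R else - (u 0 0 + u 0 1 + u 0 2%:R).
have cj : c j = - (u 0 0 + u 0 1 + u 0 2%:R) by rewrite /c (negbTE jk) (negbTE jl) (negbTE ji).
have ck : c k = u 0 0 by rewrite /c eqxx.
have cl : c l = u 0 1 by rewrite /c eqxx eq_sym (negbTE kl).
have ci : c i = u 0 2%:R by rewrite /c eqxx !(eq_sym i) (negbTE ki) (negbTE li).
have := aiK c; rewrite !KS cj ck cl ci.
have -> : - (u 0 0 + u 0 1 + u 0 2%:R) + u 0 0 + u 0 1 + u 0 2%:R = 0 by ring.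
move=> /(_ erefl).
have -> : - (u 0 0 + u 0 1 + u 0 2%:R) *: v j + u 0 0 *: v k + u 0 1 *: v l + u 0 2%:R *: v i = 0.
  rewrite -uA edgesE; apply/rowP => t; rewrite !mxE; ring.
move=> /(_ erefl) H.
have jK : j \in K by rewrite KE !inE eqxx.
have kK : k \in K by rewrite KE !inE eqxx orbT.
have lK : l \in K by rewrite KE !inE eqxx !orbT.
have iK : i \in K by rewrite KE !inE eqxx !orbT.
move/eqP: u0; apply; apply: rV3P; rewrite [RHS]mxE.
- by rewrite -ck H.
- by rewrite -cl H.
- by rewrite -ci H.
Qed.

(** The functions [p.1 i + dot x (p.2 i)] are the barycentric coordinates of [x]:
    the two identities determine them. *)
Definition bary_spec K (p : ('I_n -> R) * ('I_n -> 'rV[R]_3)) :=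
  (forall x, \sum_(i in K) (p.1 i + dot x (p.2 i)) = 1) /\
  (forall x, \sum_(i in K) (p.1 i + dot x (p.2 i)) *: v i = x).

(** The gradients are the columns of the inverse of the edge matrix; for the base
    vertex [j], minus their sum. *)
Lemma bary_exists K : is_cell K -> exists p, bary_spec K p.
Proof.
move=> [K4 aiK].
have [i iK] : exists i, i \in K by apply/card_gt0P; rewrite K4.
have [j jK ij] : exists2 j, j \in K & i != j.
  have : (0 < #|K :\ i|)%N by have := cardsD1 i K; rewrite iK K4 add1n => -[<-].
  by move=> /card_gt0P[j]; rewrite !inE eq_sym => /andP[? ?]; exists j.
have [k [l [uK KE KS]]] := cell_order K4 iK jK ij.
have dA := edgemx_det aiK uK KE KS.
move: (uK); rewrite /= !inE !negb_or => /andP[/and3P[jk jl ji] /andP[/andP[kl ki] /andP[li _]]].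
set A := edgemx j k l i in dA *.
have uA : A \in unitmx by rewrite unitmxE unitfE.
pose g (t : 'I_n) : 'rV[R]_3 := if t == k then (col 0 (invmx A))^T else
  if t == l then (col 1 (invmx A))^T else if t == i then (col 2%:R (invmx A))^T else
  - ((col 0 (invmx A))^T + (col 1 (invmx A))^T + (col 2%:R (invmx A))^T).
have gj : g j = - ((col 0 (invmx A))^T + (col 1 (invmx A))^T + (col 2%:R (invmx A))^T).
  by rewrite /g (negbTE jk) (negbTE jl) (negbTE ji).
have gk : g k = (col 0 (invmx A))^T by rewrite /g eqxx.
have gl : g l = (col 1 (invmx A))^T by rewrite /g eqxx eq_sym (negbTE kl).
have gi : g i = (col 2%:R (invmx A))^T by rewrite /g eqxx !(eq_sym i) (negbTE ki) (negbTE li).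
exists (fun t => (t == j)%:R - dot (v j) (g t), g) => /=.
have E x t : (t == j)%:R - dot (v j) (g t) + dot x (g t) = (t == j)%:R + dot (x - v j) (g t).
  by rewrite dotBl; ring.
have D x (m : 'I_3) : dot x (col m (invmx A))^T = (x *m invmx A) 0 m.
  by rewrite mxE; apply: eq_bigr => r _; rewrite !mxE.
split=> x; rewrite KS !E eqxx (eq_sym k) (eq_sym l) (eq_sym i) (negbTE jk) (negbTE jl) (negbTE ji).
  by rewrite gj gk gl gi dotNr !dotDr /=; ring.
rewrite !add0r gj gk gl gi dotNr !dotDr !D.
have := edgesE (v k - v j) (v l - v j) (v i - v j) ((x - v j) *m invmx A).
rewrite -/(edgemx j k l i) -/A mulmxKV//.
set a0 := (_ *m _) 0 0; set a1 := (_ *m _) 0 1; set a2 := (_ *m _) 0 2%:R.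
move=> H; rewrite -[RHS](subrK (v j)) H; apply/rowP => t; rewrite !mxE /=; ring.
Qed.

Definition bary_data K : ('I_n -> R) * ('I_n -> 'rV[R]_3) :=
  xget (fun=> 0, fun=> 0) [set p | bary_spec K p].
Definition bary K i x : R := (bary_data K).1 i + dot x ((bary_data K).2 i).
Definition bgrad K i : 'rV[R]_3 := (bary_data K).2 i.

Lemma bary_dataP K : is_cell K -> bary_spec K (bary_data K).
Proof. by move=> /bary_exists[p sp]; by apply: xgetPex; exists p. Qed.

Lemma bary_sum K x : is_cell K -> \sum_(i in K) bary K i x = 1.
Proof. by move=> /bary_dataP[H _]; exact: H. Qed.

Lemma bary_comb K x : is_cell K -> \sum_(i in K) bary K i x *: v i = x.
Proof. by move=> /bary_dataP[_ H]; exact: H. Qed.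

Lemma bary_uniq K x (c : 'I_n -> R) : is_cell K -> \sum_(i in K) c i = 1 ->
  \sum_(i in K) c i *: v i = x -> forall i, i \in K -> bary K i x = c i.
Proof.
move=> cK c1 cx i iK; apply/eqP; rewrite -subr_eq0; apply/eqP.
have [_ aiK] := cK; apply: (aiK (fun i => bary K i x - c i)) => //.
  by rewrite sumrB bary_sum// c1 subrr.
under eq_bigr do rewrite scalerBl.
by rewrite sumrB bary_comb// cx subrr.
Qed.

Lemma bary_sub K e (c : 'I_n -> R) : is_cell K -> e \subset K -> \sum_(i in e) c i = 1 ->
  forall i, i \in K -> bary K i (\sum_(j in e) c j *: v j) = if i \in e then c i else 0.
Proof.
move=> cK eK c1; apply: bary_uniq => //.
  rewrite -[RHS]c1 (big_setID e) /= (finset.setIidPr eK) [X in _ + X]big1 ?addr0.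
    by apply: eq_bigr => i ->.
  by move=> i /setDP[_ /negbTE ->].
rewrite (big_setID e) /= (finset.setIidPr eK) [X in _ + X]big1 ?addr0.
  by apply: eq_bigr => i ->.
by move=> i /setDP[_ /negbTE ->]; rewrite scale0r.
Qed.

Lemma baryD K i x h : bary K i (x + h) = bary K i x + dot h (bgrad K i).
Proof. by rewrite /bary dotDl addrA. Qed.

Lemma bary_vert K i j : is_cell K -> i \in K -> j \in K -> bary K i (v j) = (i == j)%:R.
Proof.
move=> cK iK jK; apply: (@bary_uniq K (v j) (fun i => (i == j)%:R)) => //.
  by rewrite (big_setD1 j)//= eqxx big1 ?addr0// => t; rewrite !inE => /andP[/negbTE ->].
rewrite (big_setD1 j)//= eqxx scale1r big1 ?addr0// => t; rewrite !inE => /andP[/negbTE -> _].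
by rewrite scale0r.
Qed.

Lemma bary_affine K i x y t :
  bary K i ((1 - t) *: x + t *: y) = (1 - t) * bary K i x + t * bary K i y.
Proof. by rewrite /bary dotDl !dotZl; ring. Qed.

Lemma continuous_bary K i : continuous (bary K i).
Proof. by apply: contD; [exact: cst_continuous|exact: continuous_dot]. Qed.

Lemma bgrad_sum K w : is_cell K -> \sum_(i in K) dot w (bgrad K i) = 0.
Proof.
move=> cK; have := bary_sum (0 + w) cK; under eq_bigr do rewrite baryD.
by rewrite big_split /= bary_sum// -[RHS]addr0 => /addrI.
Qed.

Lemma bgrad_comb K w : is_cell K -> \sum_(i in K) dot w (bgrad K i) *: v i = w.
Proof.
move=> cK; have := bary_comb (0 + w) cK; under eq_bigr do rewrite baryD scalerDl.
by rewrite big_split /= bary_comb// => /addrI.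
Qed.

Lemma hullE K : is_cell K -> hull K = [set x | forall i, i \in K -> 0 <= bary K i x].
Proof.
move=> cK; apply/seteqP; split=> x /=.
  by move=> [c [c0 c1 xE]] i iK; rewrite (bary_uniq cK c1 (esym xE)).
move=> x0; exists (fun i => if i \in K then bary K i x else 0); split.
- by move=> i; case: ifP => // /x0.
- by rewrite -[RHS](bary_sum x cK); apply: eq_bigr => i ->.
- by rewrite -[LHS](bary_comb x cK); apply: eq_bigr => i ->.
Qed.

Definition ohull K : set 'rV[R]_3 := [set x | forall i, i \in K -> 0 < bary K i x].

Lemma open_ohull K : open (ohull K).
Proof.
rewrite openE => x xK.
have : \forall y \near x, forall i, i \in enum K -> 0 < bary K i y.
  apply: (@near_seq _ _ (nbhs x) _ (enum K) (fun i y => 0 < bary K i y)) => i; rewrite mem_enum => iK.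
  have N : nbhs (bary K i x) [set` `]0, +oo[].
    by apply: open_nbhs_nbhs; split; [exact: interval_open|rewrite /= in_itv/= andbT xK].
  have := @continuous_bary K i x _ N; rewrite nbhs_simpl /=.
  by apply: (@filterS _ (nbhs x)) => y; rewrite /= in_itv /= andbT.
by apply: filterS => y H i iK; apply: H; rewrite mem_enum.
Qed.

Lemma closed_hull K : is_cell K -> closed (hull K).
Proof.
move=> cK; rewrite hullE//.
rewrite (_ : [set x | _] = \bigcap_(i in [set i | i \in K]) [set x | 0 <= bary K i x])//.
by apply: closed_bigI => i _; apply: closed_affine_ge0; exact: continuous_bary.
Qed.

(** From a point of the hull with [bary K i x = 0], moving away from the vertex [i]
    leaves the hull at once. *)
Lemma hull_interior K : is_cell K -> (hull K)° = ohull K.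
Proof.
move=> cK; apply/seteqP; split=> x; last first.
  move=> xK; have : nbhs x (ohull K) by apply: open_nbhs_nbhs; split => //; exact: open_ohull.
  by apply: filterS => y yK; rewrite hullE// => i iK; exact/ltW/yK.
move=> xK i iK.
have xh := interior_subset xK.
move: (xh); rewrite hullE// => /(_ i iK); rewrite le_eqVlt => /predU1P[x0|//]; exfalso.
have : nbhs (x + (0 : R) *: (x - v i)) (hull K) by rewrite scale0r addr0.
have ct : {for 0, continuous (fun t : R => x + t *: (x - v i))}.
  by apply: cvgD; [exact: cvg_cst|apply: cvgZr_tmp; exact: cvg_id].
move=> /ct /nbhs_ballP[e /= e0 eH].
have := eH (e / 2); rewrite /ball /= sub0r normrN ger0_norm ?divr_ge0 ?(ltW e0)//.
rewrite ltr_pdivrMr// ltr_pMr// ltr1n => /(_ isT).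
rewrite hullE// => /(_ i iK); rewrite baryD -x0 add0r dotZl.
have -> : dot (x - v i) (bgrad K i) = -1.
  have := baryD K i (v i) (x - v i); rewrite addrC subrK -x0 bary_vert// eqxx => H.
  by move: H => /=; lra.
by rewrite mulrN1 oppr_ge0 leNgt divr_gt0.
Qed.

Lemma measurable_hull K : is_cell K -> measurable (@pt R @^-1` hull K : set (prod3 R)).
Proof. by move=> cK; apply: measurable_closed; exact: closed_hull. Qed.

Lemma measurable_ohull K : measurable (@pt R @^-1` ohull K : set (prod3 R)).
Proof. by apply: measurable_open; exact: open_ohull. Qed.

Lemma hull_bounded K : exists r, hull K `<=` ccube 0 r.
Proof.
exists (\sum_(i in K) `|v i|) => x [c [c0 c1 ->]] t.
rewrite [X in _ - X]mxE subr0 summxE; apply: le_trans (ler_norm_sum _ _ _) _.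
apply: ler_sum => i iK; rewrite mxE normrM -[leRHS]mul1r; apply: ler_pM => //.
  rewrite ger0_norm// -c1 (big_setD1 i)//= lerDl; exact: sumr_ge0.
by rewrite [leRHS]/Num.Def.normr /= mx_normrE (le_trans _ (le_bigmax _ _ (0, t))).
Qed.

Lemma ohull_sub K : is_cell K -> ohull K `<=` hull K.
Proof. by move=> cK x xK; rewrite hullE// => i iK; exact/ltW/xK. Qed.

Lemma bary_param K i j k l (x : 'rV[R]_3) : is_cell K -> uniq [:: j; k; l; i] -> K = [set j; k; l; i]%SET ->
  (forall (V : nmodType) (F : 'I_n -> V), \sum_(t in K) F t = F j + F k + F l + F i) ->
  let y := v j + x *m edgemx j k l i in
  [/\ bary K k y = x 0 0, bary K l y = x 0 1, bary K i y = x 0 2%:R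
    & bary K j y = 1 - (x 0 0 + x 0 1 + x 0 2%:R)].
Proof.
move=> cK uK KE KS y.
move: (uK); rewrite /= !inE !negb_or => /andP[/and3P[jk jl ji] /andP[/andP[kl ki] /andP[li _]]].
pose c (t : 'I_n) : R := if t == k then x 0 0 else if t == l then x 0 1 else
  if t == i then x 0 2%:R else 1 - (x 0 0 + x 0 1 + x 0 2%:R).
have cj : c j = 1 - (x 0 0 + x 0 1 + x 0 2%:R) by rewrite /c (negbTE jk) (negbTE jl) (negbTE ji).
have ck : c k = x 0 0 by rewrite /c eqxx.
have cl : c l = x 0 1 by rewrite /c eqxx eq_sym (negbTE kl).
have ci : c i = x 0 2%:R by rewrite /c eqxx !(eq_sym i) (negbTE ki) (negbTE li).
have H : forall t, t \in K -> bary K t y = c t.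
  apply: bary_uniq => //; rewrite KS cj ck cl ci; first by ring.
  by rewrite /y edgesE; apply/rowP => t; rewrite !mxE; ring.
by rewrite !H ?KE ?inE ?eqxx ?orbT.
Qed.

Lemma hull_param K i j k l : is_cell K -> uniq [:: j; k; l; i] -> K = [set j; k; l; i]%SET ->
  (forall (V : nmodType) (F : 'I_n -> V), \sum_(t in K) F t = F j + F k + F l + F i) ->
  [set x | hull K (v j + x *m edgemx j k l i)] = reftet.
Proof.
move=> cK uK KE KS; apply/seteqP; split=> x; rewrite /= hullE//.
  move=> H; have [bk bl bi bj] := bary_param x cK uK KE KS.
  have := H k; have := H l; have := H i; have := H j; rewrite bk bl bi bj KE !inE !eqxx !orbT.
  move=> /(_ isT) h1 /(_ isT) h2 /(_ isT) h3 /(_ isT) h4; split=> //.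
  by rewrite -subr_ge0.
move=> [x0 x1 x2 x3] t; have [bk bl bi bj] := bary_param x cK uK KE KS.
move=> tK; move: (tK); rewrite {1}KE !inE => /orP[/orP[/orP[|]|]|] /eqP ->; rewrite ?bk ?bl ?bi ?bj//.
by rewrite subr_ge0.
Qed.

(** In the affine chart of the cell the plane is a coordinate plane. *)
Lemma bary_plane_null K i : is_cell K -> i \in K ->
  mu (@pt R @^-1` [set x | bary K i x = 0]) = 0%E.
Proof.
move=> cK iK; have [K4 aiK] := cK.
have [j jK ij] : exists2 j, j \in K & i != j.
  have : (0 < #|K :\ i|)%N by have := cardsD1 i K; rewrite iK K4 add1n => -[<-].
  by move=> /card_gt0P[j]; rewrite !inE eq_sym => /andP[? ?]; exists j.
have [k [l [uK KE KS]]] := cell_order K4 iK jK ij.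
have dA := edgemx_det aiK uK KE KS.
have [_ H] := scales_affine (v j) dA.
set E := @pt R @^-1` _.
have mE : measurable E.
  apply: measurable_closed; rewrite (_ : [set x | _] = bary K i @^-1` [set 0])//.
  apply: closed_comp; last exact: closed_eq.
  by move=> x _; exact: continuous_bary.
have := H _ mE.
have -> : coordmap (fun x => v j + x *m edgemx j k l i) @^-1` E = setT `*` [set 0].
  apply/seteqP; split=> z; rewrite /E /= /coordmap unptK;
  have [_ _ -> _] := bary_param (pt z) cK uK KE KS; rewrite pt2//.
  by move=> [].
have -> : mu (setT `*` [set 0]) = 0%E.
  apply: etrans; first by apply: product_measure1E.
  apply: etrans (mule0 _); congr (_ * _)%E; exact: lebesgue_measure_set1.
move=> /esym/eqP; rewrite mule_eq0 => /orP[|/eqP//].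
by rewrite eqe invr_eq0 normr_eq0 (negbTE dA).
Qed.

Lemma hull_boundary_null K : is_cell K ->
  mu (@pt R @^-1` (hull K `\` ohull K)) = 0%E.
Proof.
move=> cK.
have mB : measurable (@pt R @^-1` (hull K `\` ohull K)).
  apply: (measurableD (A := @pt R @^-1` hull K) (B := @pt R @^-1` ohull K)); first exact: measurable_hull.
  exact: measurable_ohull.
have mP i : measurable (@pt R @^-1` [set x | bary K i x = 0]).
  apply: measurable_closed; rewrite (_ : [set x | _] = bary K i @^-1` [set 0])//.
  apply: closed_comp; last exact: closed_eq.
  by move=> x _; exact: continuous_bary.
apply/negligibleP => //.
apply: (@negligibleS _ _ _ _ (\big[setU/set0]_(i in K) (@pt R @^-1` [set x | bary K i x = 0] : set (prod3 R)))).
  move=> z /= [zh zo].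
  have [i [iK zi]] : exists i, i \in K /\ bary K i (pt z) = 0.
    apply: contrapT => H; apply: zo => i iK.
    move: zh; rewrite hullE// => /(_ i iK); rewrite le_eqVlt => /predU1P[e|//].
    by exfalso; apply: H; exists i.
  by rewrite (big_setD1 i)//=; left.
elim/big_ind : _ => //.
- exact: negligible_set0.
- by move=> A B; exact: negligibleU.
- move=> i iK; apply/negligibleP; last exact: bary_plane_null.
  exact: mP.
Qed.

End Barycentric.

(** * The cells of a triangulation *)

Section Cells.
Context {R : realType}.
Variable Omega : set 'rV[R]_3.
Variable M : mesh R.
Hypothesis Omega_open : open Omega.
Hypothesis tri : triangulation M Omega.
Notation n := (nvert M).
Implicit Types (K L e : {set 'I_n}) (i : 'I_n) (x y : 'rV[R]_3).
Notation mu := (@leb3 R).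

Lemma cellP K : K \in cells M -> is_cell K.
Proof. by move=> KM; have [H _ _] := tri; exact: H. Qed.

(** By conformity the point is a convex combination of the common vertices of both
    cells, and barycentric coordinates are unique. *)
Lemma bary_common K L x : K \in cells M -> L \in cells M -> hull K x -> hull L x ->
  forall i, i \in K -> bary K i x = if i \in L then bary L i x else 0.
Proof.
move=> KM LM xK xL; have [_ H _] := tri.
have : (hull K `&` hull L) x by [].
rewrite (H K L KM LM) => -[c [c0 c1 xE]].
have E A : A \in cells M -> K :&: L \subset A -> forall i, i \in A ->
    bary A i x = if i \in K :&: L then c i else 0.
  by move=> AM sA i iA; rewrite xE (bary_sub _ sA)//; exact: cellP.
move=> i iK; rewrite (E K) ?subsetIl// inE iK /=; case: ifP => // iL.
by rewrite (E L) ?subsetIr// inE iK iL.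
Qed.

Lemma ohull_cell K L x : K \in cells M -> L \in cells M -> ohull K x -> hull L x -> K = L.
Proof.
move=> KM LM xK xL; apply/eqP; rewrite eqEcard; apply/andP; split.
  apply/fintype.subsetP => i iK.
  have := bary_common KM LM (ohull_sub (cellP KM) xK) xL iK.
  by case: ifP => // _ e; have := xK i iK; rewrite e ltxx.
by have [-> _] := cellP KM; have [-> _] := cellP LM.
Qed.

(** Piecewise polynomials are compared pointwise on this set; the rest of [Omega]
    consists of faces and is null. *)
Definition inter : set 'rV[R]_3 := [set x | exists2 K, K \in cells M & ohull K x].

Lemma open_inter : open inter.
Proof.
rewrite (_ : inter = \bigcup_(K in [set K | K \in cells M]) ohull K).
  by apply: bigcup_open => K _; exact: open_ohull.
by apply/seteqP; split=> x [K]; exists K.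
Qed.

Lemma ohull_Omega K : K \in cells M -> ohull K `<=` Omega.
Proof.
move=> KM x xK; have [_ _ ->] := tri.
have : nbhs x (ohull K) by apply: open_nbhs_nbhs; split => //; exact: open_ohull.
by apply: filterS => y yK; exists K => //; apply: ohull_sub => //; exact: cellP.
Qed.

Lemma inter_Omega : inter `<=` Omega.
Proof. by move=> x [K KM]; exact: ohull_Omega. Qed.

Lemma Omega_hull x : Omega x -> exists2 K, K \in cells M & hull K x.
Proof. by have [_ _ ->] := tri => /interior_subset[K]; exists K. Qed.

Let D := (@pt R @^-1` Omega : set (prod3 R)).
Let I := (@pt R @^-1` inter : set (prod3 R)).

Lemma measurable_inter : measurable I.
Proof. by apply: measurable_open; exact: open_inter. Qed.

Lemma inter_null : measurable (D `\` I) /\ mu (D `\` I) = 0%E.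
Proof.
have mDI : measurable (D `\` I).
  by apply: measurableD; [exact: measurable_open|exact: measurable_inter].
split=> //; apply/negligibleP => //.
apply: (@negligibleS _ _ _ _ (\big[setU/set0]_(K in cells M)
    (@pt R @^-1` (hull K `\` ohull K) : set (prod3 R)))).
  move=> z /= [/Omega_hull[K KM Kz] nz].
  by rewrite (big_setD1 K)//=; left; split=> // oK; apply: nz; exists K.
elim/big_ind : _ => //.
- exact: negligible_set0.
- by move=> A B; exact: negligibleU.
- move=> K KM; apply/negligibleP; last exact/hull_boundary_null/cellP.
  apply: (measurableD (A := @pt R @^-1` hull K) (B := @pt R @^-1` ohull K)).
    by apply: measurable_hull; exact: cellP.
  exact: measurable_ohull.
Qed.

Lemma vint_inter f : vint Omega f = vint inter f.
Proof.
have [mN N0] := inter_null.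
rewrite /vint /Rintegral (integral_setD_null _ _ mN N0); congr (fine (integral _ _ _)).
rewrite setDD; apply/seteqP; split=> [z [_ //]|z zI]; split=> //; exact: inter_Omega.
Qed.

Lemma eq_vint_inter f g : (forall x, inter x -> f x = g x) -> vint Omega f = vint Omega g.
Proof. by move=> fg; rewrite !vint_inter; exact: eq_vint. Qed.

Lemma eq_inner_inter f g f' g' : (forall x, inter x -> f x = f' x) ->
  (forall x, inter x -> g x = g' x) -> inner Omega f g = inner Omega f' g'.
Proof. by move=> ff gg; apply: eq_vint_inter => x xI; rewrite ff// gg. Qed.

Lemma inter_ae (P : R * R * R -> Prop) : (forall z, inter (pt z) -> P z) ->
  {ae mu, forall z, Omega (pt z) -> P z}.
Proof.
move=> H; have [mN N0] := inter_null; exists (D `\` I); split=> // z /= /not_implyP[zD zP].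
by split=> // zI; apply/zP/H.
Qed.

Lemma vint_hull K f : K \in cells M -> vint (hull K) f = vint (ohull K) f.
Proof.
move=> KM; have cK := cellP KM.
have mN : measurable (@pt R @^-1` (hull K `\` ohull K) : set (prod3 R)).
  apply: (measurableD (A := @pt R @^-1` hull K) (B := @pt R @^-1` ohull K)).
    exact: measurable_hull.
  exact: measurable_ohull.
rewrite /vint /Rintegral (integral_setD_null _ _ mN (hull_boundary_null cK)).
congr (fine (integral _ _ _)); apply/seteqP; split=> z /=.
  by move=> [zK nz]; apply: contrapT => no; apply: nz.
move=> zo; split; first exact: ohull_sub.
by move=> [].
Qed.

(** The open cells are disjoint and fill [Omega] up to a null set. *)
Lemma vint_cells f (F : {set 'I_n} -> 'rV[R]_3 -> R) :
  (forall K, K \in cells M -> continuous (F K)) ->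
  (forall K, K \in cells M -> forall x, ohull K x -> f x = F K x) ->
  vint Omega f = \sum_(K in cells M) vint (hull K) (F K).
Proof.
move=> cF fF.
have mo K : measurable (@pt R @^-1` ohull K : set (prod3 R)) by exact: measurable_ohull.
have FE K : K \in cells M -> mu.-integrable (@pt R @^-1` ohull K) (EFin \o (f \o @pt R)).
  move=> KM; have [r Kr] := hull_bounded K.
  apply: eq_integrable (continuous_integrable3 (mo K) (r := r) _ (cF K KM)) => //.
    by move=> z /[!inE] zK; rewrite /= (fF K).
  by apply: subset_trans Kr; apply: ohull_sub; exact: cellP.
have E : I = \big[setU/set0]_(K <- enum (cells M)) (@pt R @^-1` ohull K : set (prod3 R)).
  apply/seteqP; split=> z.
    move=> [K KM zK]; rewrite big_enum /= (big_setD1 K)//=; by left.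
  rewrite big_enum /=; elim/big_ind : _ => //.
    by move=> A B HA HB [/HA|/HB].
  by move=> K KM zK; exists K.
rewrite vint_inter /vint -/I /Rintegral E integral_bigsetU_EFin/=.
- rewrite -[in RHS]big_enum /= big_seq -sum_fine => [|K]; last first.
    by rewrite mem_enum => KM; apply: integrable_fin_num => //; exact: FE.
  rewrite [RHS]big_seq; apply: eq_bigr => K; rewrite mem_enum => KM.
  rewrite -[RHS]/(vint (hull K) (F K)) vint_hull//.
  by apply: eq_vint => x xK; rewrite (fF K).
- by [].
- exact: enum_uniq.
- move=> K L /=; rewrite !mem_enum => KM LM [z [zK zL]].
  by apply: ohull_cell zK _ => //; apply: ohull_sub => //; exact: cellP.
- have : {subset enum (cells M) <= cells M} by move=> K; rewrite mem_enum.
  elim: (enum (cells M)) => [|K s IH] sM.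
    by rewrite big_nil; exact: measurable_fun_set0.
  rewrite big_cons; apply/measurable_funU => //; first exact: bigsetU_measurable.
  split; first by apply: measurable_int (FE K _); apply: sM; rewrite inE eqxx.
  by apply: IH => L Ls; apply: sM; rewrite inE Ls orbT.
Qed.

End Cells.

(** * Faces and their normals *)

(** Two transpositions generate the permutations of three points. This frees the
    integral over a face from the order in which its vertices are enumerated. *)
Lemma symmetric3 (T : finType) (V : Type) (f : T -> T -> T -> V) a b c x y z :
  (forall p q r, f p r q = f p q r) -> (forall p q r, f r q p = f p q r) ->
  uniq [:: x; y; z] -> [set x; y; z]%SET = [set a; b; c]%SET -> f x y z = f a b c.
Proof.
move=> S Q uxyz E.
have xe : x \in [set a; b; c]%SET by rewrite -E !inE eqxx.
have ye : y \in [set a; b; c]%SET by rewrite -E !inE eqxx orbT.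
have ze : z \in [set a; b; c]%SET by rewrite -E !inE eqxx orbT.
move: uxyz; rewrite /= !inE !negb_or andbT => /andP[/andP[xy xz] yz].
move: xe ye ze xy xz yz; rewrite !inE.
by case/orP=> [/orP[]|] /eqP -> /orP[/orP[]|] /eqP -> /orP[/orP[]|] /eqP ->;
  rewrite ?eqxx// => _ _ _; first [exact: S | exact: Q | by rewrite S; exact: Q
    | by rewrite Q; exact: S | by rewrite S Q; exact: S].
Qed.

Section Norm.
Context {R : realType}.
Implicit Types (u p q r : 'rV[R]_3).

Lemma enormZ (a : R) u : enorm (a *: u) = `|a| * enorm u.
Proof. by rewrite /enorm dotZl dotZr mulrA sqrtrM ?mulr_ge0_le0 -?expr2 ?sqr_ge0// sqrtr_sqr. Qed.

Lemma enorm_gt0 u w : dot w u != 0 -> 0 < enorm u.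
Proof.
move=> wu; rewrite sqrtr_gt0 lt_neqAle eq_sym; apply/andP; split.
  apply: contra wu; rewrite /dot psumr_eq0 => [/allP H|i _]; last by rewrite -expr2 sqr_ge0.
  apply/eqP; apply: big1 => i _.
  by have := H i (mem_index_enum _); rewrite mulf_eq0 orbb => /eqP ->; rewrite mulr0.
by apply: sumr_ge0 => i _; rewrite -expr2 sqr_ge0.
Qed.

Lemma crossE p q : [/\ cross p q 0 0 = p 0 1 * q 0 2%:R - p 0 2%:R * q 0 1,
  cross p q 0 1 = p 0 2%:R * q 0 0 - p 0 0 * q 0 2%:R
  & cross p q 0 2%:R = p 0 0 * q 0 1 - p 0 1 * q 0 0].
Proof.
by split; rewrite mxE; congr (p _ _ * q _ _ - p _ _ * q _ _); exact/val_inj.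
Qed.

Lemma det2 (A : 'M[R]_2) : \det A = A 0 0 * A 1 1 - A 0 1 * A 1 0.
Proof.
rewrite (expand_det_row _ 0) !big_ord_recl big_ord0 addr0 /cofactor !det_mx11 !mxE /=.
rewrite expr0 mul1r expr1 mulN1r mulrN.
by congr (A _ _ * A _ _ - A _ _ * A _ _); exact/val_inj.
Qed.

Lemma det3 (A : 'M[R]_3) : \det A =
  A 0 0 * (A 1 1 * A 2%:R 2%:R - A 1 2%:R * A 2%:R 1)
  - A 0 1 * (A 1 0 * A 2%:R 2%:R - A 1 2%:R * A 2%:R 0)
  + A 0 2%:R * (A 1 0 * A 2%:R 1 - A 1 1 * A 2%:R 0).
Proof.
rewrite (expand_det_row _ 0) sum3E /cofactor !det2 !mxE /=.
rewrite expr0 mul1r expr1 mulN1r mulrN sqrrN expr1n mul1r.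
by congr (_ * (A _ _ * A _ _ - A _ _ * A _ _) - _ * (A _ _ * A _ _ - A _ _ * A _ _)
  + _ * (A _ _ * A _ _ - A _ _ * A _ _)); exact/val_inj.
Qed.

Lemma det_edges p q r : \det (edges p q r) = dot (cross p q) r.
Proof.
rewrite det3 dot3; have [-> -> ->] := crossE p q.
by rewrite !mxE /=; ring.
Qed.

Lemma dot_crossl p q : dot (cross p q) p = 0.
Proof. by rewrite dot3; have [-> -> ->] := crossE p q; ring. Qed.

Lemma dot_crossr p q : dot (cross p q) q = 0.
Proof. by rewrite dot3; have [-> -> ->] := crossE p q; ring. Qed.

End Norm.

Section Faces.
Context {R : realType}.
Variable M : mesh R.
Notation n := (nvert M).
Notation v := (@vert R M).
Implicit Types (K e : {set 'I_n}) (i j k l : 'I_n) (x y w : 'rV[R]_3).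
Implicit Types (F : 'rV[R]_3 -> R).

Definition fpt e (m : nat) : 'rV[R]_3 := nth 0 [seq v i | i <- enum e] m.
Definition tE e F : R := triI (fpt e 0) (fpt e 1) (fpt e 2) F.
Definition fcross e : 'rV[R]_3 := cross (fpt e 1 - fpt e 0) (fpt e 2 - fpt e 0).

Lemma face_intE e F : face_int e F = enorm (fcross e) * tE e F.
Proof. by []. Qed.

Lemma face_enum e : #|e| = 3%N -> exists a b c,
  [/\ enum e = [:: a; b; c], [/\ fpt e 0 = v a, fpt e 1 = v b & fpt e 2 = v c], uniq [:: a; b; c]
   & e = [set a; b; c]%SET].
Proof.
move=> e3; have := enum_uniq e; have := mem_enum e; rewrite cardE in e3.
rewrite /fpt; case: (enum e) e3 => [|a [|b [|c []]]]//= _ me ue; exists a, b, c; split=> //.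
by apply/setP => t; rewrite -me !inE orbA.
Qed.

Lemma tE_perm e a b c F : continuous F -> uniq [:: a; b; c] -> e = [set a; b; c]%SET ->
  tE e F = triI (v a) (v b) (v c) F.
Proof.
move=> cF u3 eE.
have e3 : #|e| = 3%N.
  rewrite eE; move: u3; rewrite /= !inE !negb_or andbT => /andP[/andP[ab ac] bc].
  by rewrite -finset.setUA cardsU1 cards2 !inE negb_or ab ac bc.
have [x [y [z [_ [e0 e1 e2] uxyz eE']]]] := face_enum e3.
rewrite /tE e0 e1 e2.
apply: (symmetric3 (f := fun p q r => triI (v p) (v q) (v r) F)) => //.
- by move=> p q r; exact: triI_swap.
- by move=> p q r; exact: triI_rot.
- by rewrite -eE' eE.
Qed.

Lemma edges_perm a b c i K : #|K| = 4%N -> i \in K -> K :\ i = [set a; b; c]%SET ->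
  uniq [:: a; b; c] ->
  [/\ uniq [:: a; b; c; i], K = [set a; b; c; i]%SET
    & forall (V : nmodType) (F : 'I_n -> V), \sum_(t in K) F t = F a + F b + F c + F i].
Proof.
move=> K4 iK E u3.
have nin t : t \in K :\ i -> t != i by rewrite !inE => /andP[].
have := nin a; have := nin b; have := nin c; rewrite E !inE !eqxx !orbT => /(_ isT) ci /(_ isT) bi /(_ isT) ai.
move: (u3); rewrite /= !inE !negb_or andbT => /andP[/andP[ab ac] bc].
split.
- by rewrite /= ?inE ?negb_or ab ac ai bc bi ci.
- by rewrite -(finset.setD1K iK) E finset.setUC.
- move=> V F; rewrite (big_setD1 i)//= E -finset.setUA big_setU1 ?inE ?negb_or ?ab//= big_setU1 ?inE//= big_set1.
  by rewrite addrC !addrA.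
Qed.

(** Six times the volume of the cell; dividing by the volume of the reference
    tetrahedron gives the determinant of the edge vectors without evaluating
    that volume. *)
Definition vol K : R := vint (hull K) (fun=> 1) / vint (@reftet R) (fun=> 1).

Lemma vol_det K i j k l : is_cell K -> uniq [:: j; k; l; i] -> K = [set j; k; l; i]%SET ->
  (forall (V : nmodType) (F : 'I_n -> V), \sum_(t in K) F t = F j + F k + F l + F i) ->
  vol K = `|\det (edgemx j k l i)|.
Proof.
move=> cK uK KE KS; have dA := edgemx_det (proj2 cK) uK KE KS.
have [r Kr] := hull_bounded K.
have c1 : continuous (fun _ : 'rV[R]_3 => 1 : R) by exact: cst_continuous.
have := tetra_change (v j) dA (measurable_hull cK) Kr c1.
rewrite -/(edgemx j k l i) hull_param// => E.
apply: (mulIf (lt0r_neq0 (@reftet_volume R))); rewrite /vol divfK ?lt0r_neq0 ?reftet_volume//.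
by rewrite [in RHS]E mulVKf// normr_eq0.
Qed.

(** Write a vector [w] as the combination of the edges [v j - v a] with coefficients
    [dot w (bgrad K j)]: only the edge that leaves the face contributes to
    [dot w u]. *)
Lemma face_vec K i a u : is_cell K -> i \in K -> a \in K :\ i ->
  (forall p q, p \in K :\ i -> q \in K :\ i -> dot u (v p - v q) = 0) ->
  u = dot u (v i - v a) *: bgrad K i.
Proof.
move=> cK iK aK H; apply/eqP; rewrite -subr_eq0; apply/eqP; apply: dot_inj => w.
rewrite [LHS]dotBr dotZr.
have -> : dot w u = \sum_(j in K) dot w (bgrad K j) * dot u (v j - v a).
  transitivity (dot (\sum_(j in K) dot w (bgrad K j) *: (v j - v a)) u).
    congr (dot _ u); under eq_bigr do rewrite scalerBr.
    by rewrite sumrB -scaler_suml bgrad_sum// scale0r subr0 bgrad_comb.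
  by rewrite dot_suml; apply: eq_bigr => j _; rewrite dotZl (dotC u).
rewrite (big_setD1 i)//= big1 ?addr0; first by rewrite mulrC subrr.
by move=> j jK; rewrite H ?mulr0.
Qed.

Lemma face_elt K i : is_cell K -> i \in K -> exists a, a \in K :\ i.
Proof.
by move=> [K4 _] iK; apply/card_gt0P; have := cardsD1 i K; rewrite iK K4 add1n => -[<-].
Qed.

Lemma bgrad_opp K i a : is_cell K -> i \in K -> a \in K :\ i -> dot (v i - v a) (bgrad K i) = 1.
Proof.
move=> cK iK; rewrite !inE => /andP[ai aK].
have := baryD K i (v a) (v i - v a); rewrite addrC subrK !bary_vert// eqxx eq_sym (negbTE ai).
by rewrite add0r.
Qed.

Lemma bgrad_face K i a b : is_cell K -> i \in K -> a \in K :\ i -> b \in K :\ i ->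
  dot (bgrad K i) (v a - v b) = 0.
Proof.
move=> cK iK; rewrite !inE => /andP[ai aK] /andP[bi bK].
have := baryD K i (v b) (v a - v b); rewrite addrC subrK !bary_vert//.
by rewrite !(eq_sym i) (negbTE ai) (negbTE bi) add0r dotC => <-.
Qed.

Lemma bgrad_gt0 K i : is_cell K -> i \in K -> 0 < enorm (bgrad K i).
Proof.
move=> cK iK; have [a aK] := face_elt cK iK; apply: (@enorm_gt0 _ _ (v i - v a)).
by rewrite bgrad_opp// oner_neq0.
Qed.

Lemma card_opp_face K i : is_cell K -> i \in K -> #|K :\ i| = 3%N.
Proof. by move=> [K4 _] iK; have := cardsD1 i K; rewrite iK K4 add1n => -[<-]. Qed.

(** The cross product of two edges of the face is orthogonal to it, hence a multiple
    of the gradient by [face_vec]; its product with the edge towards the opposite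
    vertex is the determinant of the cell. *)
Lemma fcross_norm K i : is_cell K -> i \in K ->
  enorm (fcross (K :\ i)) = vol K * enorm (bgrad K i).
Proof.
move=> cK iK; have [a [b [c [_ [e0 e1 e2] u3 eE]]]] := face_enum (card_opp_face cK iK).
have [uK KE KS] := edges_perm (proj1 cK) iK eE u3.
have ae : a \in K :\ i by rewrite eE !inE eqxx.
have P p : p \in K :\ i -> dot (fcross (K :\ i)) (v p - v a) = 0.
  move=> pK; have : p \in [set a; b; c]%SET by rewrite -eE.
  rewrite !inE /fcross e0 e1 e2 => /orP[/orP[|]|] /eqP ->.
  - by rewrite subrr dot0r.
  - exact: dot_crossl.
  - exact: dot_crossr.
have -> : fcross (K :\ i) = dot (fcross (K :\ i)) (v i - v a) *: bgrad K i.
  apply: face_vec => // p q pK qK.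
  have -> : v p - v q = (v p - v a) - (v q - v a) by rewrite opprB addrA subrK.
  by rewrite dotBr !P// subrr.
by rewrite enormZ (vol_det cK uK KE KS) det_edges /fcross e0 e1 e2.
Qed.

(** The outward normal of the face opposite [i], of length twice the area of the
    face: the normalization for which [tE] over the unit triangle needs no
    further factor. *)
Definition fnormal K i : 'rV[R]_3 := - vol K *: bgrad K i.

Lemma outer_normalE K i : is_cell K -> i \in K ->
  enorm (fcross (K :\ i)) *: outer_normal K (K :\ i) = fnormal K i.
Proof.
move=> cK iK; have [a ae] := face_elt cK iK; have g0 := bgrad_gt0 cK iK.
have KD j : j \in K :\: (K :\ i) -> j = i.
  by rewrite !inE negb_and negbK => /andP[/orP[/eqP//|/negbTE ->]].
have [N1 NF NK] : is_outer_normal K (K :\ i) (outer_normal K (K :\ i)).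
  apply: (@xgetPex _ 0 [set u | is_outer_normal K (K :\ i) u]).
  exists (- (enorm (bgrad K i))^-1 *: bgrad K i); split.
  - by rewrite enormZ normrN ger0_norm ?invr_ge0 ?ltW// mulVf// gt_eqF.
  - by move=> p q pK qK; rewrite dotZl bgrad_face// mulr0.
  - move=> p q pK /KD ->; rewrite dotZl dotC bgrad_opp// mulr1.
    by rewrite oppr_lt0 invr_gt0.
have E := face_vec cK iK ae NF.
have k0 : dot (outer_normal K (K :\ i)) (v i - v a) < 0.
  by apply: NK => //; rewrite !inE eqxx iK.
move: E k0 N1; set k := dot _ _ => -> k0; rewrite enormZ ltr0_norm// => kg.
rewrite scalerA fcross_norm// -mulrA (mulrC (enorm _)); congr (_ *: _).
by rewrite -[k]opprK mulNr kg mulrN1.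
Qed.

End Faces.

(** * Green's formula on the cells *)

Section Linearity.
Context {R : realType}.
Implicit Types (f g F : 'rV[R]_3 -> R) (E : set 'rV[R]_3).

Lemma cont_sum (J : Type) (r : seq J) (P : pred J) (f : J -> 'rV[R]_3 -> R) :
  (forall k, P k -> continuous (f k)) -> continuous (fun x => \sum_(k <- r | P k) f k x).
Proof.
move=> cf; rewrite (_ : (fun x => _) = \sum_(k <- r | P k) f k); last first.
  by apply/funext => x; rewrite fct_sumE.
elim/big_ind : _ => //; first exact: cst_continuous.
by move=> g h cg ch; exact: contD.
Qed.

Lemma contZ (a : R) f : continuous f -> continuous (fun x => a * f x).
Proof. by move=> cf; apply: contM => //; exact: cst_continuous. Qed.

Lemma vintD E r f g : measurable (@pt R @^-1` E : set (prod3 R)) -> E `<=` ccube 0 r ->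
  continuous f -> continuous g ->
  vint E (fun x => f x + g x) = vint E f + vint E g.
Proof.
move=> mE Er cf cg; rewrite /vint -RintegralD//.
- exact: continuous_integrable3 mE Er cf.
- exact: continuous_integrable3 mE Er cg.
Qed.

Lemma vintZ E r (a : R) f : measurable (@pt R @^-1` E : set (prod3 R)) -> E `<=` ccube 0 r ->
  continuous f -> vint E (fun x => a * f x) = a * vint E f.
Proof.
by move=> mE Er cf; rewrite /vint -RintegralZl//; exact: continuous_integrable3 mE Er cf.
Qed.

Lemma vint_sum E r (J : Type) (s : seq J) (P : pred J) (f : J -> 'rV[R]_3 -> R) :
  measurable (@pt R @^-1` E : set (prod3 R)) -> E `<=` ccube 0 r ->
  (forall k, P k -> continuous (f k)) ->
  vint E (fun x => \sum_(k <- s | P k) f k x) = \sum_(k <- s | P k) vint E (f k).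
Proof.
move=> mE Er cf; elim: s => [|k s IH].
  rewrite big_nil; under eq_vint do rewrite big_nil.
  by rewrite /vint /Rintegral integral0.
rewrite big_cons; under eq_vint do rewrite big_cons.
case: ifP => Pk //; rewrite (vintD mE Er) ?IH//; first exact: cf.
exact: cont_sum.
Qed.

Lemma triID a b c f g : continuous f -> continuous g ->
  triI a b c (fun x => f x + g x) = triI a b c f + triI a b c g.
Proof.
move=> cf cg; rewrite /triI -RintegralD//; first exact: unit_triangle_closed.
- exact: (tri_integrable a b c cf).
- exact: (tri_integrable a b c cg).
Qed.

Lemma triIZ a b c (k : R) f : continuous f ->
  triI a b c (fun x => k * f x) = k * triI a b c f.
Proof.
move=> cf; rewrite /triI -RintegralZl//; first exact: unit_triangle_closed.
exact: (tri_integrable a b c cf).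
Qed.

Lemma triI0 a b c : triI a b c (fun=> 0 : R) = 0.
Proof. by rewrite /triI /Rintegral integral0. Qed.

Lemma triI_sum a b c (J : Type) (s : seq J) (P : pred J) (f : J -> 'rV[R]_3 -> R) :
  (forall k, P k -> continuous (f k)) ->
  triI a b c (fun x => \sum_(k <- s | P k) f k x) = \sum_(k <- s | P k) triI a b c (f k).
Proof.
move=> cf; elim: s => [|k s IH].
  rewrite big_nil -[RHS](triI0 a b c); congr (triI a b c).
  by apply/funext => x; rewrite big_nil.
rewrite big_cons; case: (boolP (P k)) => Pk.
  rewrite -IH -triID//; [|exact: cf|exact: cont_sum].
  by congr (triI a b c); apply/funext => x; rewrite big_cons Pk.
by rewrite -IH; congr (triI a b c); apply/funext => x; rewrite big_cons (negbTE Pk).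
Qed.

Lemma derive_grad F w x : C1 F -> 'D_w F x = dot w (grad F x).
Proof. by move=> [dF _]; rewrite derive_partial//; apply: eq_bigr => i _; rewrite mxE. Qed.

Definition divergence (U : 'rV[R]_3 -> 'rV[R]_3) (x : 'rV[R]_3) : R :=
  \sum_(k < 3) partial k (component k U) x.

End Linearity.

Section Divergence.
Context {R : realType}.
Variable M : mesh R.
Notation n := (nvert M).
Notation v := (@vert R M).
Implicit Types (K : {set 'I_n}) (i j k l : 'I_n) (x w : 'rV[R]_3).
Implicit Types (F : 'rV[R]_3 -> R).

Lemma cell_edge K i j F : is_cell K -> i \in K -> j \in K -> C1 F ->
  vint (hull K) ('D_(v i - v j) F) = vol K * (tE (K :\ j) F - tE (K :\ i) F).
Proof.
move=> cK iK jK CF; have cF := C1_continuous CF.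
have [->|ij] := eqVneq i j.
  rewrite !subrr mulr0 (@eq_vint _ _ _ (fun=> 0)); first by rewrite /vint /Rintegral integral0.
  by move=> x _; rewrite derive_grad// dot0l.
have [k [l [uK KE KS]]] := cell_order (proj1 cK) iK jK ij.
have dA := edgemx_det (proj2 cK) uK KE KS; have [r Kr] := hull_bounded K.
have := tetra_edge dA (measurable_hull cK) Kr CF (hull_param cK uK KE KS).
rewrite -/(edgemx j k l i) -(vol_det cK uK KE KS) => ->.
move: (uK); rewrite /= !inE !negb_or => /andP[/and3P[jk jl ji] /andP[/andP[kl ki] /andP[li _]]].
have -> : tE (K :\ j) F = triI (v i) (v k) (v l) F.
  apply: tE_perm => //; first by rewrite /= !inE !negb_or !(eq_sym i) ki li kl.
  apply/setP => t; rewrite KE !inE; have [->|tj] := eqVneq t j.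
    by rewrite (negbTE ji) (negbTE jk) (negbTE jl).
  by rewrite /=; do 3 case: eqP.
have -> // : tE (K :\ i) F = triI (v j) (v k) (v l) F.
apply: tE_perm => //; first by rewrite /= !inE !negb_or jk jl kl.
apply/setP => t; rewrite KE !inE; have [->|ti] := eqVneq t i.
  by rewrite !(eq_sym i) (negbTE ji) (negbTE ki) (negbTE li).
by rewrite /= orbF.
Qed.

(** The gradients of the barycentric coordinates add up to zero, so [w] is a
    combination of the edges [v i - v j], to which [cell_edge] applies. *)
Lemma cell_div K w F : is_cell K -> C1 F ->
  vint (hull K) ('D_w F) = \sum_(i in K) dot w (fnormal K i) * tE (K :\ i) F.
Proof.
move=> cK CF; have cF := C1_continuous CF; have [r Kr] := hull_bounded K.
have mK := measurable_hull cK.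
have [j jK] : exists j, j \in K by apply/card_gt0P; rewrite (proj1 cK).
have -> : 'D_w F = fun x => \sum_(i in K) dot w (bgrad K i) * 'D_(v i - v j) F x.
  apply/funext => x; under eq_bigr do rewrite derive_grad// -dotZl.
  rewrite -dot_suml derive_grad//; congr dot.
  under eq_bigr do rewrite scalerBr.
  by rewrite sumrB -scaler_suml bgrad_sum// scale0r subr0 bgrad_comb.
rewrite (vint_sum _ mK Kr); last by move=> i iK; apply: contZ; exact: continuous_derive.
have gen (T : 'I_n -> R) : \sum_(i in K) dot w (bgrad K i) * (vol K * (T j - T i)) =
    \sum_(i in K) dot w (fnormal K i) * T i.
  rewrite (eq_bigr (fun i => dot w (bgrad K i) * vol K * T j + dot w (fnormal K i) * T i)).
    by rewrite big_split /= -!mulr_suml bgrad_sum// !mul0r add0r.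
  by move=> i iK; rewrite /fnormal dotZr; ring.
rewrite -(gen (fun i => tE (K :\ i) F)); apply: eq_bigr => i iK.
rewrite (vintZ _ mK Kr); last exact: continuous_derive.
by congr (_ * _); exact: cell_edge.
Qed.

(** The divergence theorem for the components of the product of [U] and [phi]. *)
Lemma cell_green K (U : 'rV[R]_3 -> 'rV[R]_3) (phi : 'rV[R]_3 -> R) : is_cell K ->
  (forall d : 'I_3, C1 (component d U)) -> C1 phi ->
  vint (hull K) (fun x => dot (U x) (grad phi x) + divergence U x * phi x) =
  \sum_(i in K) tE (K :\ i) (fun x => dot (U x) (fnormal K i) * phi x).
Proof.
move=> cK CU Cphi; have [r Kr] := hull_bounded K; have mK := measurable_hull cK.
have CM (k : 'I_3) : C1 (fun x => component k U x * phi x) by exact: C1M.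
have E x : dot (U x) (grad phi x) + divergence U x * phi x =
    \sum_(k < 3) 'D_(delta_mx 0 k) (fun x => component k U x * phi x) x.
  rewrite /dot /divergence mulr_suml -big_split; apply: eq_bigr => k _.
  rewrite -/(partial k _ x) partialM ?mxE; [|exact: (CU k).1|exact: Cphi.1].
  by rewrite /component /=; ring.
rewrite (eq_vint (fun x _ => E x)) (vint_sum _ mK Kr); last first.
  by move=> k _; exact: continuous_derive.
under eq_bigr do rewrite cell_div//.
rewrite exchange_big; apply: eq_bigr => i iK /=.
rewrite /tE; set a := fpt _ _; set b := fpt _ _; set c := fpt _ _.
under eq_bigr => k _.
  rewrite -triIZ; last exact/C1_continuous/CM.
  over.
rewrite -triI_sum; last by move=> k _; apply/contZ/C1_continuous.
congr (triI a b c); apply/funext => x; rewrite /dot mulr_suml; apply: eq_bigr => k _.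
rewrite (bigD1 k)//= mxE eqxx big1 ?addr0 ?mul1r => [|q qk]; last by rewrite !mxE (negbTE qk) andbF mul0r.
by rewrite eqxx /component /=; ring.
Qed.

End Divergence.

Section TwoCells.
Context {R : realType}.
Variable Omega : set 'rV[R]_3.
Variable M : mesh R.
Hypothesis tri : triangulation M Omega.
Notation n := (nvert M).
Notation v := (@vert R M).
Implicit Types (K L e : {set 'I_n}) (i j k : 'I_n) (x y : 'rV[R]_3).

Lemma face_elt_cell K e : is_cell K -> e \subset K -> #|e| = 3%N ->
  exists2 i, i \in K & e = K :\ i.
Proof.
move=> [K4 _] eK e3; have : #|K :\: e| == 1%N by rewrite cardsD (finset.setIidPr eK) K4 e3.
move/cards1P => [i E]; exists i.
  have : i \in K :\: e by rewrite E inE eqxx.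
  by rewrite !inE => /andP[].
by rewrite -E finset.setDDr finset.setDv finset.set0U (finset.setIidPr eK).
Qed.

(** If the gradients pointed to the same side, both cells would contain in their
    interiors a point close to the centroid of the common face. *)
Lemma opposite K L i j : K \in cells M -> L \in cells M -> i \in K -> j \in L ->
  K :\ i = L :\ j -> K != L -> exists2 c : R, c < 0 & bgrad L j = c *: bgrad K i.
Proof.
move=> KM LM iK jL eKL KL; have cK := cellP tri KM; have cL := cellP tri LM.
have [a aK] := face_elt cK iK.
have g : bgrad L j = dot (bgrad L j) (v i - v a) *: bgrad K i.
  by apply: face_vec => // p q; rewrite eKL; exact: bgrad_face.
exists (dot (bgrad L j) (v i - v a)) => //.
rewrite ltNge; apply: contraNN KL => c0; apply/eqP.
have aL : a \in L :\ j by rewrite -eKL.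
have c1 : dot (bgrad L j) (v i - v a) = bary L j (v i).
  have := baryD L j (v a) (v i - v a); rewrite addrC subrK => ->; rewrite bary_vert//; last first.
    by move: aL; rewrite !inE => /andP[].
  move: aL; rewrite !inE eq_sym => /andP[/negbTE -> _].
  by rewrite add0r dotC.
have cp : 0 < bary L j (v i).
  rewrite lt_neqAle -c1 c0 andbT eq_sym; apply/eqP => z.
  by have := bgrad_gt0 cL jL; rewrite g z enormZ normr0 mul0r ltxx.
set e := K :\ i in eKL.
have e3 : #|e| = 3%N by exact: card_opp_face.
have s1 : \sum_(p in e) (3%:R^-1 : R) = 1.
  by rewrite sumr_const e3; field.
pose x0 := \sum_(p in e) (3%:R^-1 : R) *: v p.
have bK := bary_sub cK (finset.subD1set K i) s1.
have eL : e \subset L by rewrite eKL; exact: finset.subD1set.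
have bL := bary_sub cL eL s1.
pose S := \sum_(p in e) `|bary L p (v i)|.
have S0 : 0 <= S by apply: sumr_ge0.
(* The point [y] is so close to the centroid [x0] of the face that the
   coordinates in [L] of the vertices of the face stay positive, whatever their
   values [bary L p (v i)] at [v i]. *)
pose t : R := (2 + 3 * S)^-1.
have t0 : 0 < t by rewrite invr_gt0; lra.
have t1 : t * (2 + 3 * S) = 1 by rewrite mulVf// gt_eqF//; lra.
have tS : 0 <= t * S by apply: mulr_ge0 => //; exact: ltW.
pose y := (1 - t) *: x0 + t *: v i.
have yK : ohull K y.
  move=> p pK; rewrite /y bary_affine bK// bary_vert// -/e.
  have [pi|pi] := eqVneq p i; first by rewrite pi !inE eqxx /= mulr0 add0r mulr1.
  by rewrite !inE pi pK /= mulr0 addr0 mulr_gt0// ?invr_gt0//; lra.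
have yL : ohull L y.
  move=> p pL; rewrite /y bary_affine bL//.
  case: (boolP (p \in e)) => pe; last first.
    have -> : p = j by apply/eqP; move: pe; rewrite eKL !inE pL andbT negbK.
    by rewrite mulr0 add0r mulr_gt0.
  have : `|bary L p (v i)| <= S by rewrite /S (big_setD1 p)//= lerDl; exact: sumr_ge0.
  rewrite ler_norml => /andP[h _].
  have : t * - S <= t * bary L p (v i) by rewrite ler_pM2l.
  lra.
exact: (ohull_cell tri KM LM yK (ohull_sub cL yL)).
Qed.

Lemma fnormal_opp K L i j : K \in cells M -> L \in cells M -> i \in K -> j \in L ->
  K :\ i = L :\ j -> K != L -> fnormal L j = - fnormal K i.
Proof.
move=> KM LM iK jL eKL KL; have cK := cellP tri KM; have cL := cellP tri LM.
have [c c0 g] := opposite KM LM iK jL eKL KL.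
have := fcross_norm cL jL; rewrite -eKL fcross_norm// g enormZ mulrA.
move/(mulIf (lt0r_neq0 (bgrad_gt0 cK iK))); rewrite ltr0_norm// => E.
by rewrite /fnormal g scalerA E scaleNr opprK mulrN mulNr.
Qed.

Lemma face_cells_mem e K : (K \in face_cells e) = (e \subset K) && (K \in cells M).
Proof. by rewrite mem_filter mem_enum. Qed.

(** Three cells sharing a face would have pairwise opposite normals. *)
Lemma face_cells_le2 e : #|e| = 3%N -> (size (face_cells e) <= 2)%N.
Proof.
move=> e3; have : uniq (face_cells e) by apply/filter_uniq/enum_uniq.
have := face_cells_mem e.
case: (face_cells e) => [|K [|L [|Q s]]]// H.
have := H K; have := H L; have := H Q; rewrite !inE !eqxx !orbT /=.
move=> /esym/andP[eQ QM] /esym/andP[eL LM] /esym/andP[eK KM].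
rewrite !inE !negb_or => /andP[/and3P[KL KQ _] /andP[/andP[LQ _] _]].
have [i iK E1] := face_elt_cell (cellP tri KM) eK e3.
have [j jL E2] := face_elt_cell (cellP tri LM) eL e3.
have [k kQ E3] := face_elt_cell (cellP tri QM) eQ e3.
have [c c0 g1] := opposite KM LM iK jL (etrans (esym E1) E2) KL.
have [d d0 g2] := opposite LM QM jL kQ (etrans (esym E2) E3) LQ.
have [f f0 g3] := opposite KM QM iK kQ (etrans (esym E1) E3) KQ.
have [a aK] := face_elt (cellP tri KM) iK.
have := bgrad_opp (cellP tri KM) iK aK => o.
have : dot (v i - v a) (bgrad Q k) = dot (v i - v a) (bgrad Q k) by [].
rewrite {1}g2 g3 g1 !dotZr o !mulr1 => E.
have : 0 < d * c by rewrite nmulr_rgt0.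
by rewrite E ltNge (ltW f0).
Qed.

(** The vector [fnormal], indexed by the face instead of the opposite vertex. *)
Definition fnorm K e : 'rV[R]_3 := enorm (fcross e) *: outer_normal K e.

Lemma sum_faces (V : nmodType) K (H : {set 'I_n} -> V) : is_cell K ->
  \sum_(i in K) H (K :\ i) = \sum_(e : {set 'I_n} | (#|e| == 3%N) && (e \subset K)) H e.
Proof.
move=> cK; rewrite -(@big_imset _ _ _ _ _ (fun i => K :\ i) (mem K) H) /=; last first.
  move=> i j iK jK /setP /(_ i); have {}iK : i \in K by [].
  rewrite !inE eqxx iK andbT /=.
  by case: eqP.
apply: eq_bigl => e; apply/imsetP/andP => [[i iK ->]|[/eqP e3 eK]].
  by rewrite card_opp_face// finset.subD1set.
by have [i iK E] := face_elt_cell cK eK e3; exists i.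
Qed.

Lemma sum_cells_faces (V : nmodType) (H : {set 'I_n} -> {set 'I_n} -> V) :
  \sum_(K in cells M) \sum_(i in K) H K (K :\ i) =
  \sum_(e : {set 'I_n} | #|e| == 3%N) \sum_(K <- face_cells e) H K e.
Proof.
under eq_bigr => K KM.
  rewrite sum_faces; last exact: (cellP tri KM).
  over.
rewrite (exchange_big_dep (fun e : {set 'I_n} => #|e| == 3%N)) /=; last by move=> K e _ /andP[].
apply: eq_bigr => e e3; rewrite /face_cells big_filter big_enum_cond /=.
by apply: eq_bigl => K; rewrite e3.
Qed.

Lemma cells_green (U : {set 'I_n} -> 'rV[R]_3 -> 'rV[R]_3) (phi : {set 'I_n} -> 'rV[R]_3 -> R) :
  (forall K, K \in cells M -> forall d : 'I_3, C1 (component d (U K))) ->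
  (forall K, K \in cells M -> C1 (phi K)) ->
  \sum_(K in cells M)
    vint (hull K) (fun x => dot (U K x) (grad (phi K) x) + divergence (U K) x * phi K x) =
  \sum_(e : {set 'I_n} | #|e| == 3%N) \sum_(K <- face_cells e)
     tE e (fun x => dot (U K x) (fnorm K e) * phi K x).
Proof.
move=> CU Cphi; rewrite -sum_cells_faces; apply: eq_bigr => K KM.
have cK := cellP tri KM; rewrite cell_green//; [|exact: CU|exact: Cphi].
by apply: eq_bigr => i iK; rewrite /fnorm outer_normalE.
Qed.

End TwoCells.

(** * Piecewise polynomials and their weak divergence *)

Section PiecewisePolynomials.
Context {R : realType}.
Variable Omega : set 'rV[R]_3.
Variable M : mesh R.
Hypothesis Omega_open : open Omega.
Hypothesis Omega_bounded : bounded_set Omega.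
Hypothesis tri : triangulation M Omega.
Notation n := (nvert M).
Implicit Types (K L e : {set 'I_n}) (i j : 'I_n) (x y w : 'rV[R]_3).
Implicit Types (f g phi : 'rV[R]_3 -> R) (c d : {set 'I_n} -> poly3 R).
Implicit Types (u : 'rV[R]_3 -> 'rV[R]_3).
Notation mu := (@leb3 R).
Notation D := (@pt R @^-1` Omega : set (prod3 R)).

(** Only the open cells are looked at: on the faces a function of a finite element
    space may take any value. *)
Definition ispw f c := forall K, K \in cells M -> forall x, ohull K x -> f x = poly_eval (c K) x.

Definition pwfun c x : R := \sum_(K in cells M) \1_(ohull K) x * poly_eval (c K) x.

Lemma pwfunE c : ispw (pwfun c) c.
Proof.
move=> K KM x xK; rewrite /pwfun (big_setD1 K)//= indicE mem_set// mul1r big1 ?addr0//.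
move=> L; rewrite !inE => /andP[LK LM]; rewrite indicE memNset ?mul0r// => xL.
by move/eqP: LK; apply; apply: (ohull_cell tri LM KM xL (ohull_sub (cellP tri KM) xK)).
Qed.

Lemma measurable_pwfun c : measurable_fun D (pwfun c \o @pt R).
Proof.
rewrite (_ : pwfun c \o _ = \sum_(K in cells M) (fun z => \1_(ohull K) (pt z) * poly_eval (c K) (pt z))).
  elim/big_ind : _ => //; first exact: measurable_cst.
    by move=> f g mf mg; exact: measurable_funD.
  move=> K KM.
  have m1 : measurable_fun D (fun z => \1_(ohull K) (pt z) : R).
    rewrite (_ : (fun z => _) = \1_(@pt R @^-1` ohull K)).
      by apply: measurable_indic; exact: measurable_ohull.
    by apply/funext => z; rewrite !indicE.
  have m2 := @measurable_mpoly R (c K) D.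
  have := measurable_funM m1 m2; exact.
by apply/funext => z; rewrite fct_sumE.
Qed.

Lemma L2_pwfun c : L2 Omega (pwfun c).
Proof.
have [r Or] := bounded_cube Omega_bounded.
have H K : exists N, forall x, ccube 0 r x -> `|poly_eval (c K) x| <= N.
  by apply: continuous_bounded; exact: continuous_poly.
have [N HN] := choice H.
apply: (L2_bounded Omega_open Omega_bounded (M := \sum_(K in cells M) `|N K|)).
  exact: measurable_pwfun.
move=> x Ox; apply: le_trans (ler_norm_sum _ _ _) _; apply: ler_sum => K _.
rewrite normrM -[leRHS]mul1r; apply: ler_pM => //.
  by rewrite indicE; case: (_ \in _); rewrite ?normr1 ?normr0.
by apply: le_trans (HN _ _ _) (ler_norm _) => i; exact/ltW/Or.
Qed.

Lemma L2_continuous f : continuous f -> L2 Omega f.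
Proof.
move=> cf; have [r Or] := bounded_cube Omega_bounded.
have [N HN] := continuous_bounded r cf.
apply: (L2_bounded Omega_open Omega_bounded (M := N)).
  exact: continuous_measurable.
by move=> x Ox; apply: HN => i; exact/ltW/Or.
Qed.

Lemma ispw_inter f c : ispw f c -> forall x, inter M x -> f x = pwfun c x.
Proof. by move=> fc x [K KM xK]; rewrite (fc K)// (pwfunE _ KM). Qed.

Lemma eq_ispw f g c : (forall x, inter M x -> f x = g x) -> ispw f c -> ispw g c.
Proof. by move=> fg fc K KM x xK; rewrite -fg ?(fc K)//; exists K. Qed.

Lemma inter_ae_eq (V : Type) (f g : 'rV[R]_3 -> V) :
  (forall x, inter M x -> f x = g x) -> ae_eq_on Omega f g.
Proof. by move=> fg; apply: (inter_ae Omega_open tri) => z; exact: fg. Qed.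

Lemma L2_inter f g : measurable_fun D (f \o @pt R) -> (forall x, inter M x -> f x = g x) ->
  L2 Omega g -> L2 Omega f.
Proof.
move=> mf fg /(L2P Omega_open g).1[mg /integrableP[mg2 ig2]].
apply/(L2P Omega_open f); split=> //.
have [mN N0] := inter_null Omega_open tri.
apply/integrableP; split; first by apply/measurable_EFinP; exact: measurable_funX.
have E (h : prod3 R -> \bar R) : (\int[mu]_(z in D) h z =
    \int[mu]_(z in D `&` (@pt R @^-1` inter M)) h z)%E.
  by rewrite (integral_setD_null D h mN N0) setDD.
move: ig2; rewrite 2!E; congr (_ < _)%E; apply: eq_integral => z; rewrite inE => -[_ zI].
by rewrite /= fg.
Qed.

Lemma L2_pw f c : measurable_fun D (f \o @pt R) -> ispw f c -> L2 Omega f.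
Proof. by move=> mf fc; exact: L2_inter (ispw_inter fc) (L2_pwfun c). Qed.

Lemma ispwD f g c d : ispw f c -> ispw g d -> ispw (fun x => f x + g x) (fun K => c K + d K).
Proof. by move=> fc gd K KM x xK; rewrite peE (fc K)// (gd K). Qed.
Lemma ispwM f g c d : ispw f c -> ispw g d -> ispw (fun x => f x * g x) (fun K => c K * d K).
Proof. by move=> fc gd K KM x xK; rewrite peE (fc K)// (gd K). Qed.
Lemma ispwB f g c d : ispw f c -> ispw g d -> ispw (fun x => f x - g x) (fun K => c K - d K).
Proof. by move=> fc gd K KM x xK; rewrite peB (fc K)// (gd K). Qed.
Lemma ispwC (a : R) : ispw (fun=> a) (fun=> mpolyC 3 a).
Proof. by move=> K KM x xK; rewrite peE. Qed.

Lemma pwP (N : nat) f : piecewise_poly M N f <-> exists2 c, ispw f c & forall K, deg_le N (c K).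
Proof.
split=> [fN|[c fc cN] K KM]; last first.
  exists (poly_eval (c K)); first by exists (c K); [exact: cN|].
  by move=> x; rewrite (hull_interior (cellP tri KM)); exact: fc.
have H K : exists p, deg_le N p /\ (K \in cells M -> forall x, ohull K x -> f x = poly_eval p x).
  have [KM|KM] := boolP (K \in cells M); last by exists 0; split=> //; exact: deg_le0.
  have [q [p pN ->] fq] := fN K KM; exists p; split=> // _ x xK.
  by apply: fq; rewrite (hull_interior (cellP tri KM)).
by have [c Hc] := choice H; exists c => K; have [] := Hc K.
Qed.

Lemma leb3_open (U : set 'rV[R]_3) x : open U -> U x -> (0 < mu (@pt R @^-1` U))%E.
Proof.
move=> oU Ux; have := Ux; rewrite {1}(open_cubes oU) => -[q qU _].
have r0 : 0 < (rradius q : R) by rewrite invr_gt0 ltr0n.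
apply: (@lt_le_trans _ _ (mu (@pt R @^-1` cube (rcenter q) (rradius q)))).
  by rewrite leb3_cubeE// lte_fin exprn_gt0// mulrn_wgt0.
apply: le_measure; rewrite ?inE; [exact: measurable_cube|exact: measurable_open|].
by move=> z zq; apply: qU => i; exact/ltW/zq.
Qed.

(** A polynomial that does not vanish at a point of an open cell does not vanish on
    a neighbourhood, which has positive measure. *)
Lemma pw_ae0 f c : ispw f c -> ae_eq_on Omega f (fun=> 0) -> forall x, inter M x -> f x = 0.
Proof.
move=> fc [N [mN N0 HN]] x [K KM xK]; apply/eqP; apply: contraT => fx.
pose U := ohull K `&` [set y | poly_eval (c K) y != 0].
have oU : open U.
  apply: openI; first exact: open_ohull.
  have -> : [set y | poly_eval (c K) y != 0] = poly_eval (c K) @^-1` [set t | t != 0] by [].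
  apply: open_comp; first by move=> y _; exact: continuous_poly.
  exact: open_neq.
have Ux : U x by split=> //=; rewrite -(fc K).
suff : (mu (@pt R @^-1` U) <= 0)%E by rewrite leNgt (leb3_open oU Ux).
rewrite -N0; apply: le_measure; rewrite ?inE//; first exact: measurable_open.
move=> z [zK zc]; apply: HN => /= H; move: zc; rewrite /= -(fc K)// H ?eqxx//.
exact: (ohull_Omega tri KM).
Qed.

Lemma ae_cells (P : R * R * R -> Prop) :
  (forall K, K \in cells M -> {ae mu, forall z, ohull K (pt z) -> P z}) ->
  {ae mu, forall z, Omega (pt z) -> P z}.
Proof.
move=> H.
have : {ae mu, forall z, forall K, K \in enum (cells M) -> ohull K (pt z) -> P z}.
  have : forall K, K \in enum (cells M) -> K \in cells M by move=> K; rewrite mem_enum.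
  elim: (enum (cells M)) => [|K s IH] sM.
    by apply: (ae_imp (P := fun=> True)) => //; exact: aeW.
  have Hs : {ae mu, forall z, forall K, K \in s -> ohull K (pt z) -> P z}.
    by apply: IH => L Ls; apply: sM; rewrite inE Ls orbT.
  have HK := H K (sM K (mem_head _ _)).
  by apply: ae_imp2 Hs HK => z zs zK L; rewrite inE => /predU1P[->//|]; exact: zs.
have I := inter_ae Omega_open tri (P := fun z => inter M (pt z)) (fun z zI => zI).
by apply: ae_imp2 I => z zI zP /zI[K KM zK]; apply: (zP K) => //; rewrite mem_enum.
Qed.

Implicit Types (C : {set 'I_n} -> 'I_3 -> poly3 R).
Definition evalv (P : 'I_3 -> poly3 R) x : 'rV[R]_3 := \row_a poly_eval (P a) x.
Definition pdivp (P : 'I_3 -> poly3 R) : poly3 R := \sum_(a < 3) mderiv a (P a).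
Definition ispwv u C := forall a : 'I_3, ispw (component a u) (fun K => C K a).

Lemma evalv_comp P (a : 'I_3) : component a (evalv P) = poly_eval (P a).
Proof. by apply/funext => x; rewrite /component mxE. Qed.

Lemma pdiv_evalv P : divergence (evalv P) = poly_eval (pdivp P).
Proof.
apply/funext => x; rewrite /divergence /pdivp pe_sum; apply: eq_bigr => a _.
by rewrite evalv_comp partial_poly.
Qed.

Lemma ispwvE u C K x : ispwv u C -> K \in cells M -> ohull K x -> u x = evalv (C K) x.
Proof. by move=> uC KM xK; apply/rowP => a; rewrite mxE -(uC a K KM x xK). Qed.

Lemma dot_evalvE P x w : dot (evalv P x) w = \sum_(a < 3) poly_eval (P a) x * w 0 a.
Proof. by apply: eq_bigr => a _; rewrite mxE. Qed.

Lemma pw_green u C phi : ispwv u C -> C1 phi ->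
  innerv Omega u (grad phi) + inner Omega (pwfun (fun K => pdivp (C K))) phi =
  \sum_(e : {set 'I_n} | #|e| == 3%N) \sum_(K <- face_cells e)
     tE e (fun x => dot (evalv (C K) x) (fnorm K e) * phi x).
Proof.
move=> uC Cphi; have cphi := C1_continuous Cphi.
rewrite -(cells_green tri (U := fun K => evalv (C K)) (phi := fun=> phi))//; last first.
  by move=> K KM a; rewrite evalv_comp; exact: C1_poly.
have c1 K : continuous (fun x => dot (evalv (C K) x) (grad phi x)).
  rewrite (_ : (fun x => _) = fun x => \sum_(a < 3) poly_eval (C K a) x * partial a phi x).
    by apply: cont_sum => a _; apply: contM; [exact: continuous_poly|exact: Cphi.2].
  by apply/funext => x; rewrite dot_evalvE; apply: eq_bigr => a _; rewrite mxE.
have c2 K : continuous (fun x => divergence (evalv (C K)) x * phi x).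
  by rewrite pdiv_evalv; apply: contM => //; exact: continuous_poly.
have -> : innerv Omega u (grad phi) =
    \sum_(K in cells M) vint (hull K) (fun x => dot (evalv (C K) x) (grad phi x)).
  apply: (vint_cells Omega_open tri) => K KM //= x xK.
  by rewrite (ispwvE uC KM xK).
have -> : inner Omega (pwfun (fun K => pdivp (C K))) phi =
    \sum_(K in cells M) vint (hull K) (fun x => divergence (evalv (C K)) x * phi x).
  apply: (vint_cells Omega_open tri) => K KM //= x xK.
  by rewrite (pwfunE _ KM)// pdiv_evalv.
rewrite -big_split; apply: eq_bigr => K KM /=.
have [r Kr] := hull_bounded K.
by rewrite (vintD (measurable_hull (cellP tri KM)) Kr).
Qed.

Lemma tri_hull e z : #|e| = 3%N -> unit_triangle z ->
  hull e (tripoint (fpt e 0) (fpt e 1) (fpt e 2) z).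
Proof.
move=> e3 [z1 z2 z12]; have [a [b [c [_ [-> -> ->] u3 eE]]]] := face_enum e3.
move: u3; rewrite /= !inE !negb_or andbT => /andP[/andP[ab ac] bc].
exists (fun t => if t == a then 1 - z.1 - z.2 else if t == b then z.1 else z.2).
have S (V : nmodType) (F : 'I_n -> V) : \sum_(t in e) F t = F a + F b + F c.
  by rewrite eE -finset.setUA big_setU1 ?inE ?negb_or ?ab//= big_setU1 ?inE//= big_set1 addrA.
rewrite !S !eqxx !(eq_sym _ a) (negbTE ab) (negbTE ac) eq_sym (negbTE bc); split.
- by move=> t; case: ifP => _; [|case: ifP => _ //]; lra.
- by ring.
- by rewrite /tripoint; apply/rowP => t; rewrite !mxE; ring.
Qed.

Lemma hull_faceE K i x : is_cell K -> i \in K -> hull (K :\ i) x -> hull K x /\ bary K i x = 0.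
Proof.
move=> cK iK [c [c0 c1 xE]].
have H := bary_sub cK (finset.subD1set K i) c1; rewrite -xE in H.
split; last by rewrite H// !inE eqxx.
by rewrite hullE// => j jK; rewrite H//; case: ifP.
Qed.

Lemma face_not_ohull K L e x : K \in cells M -> L \in cells M -> e \subset L -> #|e| = 3%N ->
  hull e x -> ~ ohull K x.
Proof.
move=> KM LM eL e3 xe xK; have cL := cellP tri LM.
have [j jL E] := face_elt_cell cL eL e3; move: xe; rewrite E => /(hull_faceE cL jL)[xL b0].
have KL := ohull_cell tri KM LM xK xL; move: xK; rewrite KL => /(_ j jL).
by rewrite b0 ltxx.
Qed.

Lemma tE_eq e f g : #|e| = 3%N -> (forall x, hull e x -> f x = g x) -> tE e f = tE e g.
Proof.
by move=> e3 fg; apply: eq_Rintegral => z; rewrite inE => zt; rewrite fg//; exact: tri_hull.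
Qed.

Lemma tE0 e f : #|e| = 3%N -> (forall x, hull e x -> f x = 0) -> tE e f = 0.
Proof. by move=> e3 f0; rewrite (tE_eq e3 f0); exact: triI0. Qed.

(** For test functions supported in one open cell the face terms of [pw_green]
    vanish. *)
Lemma weak_div_pw u g C : is_weak_div Omega u g -> ispwv u C ->
  ae_eq_on Omega g (pwfun (fun K => pdivp (C K))).
Proof.
move=> [gL gW] uC; set h := pwfun _; have hL : L2 Omega h by exact: L2_pwfun.
apply: ae_cells => K KM.
have KO := ohull_Omega tri KM.
have ghL : L2 Omega (fun x => g x - h x) by exact: L2B.
suff H : forall phi, bump_fun phi -> compactly_supported (ohull K) phi ->
    inner Omega (fun x => g x - h x) phi = 0.
  have := ae0_open Omega_open Omega_bounded KO ghL H (@open_ohull _ _ K).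
  by apply: ae_imp => z H' zK; apply/eqP; rewrite -subr_eq0; apply/eqP/H'.
move=> phi bphi [A [cA AK] A0].
have Cphi := bump_fun_C1 bphi.
have phL := L2_continuous (C1_continuous Cphi).
rewrite (innerBl Omega_open)//.
have := pw_green uC Cphi; rewrite gW; first last.
- by exists A => //; split=> //; exact: subset_trans KO.
- exact: bump_fun_smooth.
rewrite -/h big1; first by lra.
move=> e /eqP e3; rewrite big_seq big1// => L; rewrite face_cells_mem => /andP[eL LM].
apply: tE0 => // x xe; rewrite A0 ?mulr0// => /AK.
exact: face_not_ohull KM LM eL e3 xe.
Qed.

End PiecewisePolynomials.

(** * Continuity of the normal component across faces *)

Section TrianglePositivity.
Context {R : realType}.
Implicit Types (F : 'rV[R]_3 -> R) (a b c : 'rV[R]_3).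

Definition otriangle (z : R * R) := [/\ 0 < z.1, 0 < z.2 & z.1 + z.2 < 1].

Lemma continuous_tripoint a b c F : continuous F ->
  continuous (fun z : R * R => F (tripoint a b c z)).
Proof.
move=> cF z; apply: (@continuous_comp _ _ _ (tripoint a b c) F); last exact: cF.
rewrite /tripoint; apply: cvgD; first (apply: cvgD; first exact: cvg_cst).
  by apply: cvgZr_tmp; exact: cvg_fst.
by apply: cvgZr_tmp; exact: cvg_snd.
Qed.

Lemma triI_pos a b c F z0 : continuous F ->
  (forall z, unit_triangle z -> 0 <= F (tripoint a b c z)) ->
  otriangle z0 -> 0 < F (tripoint a b c z0) -> 0 < triI a b c F.
Proof.
move=> cF F0 [z1 z2 z12] Fz0.
have cG := @continuous_tripoint a b c F cF.
set G := (fun z : R * R => F (tripoint a b c z)) in cG.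
have iG := tri_integrable a b c cF.
have h0 : G z0 / 2 < G z0 by rewrite ltr_pdivrMr// ltr_pMr// ltr1n.
have c1 : fst @ nbhs z0 --> z0.1 by exact: cvg_fst.
have c2 : snd @ nbhs z0 --> z0.2 by exact: cvg_snd.
have c3 : (fun z : R * R => z.1 + z.2) @ nbhs z0 --> z0.1 + z0.2 by exact: cvgD.
have N1 := @cvgr_gt _ _ (nbhs z0) (nbhs_filter z0) G _ (cG z0) _ h0.
have N2 := @cvgr_gt _ _ (nbhs z0) (nbhs_filter z0) fst _ c1 _ z1.
have N3 := @cvgr_gt _ _ (nbhs z0) (nbhs_filter z0) snd _ c2 _ z2.
have N4 := @cvgr_lt _ _ (nbhs z0) (nbhs_filter z0) _ _ c3 _ z12.
have : \forall z \near z0, G z0 / 2 < G z /\ unit_triangle z.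
  near=> z; split; first by near: z.
  split; apply/ltW; near: z => //.
move=> /nbhs_ballP[r /= r0 Hr].
pose S : set (measurableTypeR R * measurableTypeR R) := ball z0.1 r `*` ball z0.2 r.
have mb (x : R) : measurable (ball x r : set (measurableTypeR R)).
  by apply: open_measurable; exact: ball_open.
have mS : measurable S by exact: measurableX.
have SH z : S z -> G z0 / 2 < G z /\ unit_triangle z by move=> [h1 h2]; apply: Hr.
have G0 : 0 < G z0 / 2 by rewrite divr_gt0.
have mG : measurable_fun setT (fun z : measurableTypeR R * measurableTypeR R => G z).
  exact: measurable_tripoint.
apply: fine_gt0; apply/andP; split; last first.
  have := integrable_fin_num unit_triangle_closed iG.
  by rewrite fin_numElt => /andP[].
apply: (@lt_le_trans _ _ (\int[@leb2 R]_(z in S) (G z0 / 2)%:E)%E).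
  rewrite integral_cst// mule_gt0//.
  have -> : @leb2 R S = (lebesgue_measure (ball z0.1 r : set (measurableTypeR R)) *
     lebesgue_measure (ball z0.2 r : set (measurableTypeR R)))%E.
    by apply: product_measure1E.
  by rewrite !lebesgue_measure_ball ?ltW// -EFinM lte_fin mulr_gt0// mulrn_wgt0.
apply: (@le_trans _ _ (\int[@leb2 R]_(z in S) (G z)%:E)%E).
  apply: ge0_le_integral => //.
  - by move=> z _; rewrite lee_fin ltW.
  - by apply/measurable_EFinP; apply: measurable_funS mG.
  - by move=> z /SH[h _]; rewrite lee_fin ltW.
apply: ge0_subset_integral => //.
- exact: unit_triangle_closed.
- by apply/measurable_EFinP; apply: measurable_funS mG.
- by move=> z /SH[].
Unshelve. all: by end_near.
Qed.

Lemma cube_box (x : 'rV[R]_3) (r : R) : cube x r = box (x - const_mx r) (x + const_mx r).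
Proof.
apply/seteqP; split=> y yr i; have := yr i; rewrite !mxE ltr_norml => /andP[h1 h2].
  by apply/andP; split; lra.
by apply/andP; split; lra.
Qed.

Lemma local_bump (U : set 'rV[R]_3) x : nbhs x U -> exists phi,
  [/\ bump_fun phi, forall y, ~ U y -> phi y = 0, forall y, 0 <= phi y & 0 < phi x].
Proof.
move=> /nbhs_ballP[r /= r0]; rewrite -cube_ball// cube_box => bU.
have xb : box (x - const_mx r) (x + const_mx r) x.
  by rewrite -cube_box => i; rewrite subrr normr0.
have := @bump_cvg _ (x - const_mx r) (x + const_mx r) x.
rewrite indicE mem_set// => /(cvgr_gt _) /(_ 0 ltr01)[N _ /(_ N (leqnn N)) /= p0].
exists (boxbump N (x - const_mx r) (x + const_mx r)); split=> //.
- exact: bump_is_bump.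
- by move=> y yU; apply: bump_out => /bU.
- by move=> y; have /andP[] := bump_itv N (x - const_mx r) (x + const_mx r) y.
Qed.

End TrianglePositivity.

Section JumpFree.
Context {R : realType}.
Variable Omega : set 'rV[R]_3.
Variable M : mesh R.
Hypothesis Omega_open : open Omega.
Hypothesis Omega_bounded : bounded_set Omega.
Hypothesis tri : triangulation M Omega.
Notation n := (nvert M).
Notation v := (@vert R M).
Implicit Types (K L e : {set 'I_n}) (i j : 'I_n) (x y : 'rV[R]_3).
Implicit Types (g phi : 'rV[R]_3 -> R) (c : {set 'I_n} -> poly3 R).
Implicit Types (u : 'rV[R]_3 -> 'rV[R]_3) (C : {set 'I_n} -> 'I_3 -> poly3 R).
Notation tpt e := (tripoint (fpt e 0) (fpt e 1) (fpt e 2)).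

Lemma wdivP u : (exists g, is_weak_div Omega u g) -> is_weak_div Omega u (wdiv Omega u).
Proof. by move=> H; apply: (@xgetPex _ _ [set g | is_weak_div Omega u g]). Qed.

Lemma wdiv_pw u C : (exists g, is_weak_div Omega u g) -> ispwv u C ->
  ae_eq_on Omega (wdiv Omega u) (pwfun (fun K => pdivp (C K))).
Proof. by move=> /wdivP; exact: weak_div_pw. Qed.

(** The test function need not vanish on the boundary, because [H0div] encodes the
    vanishing normal trace by the same identity. *)
Lemma trace_green u C phi : H0div Omega u -> ispwv u C -> smooth phi -> C1 phi ->
  \sum_(e : {set 'I_n} | #|e| == 3%N) \sum_(K <- face_cells e)
     tE e (fun x => dot (evalv (C K) x) (fnorm K e) * phi x) = 0.
Proof.
move=> [uL ug ut] uC sphi Cphi.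
rewrite -(pw_green Omega_open tri uC Cphi) -[RHS](ut _ sphi); congr (_ + _).
apply/esym/(ae_inner Omega_open); last exact: wdiv_pw.
- by have [] := wdivP ug.
- exact: L2_pwfun.
- exact/L2_continuous/C1_continuous.
Qed.

Lemma tri_coef e z : #|e| = 3%N -> exists c : 'I_n -> R,
  [/\ \sum_(t in e) c t = 1, tpt e z = \sum_(t in e) c t *: v t
    & forall P : R -> Prop, P (1 - z.1 - z.2) -> P z.1 -> P z.2 -> forall t, P (c t)].
Proof.
move=> e3; have [a [b [c [_ [-> -> ->] u3 eE]]]] := face_enum e3.
move: u3; rewrite /= !inE !negb_or andbT => /andP[/andP[ab ac] bc].
exists (fun t => if t == a then 1 - z.1 - z.2 else if t == b then z.1 else z.2).
have S (V : nmodType) (F : 'I_n -> V) : \sum_(t in e) F t = F a + F b + F c.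
  by rewrite eE -finset.setUA big_setU1 ?inE ?negb_or ?ab//= big_setU1 ?inE//= big_set1 addrA.
rewrite !S !eqxx !(eq_sym _ a) (negbTE ab) (negbTE ac) eq_sym (negbTE bc); split.
- by ring.
- by rewrite /tripoint; apply/rowP => t; rewrite !mxE; ring.
- by move=> P p1 p2 p3 t; case: ifP => _; [|case: ifP].
Qed.

Lemma hull_tri e x : #|e| = 3%N -> hull e x -> exists2 z, unit_triangle z & x = tpt e z.
Proof.
move=> e3 [c [c0 c1 ->]].
have [p [q [r [_ [-> -> ->] u3 eE]]]] := face_enum e3.
move: u3; rewrite /= !inE !negb_or andbT => /andP[/andP[ab ac] bc].
have S (V : nmodType) (F : 'I_n -> V) : \sum_(t in e) F t = F p + F q + F r.
  by rewrite eE -finset.setUA big_setU1 ?inE ?negb_or ?ab//= big_setU1 ?inE//= big_set1 addrA.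
move: c1; rewrite !S => c1; exists (c q, c r).
  by split=> //=; have := c0 p; lra.
have -> : c p = 1 - c q - c r by lra.
by rewrite /tripoint /=; apply/rowP => t; rewrite !mxE; ring.
Qed.

Lemma tri_bary K i z : is_cell K -> i \in K -> otriangle z ->
  [/\ hull K (tpt (K :\ i) z), bary K i (tpt (K :\ i) z) = 0
    & forall j, j \in K :\ i -> 0 < bary K j (tpt (K :\ i) z)].
Proof.
move=> cK iK [z1 z2 z12]; have e3 := card_opp_face cK iK.
have [c [c1 -> cP]] := tri_coef z e3.
have H := bary_sub cK (finset.subD1set K i) c1.
have c0 j : 0 < c j by apply: (cP (fun t => 0 < t)) => //; lra.
split.
- by rewrite hullE// => j jK; rewrite H//; case: ifP => // _; exact: ltW.
- by rewrite H// !inE eqxx.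
- by move=> j jKi; rewrite H ?jKi//; move: jKi; rewrite !inE => /andP[].
Qed.

(** A point of another face near an inner point of [e] would, in the limit, have a
    positive and a vanishing barycentric coordinate at the same vertex. *)
Lemma near_other_faces e e' K L z : #|e| = 3%N -> #|e'| = 3%N -> e != e' ->
  K \in cells M -> L \in cells M -> e \subset K -> e' \subset L -> otriangle z ->
  \forall y \near tpt e z, ~ hull e' y.
Proof.
move=> e3 e'3 ee' KM LM eK eL zt; have cK := cellP tri KM; have cL := cellP tri LM.
have [i iK E] := face_elt_cell cK eK e3; have [j jL E'] := face_elt_cell cL eL e'3.
pose A := hull L `&` [set y | bary L j y = 0].
have cA : closed A.
  apply: closedI; first exact: closed_hull.
  rewrite (_ : [set x | _] = bary L j @^-1` [set 0])//.
  apply: closed_comp; last exact: closed_eq.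
  by move=> y _; exact: continuous_bary.
have xA : ~ A (tpt e z).
  move=> [xL bj0].
  have [xK b0 bpos] := tri_bary cK iK zt; rewrite -E in xK b0 bpos.
  have bc := bary_common tri KM LM xK xL.
  move/eqP: ee'; apply; apply/eqP; rewrite eqEcard e3 e'3 leqnn andbT.
  apply/fintype.subsetP => t te.
  have tK : t \in K by move/fintype.subsetP: eK; exact.
  have := bpos t te; rewrite bc//; case: ifP => [tL|]; last by rewrite ltxx.
  rewrite E' !inE tL andbT; apply: contraL => /eqP ->; by rewrite bj0 ltxx.
have : nbhs (tpt e z) (~` A) by apply: open_nbhs_nbhs; split => //; exact: closed_openC.
apply: filterS => y yA ye; apply: yA; rewrite E' in ye.
by have [h1 h2] := hull_faceE cL jL ye; split.
Qed.

(** A nonzero value at an inner point of the face would be detected in [trace_green]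
    by a bump function at this point that is zero on all other faces; the border
    of the face is reached by continuity. On a boundary face the sum has one
    term, which is the normal component itself. *)
Lemma jump_free u C e x : H0div Omega u -> ispwv u C -> #|e| = 3%N -> hull e x ->
  \sum_(K <- face_cells e) dot (evalv (C K) x) (fnorm K e) = 0.
Proof.
move=> uH uC e3 xe.
have [->|[K KE]] : face_cells e = [::] \/ exists K, K \in face_cells e.
- by case: (face_cells e) => [|K s]; [left|right; exists K; rewrite inE eqxx].
- by rewrite big_nil.
have := KE; rewrite face_cells_mem => /andP[eK KM].
pose J y := \sum_(K <- face_cells e) dot (evalv (C K) y) (fnorm K e).
have cterm L e' : continuous (fun y => dot (evalv (C L) y) (fnorm L e')).
  rewrite (_ : (fun y => _) = fun y => \sum_(a < 3) poly_eval (C L a) y * fnorm L e' 0 a).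
    by apply: cont_sum => a _; apply: contM; [exact: continuous_poly|exact: cst_continuous].
  by apply/funext => y; rewrite dot_evalvE.
have cJ : continuous J by apply: cont_sum.
have Jopen z : otriangle z -> J (tpt e z) = 0.
  move=> zt; apply/eqP; apply: contraT => J0.
  pose q := tpt e z.
  have N1 : \forall y \near q, 0 < J q * J y.
    have cq : continuous (fun y => J q * J y) by exact: contZ.
    apply: (@cvgr_gt _ _ (nbhs q) (nbhs_filter q) _ _ (cq q)).
    by rewrite -expr2 lt_neqAle eq_sym sqrf_eq0 J0 sqr_ge0.
  pose bad := [seq e' : {set 'I_n} <- enum {set 'I_n} |
    [&& #|e'| == 3%N, e' != e & [exists L in cells M, e' \subset L]]].
  have N2 : \forall y \near q, forall e', e' \in bad -> ~ hull e' y.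
    apply: (@near_seq _ _ (nbhs q) _ bad (fun e' y => ~ hull e' y)) => e'; rewrite mem_filter => /andP[/and3P[/eqP e'3 ee' /existsP[L /andP[LM eL]]] _].
    by apply: (near_other_faces e3 e'3 _ KM LM eK eL zt); rewrite eq_sym.
  have [phi [bphi phiU phi0 phiq]] := local_bump (filterI N1 N2).
  have := trace_green uH uC (bump_fun_smooth bphi) (bump_fun_C1 bphi).
  have cphi := C1_continuous (bump_fun_C1 bphi).
  rewrite (bigD1 e) /=; last by rewrite e3.
  rewrite [X in _ + X]big1 ?addr0; last first.
    move=> e' /andP[/eqP e'3 e'e]; rewrite big_seq big1// => L; rewrite face_cells_mem => /andP[eL LM].
    apply: tE0 => // y ye; rewrite phiU ?mulr0// => -[_ H].
    apply: (H e') ye; rewrite mem_filter e'3 eqxx e'e mem_enum inE andbT /=.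
    by apply/existsP; exists L; rewrite LM.
  rewrite /tE -triI_sum; last by move=> L _; exact: contM.
  move=> E.
  have : 0 < triI (fpt e 0) (fpt e 1) (fpt e 2) (fun y => J q * (J y * phi y)).
    apply: (triI_pos (z0 := z)) => //.
    - by apply: contZ; exact: contM.
    - move=> t tt; set y := tripoint _ _ _ _.
      have [[h _]|h] := pselect ((fun y => 0 < J q * J y) y /\ forall e', e' \in bad -> ~ hull e' y).
        by rewrite mulrA mulr_ge0// ltW.
      by rewrite phiU ?mulr0.
    - by rewrite mulrA mulr_gt0// -expr2 lt_neqAle eq_sym sqrf_eq0 J0 sqr_ge0.
  rewrite triIZ; last exact: contM.
  rewrite (_ : triI _ _ _ _ = 0) ?mulr0 ?ltxx//.
  by rewrite -[RHS]E; congr (triI _ _ _); apply/funext => y; rewrite /J mulr_suml.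
(* The segment from a point of the closed face to its centroid runs in the
   open face. *)
have [z [z1 z2 z12] ->] := hull_tri e3 xe.
pose p (t : R) : R * R := ((1 - t) * z.1 + t * 3%:R^-1, (1 - t) * z.2 + t * 3%:R^-1).
have cp : continuous (fun t => J (tpt e (p t))).
  move=> t; apply: (@continuous_comp _ _ _ p (fun z => J (tpt e z))); last exact: continuous_tripoint.
  have lin (a : R) : {for t, continuous (fun t : R => (1 - t) * a + t * 3%:R^-1)}.
    apply: cvgD; last by apply: cvgMr_tmp; exact: cvg_id.
    by apply: cvgMr_tmp; apply: cvgB; [exact: cvg_cst|exact: cvg_id].
  exact: (cvg_pair (lin z.1) (lin z.2)).
have p0 t : 0 < t -> t < 1 -> J (tpt e (p t)) = 0.
  move=> t0 t1; apply: Jopen; have q : (0 : R) < 3%:R^-1 by [].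
  have h1 : 0 <= (1 - t) * z.1 by apply: mulr_ge0 => //; lra.
  have h2 : 0 <= (1 - t) * z.2 by apply: mulr_ge0 => //; lra.
  have h3 : 0 < t * 3%:R^-1 by exact: mulr_gt0.
  have h4 : (1 - t) * (z.1 + z.2) <= 1 - t by rewrite -[leRHS]mulr1 ler_wpM2l//; lra.
  by split; rewrite /p /=; lra.
have pz : p 0 = z by rewrite /p subr0 !mul1r !mul0r !addr0; case: (z).
rewrite -[LHS]/(J _) -pz.
have H1 : J (tpt e (p t)) @[t --> 0^'+] --> J (tpt e (p 0)).
  by apply: cvg_at_right_filter; exact: cp.
have H2 : J (tpt e (p t)) @[t --> 0^'+] --> (0 : R).
  apply: cvg_near_cst; near=> t; apply: p0; near: t.
    exact: nbhs_right_gt.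
  exact: nbhs_right_lt.
exact: cvg_unique H1 H2.
Unshelve. all: by end_near.
Qed.

End JumpFree.

(** * Antisymmetry of the transport form *)

Section Transport.
Context {R : realType}.
Variable Omega : set 'rV[R]_3.
Variable M : mesh R.
Hypothesis Omega_open : open Omega.
Hypothesis Omega_bounded : bounded_set Omega.
Hypothesis tri : triangulation M Omega.
Notation n := (nvert M).
Notation v := (@vert R M).
Implicit Types (K L e : {set 'I_n}) (i j : 'I_n) (x y w : 'rV[R]_3).
Implicit Types (f g phi : 'rV[R]_3 -> R) (c d : {set 'I_n} -> poly3 R).
Implicit Types (u : 'rV[R]_3 -> 'rV[R]_3) (C : {set 'I_n} -> 'I_3 -> poly3 R).

Lemma tEZ e (a : R) f : continuous f -> tE e (fun x => a * f x) = a * tE e f.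
Proof. exact: triIZ. Qed.

Lemma tED e f g : continuous f -> continuous g -> tE e (fun x => f x + g x) = tE e f + tE e g.
Proof. exact: triID. Qed.

Lemma hull_closure K : is_cell K -> hull K `<=` closure (ohull K).
Proof.
move=> cK x; rewrite hullE// => x0.
have s1 : \sum_(i in K) (4%:R^-1 : R) = 1 by rewrite sumr_const (proj1 cK); field.
have sK : K \subset K by [].
have bc := bary_sub cK sK s1.
pose y := \sum_(j in K) (4%:R^-1 : R) *: v j.
have yK t : 0 < t -> t < 1 -> ohull K ((1 - t) *: x + t *: y).
  move=> t0 t1 i iK; rewrite bary_affine /y bc// iK.
  have : 0 <= (1 - t) * bary K i x by apply: mulr_ge0; [lra|exact: x0].
  have : 0 < t * 4%:R^-1 by apply: mulr_gt0.
  lra.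
have ct : (fun t : R => (1 - t) *: x + t *: y) @ (0 : R) --> (1 - 0) *: x + (0 : R) *: y.
  apply: cvgD; first by apply: cvgZr_tmp; apply: cvgB; [exact: cvg_cst|exact: cvg_id].
  by apply: cvgZr_tmp; exact: cvg_id.
rewrite subr0 scale1r scale0r addr0 in ct.
move=> U /ct /nbhs_ballP[r /= r0 Hr].
pose t := Num.min (r / 2) (2%:R^-1 : R).
have t0 : 0 < t by rewrite lt_min divr_gt0//=.
have t1 : t < 1 by rewrite gt_min; apply/orP; right; lra.
exists ((1 - t) *: x + t *: y); split; first exact: yK.
apply: Hr; rewrite /ball /= sub0r normrN ger0_norm ?ltW//.
by rewrite gt_min ltr_pdivrMr// ltr_pMr// ltr1n.
Qed.

Lemma traceE (V : normedModType R) K (f F : 'rV[R]_3 -> V) x : is_cell K ->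
  continuous F -> (forall y, ohull K y -> f y = F y) -> hull K x -> trace K f x = F x.
Proof.
move=> cK cF fF xK; rewrite /trace hull_interior//.
have pF : ProperFilter (within (ohull K) (nbhs x)).
  by apply: within_nbhs_proper; exact: hull_closure.
apply: cvg_lim; first exact: norm_hausdorff.
have : F y @[y --> within (ohull K) (nbhs x)] --> F x.
  by apply: cvg_within_filter; exact: cF.
apply: cvg_trans; apply: near_eq_cvg.
have : \forall y \near nbhs x, ohull K y -> F y = f y by apply: nearW => y yK; rewrite fF.
exact.
Qed.

Lemma continuous_evalv (P : 'I_3 -> poly3 R) : continuous (evalv P).
Proof.
rewrite (_ : evalv P = fun x => poly_eval (P 0) x *: delta_mx 0 0 +
   poly_eval (P 1) x *: delta_mx 0 1 + poly_eval (P 2%:R) x *: delta_mx 0 2%:R).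
  have cp (a : 'I_3) : continuous (fun x => poly_eval (P a) x *: (delta_mx 0 a : 'rV[R]_3)).
    move=> x; have cpa := @continuous_poly R (P a) x.
    exact: (@cvgZr_tmp _ _ _ _ _ (poly_eval (P a)) (poly_eval (P a) x) (delta_mx 0 a) cpa).
  by move=> x; exact: (cvgD (cvgD (cp 0 x) (cp 1 x)) (cp 2%:R x)).
by apply/funext => x; rewrite [LHS]row_delta sum3E !mxE.
Qed.

Lemma continuous_dot_evalv (P : 'I_3 -> poly3 R) w : continuous (fun x => dot (evalv P x) w).
Proof.
move=> x; apply: (@continuous_comp _ _ _ (evalv P) (fun y => dot y w)).
  exact: continuous_evalv.
exact: continuous_dot.
Qed.

Lemma grad_ohull K f p x : ohull K x -> (forall y, ohull K y -> f y = poly_eval p y) ->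
  grad f x = grad (poly_eval p) x.
Proof.
move=> xK fp; apply/rowP => a; rewrite !mxE /partial; apply: near_eq_derive.
have : nbhs x (ohull K) by apply: open_nbhs_nbhs; split => //; exact: open_ohull.
by apply: filterS => y; exact: fp.
Qed.

Lemma interior_faceP e : e \in interior_faces M -> [/\ #|e| = 3%N,
  face_cells e = [:: cell1 e; cell2 e], [/\ cell1 e \in cells M, e \subset cell1 e &
    [/\ cell2 e \in cells M, e \subset cell2 e & cell1 e != cell2 e]]
  & fnorm (cell2 e) e = - fnorm (cell1 e) e].
Proof.
rewrite inE => /andP[/eqP e3 s2]; have := face_cells_le2 tri e3.
have : uniq (face_cells e) by apply/filter_uniq/enum_uniq.
have := face_cells_mem e; rewrite /cell1 /cell2.
case: (face_cells e) s2 => [|K [|L [|//]]]// _ H.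
have := H K; have := H L; rewrite !inE !eqxx !orbT /= => /esym/andP[eL LM] /esym/andP[eK KM].
rewrite inE andbT => KL _; split=> //.
have [i iK E1] := face_elt_cell (cellP tri KM) eK e3.
have [j jL E2] := face_elt_cell (cellP tri LM) eL e3.
have -> : fnorm K e = fnormal K i by rewrite E1 /fnorm outer_normalE//; exact: (cellP tri KM).
have -> : fnorm L e = fnormal L j by rewrite E2 /fnorm outer_normalE//; exact: (cellP tri LM).
by apply: (fnormal_opp tri KM LM iK jL _ KL); rewrite -E1 -E2.
Qed.

(** The integrand of [bh] on a face, once it is known that the normal component of
    the field is the same from both sides. *)
Definition face_flux C c d e x : R :=
  2^-1 * (dot (evalv (C (cell1 e)) x) (fnorm (cell1 e) e)
    * (poly_eval (c (cell1 e)) x - poly_eval (c (cell2 e)) x)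
    * (poly_eval (d (cell1 e)) x + poly_eval (d (cell2 e)) x)).

Lemma hull_sub e K : is_cell K -> e \subset K -> #|e| = 3%N -> hull e `<=` hull K.
Proof.
move=> cK eK e3 x; have [i iK ->] := face_elt_cell cK eK e3.
by move=> /(hull_faceE cK iK)[].
Qed.

Lemma bhE (m : nat) f g u C c d : H0div Omega u -> ispwv u C ->
  ispw (proj_F Omega M m f) c -> ispw (proj_F Omega M m g) d ->
  bh Omega M m f g u =
  - (\sum_(K in cells M) vint (hull K)
      (fun x => dot (evalv (C K) x) (grad (poly_eval (c K)) x) * poly_eval (d K) x))
  + \sum_(e in interior_faces M) tE e (face_flux C c d e).
Proof.
move=> uH uC fc gd; rewrite /bh; congr (- _ + _).
  apply: eq_bigr => K KM; rewrite !(vint_hull tri)//; apply: eq_vint => x xK.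
  by rewrite (ispwvE uC KM xK) (grad_ohull xK (fc K KM)) (gd K KM).
apply: eq_bigr => e eI; have [e3 fE [KM eK [LM eL KL]] N] := interior_faceP eI.
set K := cell1 e in fE KM eK KL N *; set L := cell2 e in fE LM eL KL N *.
have cK := cellP tri KM; have cL := cellP tri LM.
have e3' := jump_free Omega_open Omega_bounded tri uH uC e3.
rewrite face_intE.
have -> : tE e (fun x => dot (average e u x) (jump e (proj_F Omega M m f) x) *
     average e (proj_F Omega M m g) x) =
  tE e (fun x => dot (2^-1 *: (evalv (C K) x + evalv (C L) x))
    ((poly_eval (c K) x - poly_eval (c L) x) *: outer_normal K e)
     * (2^-1 * (poly_eval (d K) x + poly_eval (d L) x))).
  apply: tE_eq => // x xe; have xK := hull_sub cK eK e3 xe; have xL := hull_sub cL eL e3 xe.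
  rewrite /average /jump -/K -/L.
  rewrite (traceE cK (@continuous_evalv (C K)) (fun y => ispwvE uC KM) xK).
  rewrite (traceE cL (@continuous_evalv (C L)) (fun y => ispwvE uC LM) xL).
  rewrite (traceE cK (@continuous_poly R (c K)) (fc K KM) xK).
  rewrite (traceE cL (@continuous_poly R (c L)) (fc L LM) xL).
  rewrite (traceE cK (@continuous_poly R (d K)) (gd K KM) xK).
  rewrite (traceE cL (@continuous_poly R (d L)) (gd L LM) xL).
  by rewrite scalerN -scalerBl.
rewrite -tEZ; last first.
  have ca : continuous (fun x => poly_eval (c K) x - poly_eval (c L) x).
    by apply: contB; exact: continuous_poly.
  have cd : continuous (fun x => poly_eval (d K) x + poly_eval (d L) x).
    by apply: contD; exact: continuous_poly.
  rewrite (_ : (fun x => _) = fun x =>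
     2^-1 * ((dot (evalv (C K) x) (outer_normal K e) + dot (evalv (C L) x) (outer_normal K e))
     * (poly_eval (c K) x - poly_eval (c L) x)) * (2^-1 * (poly_eval (d K) x + poly_eval (d L) x))).
    apply: contM; last exact: contZ.
    by apply: contZ; apply: contM => //; apply: contD; exact: continuous_dot_evalv.
  by apply/funext => x; rewrite dotZl dotDl !dotZr; ring.
apply: tE_eq => // x xe; have := e3' x xe.
rewrite fE big_cons big_seq1 N dotNr => J0.
have {}J0 : dot (evalv (C L) x) (fnorm K e) = dot (evalv (C K) x) (fnorm K e) by lra.
rewrite /face_flux -/K -/L dotZl dotDl !dotZr.
transitivity (2^-1 * (2^-1 * (dot (evalv (C K) x) (fnorm K e) + dot (evalv (C L) x) (fnorm K e)))
  * (poly_eval (c K) x - poly_eval (c L) x) * (poly_eval (d K) x + poly_eval (d L) x)).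
  by rewrite /fnorm !dotZr; ring.
by rewrite J0 /fnorm !dotZr; field.
Qed.

Lemma face_flux_cont C c d e : continuous (face_flux C c d e).
Proof.
apply: contZ; apply: contM; last by apply: contD; exact: continuous_poly.
apply: contM; first exact: continuous_dot_evalv.
by apply: contB; exact: continuous_poly.
Qed.

(** The volume terms add up to integrals of [u] against the gradient of the product
    of the two projections. Green's formula turns them into face integrals, where
    the jump of the product is the sum of both mixed products of jump and
    average. *)
Lemma bh_antisym (m : nat) f g u C c d : H0div Omega u -> ispwv u C ->
  ae_eq_on Omega (pwfun (fun K => pdivp (C K))) (fun=> 0) ->
  ispw (proj_F Omega M m f) c -> ispw (proj_F Omega M m g) d ->
  bh Omega M m f g u + bh Omega M m g f u = 0.
Proof.
move=> uH uC div0 fc gd; rewrite (bhE uH uC fc gd) (bhE uH uC gd fc).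
pose F K := poly_eval (c K * d K).
have FE K x : F K x = poly_eval (c K) x * poly_eval (d K) x by rewrite /F peE.
have cgrad K p q : continuous (fun x => dot (evalv (C K) x) (grad (poly_eval p) x) * poly_eval q x).
  rewrite (_ : (fun x => _) = poly_eval ((\sum_(a < 3) C K a * mderiv a p) * q)).
    exact: continuous_poly.
  apply/funext => x; rewrite peM pe_sum dot_evalvE; congr (_ * _).
  by apply: eq_bigr => a _; rewrite !mxE partial_poly peM.
have E1 : \sum_(K in cells M) vint (hull K)
      (fun x => dot (evalv (C K) x) (grad (poly_eval (c K)) x) * poly_eval (d K) x) +
   \sum_(K in cells M) vint (hull K)
      (fun x => dot (evalv (C K) x) (grad (poly_eval (d K)) x) * poly_eval (c K) x) =
   \sum_(K in cells M) vint (hull K)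
    (fun x => dot (evalv (C K) x) (grad (F K) x) + divergence (evalv (C K)) x * F K x).
  have -> : \sum_(K in cells M) vint (hull K)
      (fun x => dot (evalv (C K) x) (grad (F K) x) + divergence (evalv (C K)) x * F K x) =
    \sum_(K in cells M) vint (hull K) (fun x => dot (evalv (C K) x) (grad (F K) x)) +
    \sum_(K in cells M) vint (hull K) (fun x => divergence (evalv (C K)) x * F K x).
    rewrite -big_split; apply: eq_bigr => K KM; have [r Kr] := hull_bounded K.
    rewrite (vintD (measurable_hull (cellP tri KM)) Kr)//.
      rewrite (_ : (fun x => _) = fun x => dot (evalv (C K) x) (grad (poly_eval (c K * d K)) x) * poly_eval 1 x).
        exact: cgrad.
      by apply/funext => x; rewrite pe1 mulr1.
    by rewrite pdiv_evalv; apply: contM; exact: continuous_poly.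
  have -> : \sum_(K in cells M) vint (hull K) (fun x => divergence (evalv (C K)) x * F K x) = 0.
    transitivity (inner Omega (pwfun (fun K => pdivp (C K))) (pwfun (fun K => c K * d K))).
      apply/esym/(vint_cells Omega_open tri) => K KM.
        by rewrite pdiv_evalv; apply: contM; exact: continuous_poly.
      by move=> x xK; rewrite !(pwfunE tri _ KM)// pdiv_evalv.
    rewrite -(inner0l Omega (pwfun (fun K => c K * d K))).
    apply: (ae_inner Omega_open) => //; [exact: L2_pwfun| |exact: L2_pwfun].
    exact: L2_0.
  rewrite addr0 -big_split; apply: eq_bigr => K KM /=; have [r Kr] := hull_bounded K.
  rewrite -(vintD (measurable_hull (cellP tri KM)) Kr)//; apply: eq_vint => x _.
  rewrite /dot !mulr_suml -big_split; apply: eq_bigr => a _ /=.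
  by rewrite !mxE /F !partial_poly mderivM !peE; ring.
have E2 : \sum_(e in interior_faces M) tE e (face_flux C c d e) +
    \sum_(e in interior_faces M) tE e (face_flux C d c e) =
  \sum_(e : {set 'I_n} | #|e| == 3%N) \sum_(K <- face_cells e)
     tE e (fun x => dot (evalv (C K) x) (fnorm K e) * F K x).
  rewrite [RHS](bigID (fun e : {set 'I_n} => e \in interior_faces M)) /=.
  rewrite [X in _ = _ + X]big1 ?addr0; last first.
    move=> e /andP[/eqP e3 eI]; have := jump_free Omega_open Omega_bounded tri uH uC e3.
    move: eI; rewrite inE e3 eqxx /= -leqNgt.
    case: (face_cells e) => [|K [|//]] _ J0; first by rewrite big_nil.
    rewrite big_seq1; apply: tE0 => // x /J0; rewrite big_seq1 => ->; exact: mul0r.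
  rewrite -big_split; apply: eq_big => [e|e eI].
    by rewrite [in LHS]inE [in RHS]inE andbA andbb.
  have [e3 fE _ N] := interior_faceP eI.
  rewrite fE big_cons big_seq1 /= -[LHS]tED; [|exact: face_flux_cont..].
  rewrite -[RHS]tED.
  - apply: tE_eq => // x xe; have := jump_free Omega_open Omega_bounded tri uH uC e3 xe.
    rewrite fE big_cons big_seq1 N !dotNr !FE /face_flux => J0.
    have {}J0 : dot (evalv (C (cell2 e)) x) (fnorm (cell1 e) e) =
      dot (evalv (C (cell1 e)) x) (fnorm (cell1 e) e) by lra.
    by rewrite J0; field.
  - by apply: contM; [exact: continuous_dot_evalv|exact: continuous_poly].
  - by apply: contM; [exact: continuous_dot_evalv|exact: continuous_poly].
have := cells_green tri (U := fun K => evalv (C K)) (phi := F).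
rewrite -E1 -E2 => G; rewrite addrACA -opprD G ?addNr//.
  by move=> K KM a; rewrite evalv_comp; exact: C1_poly.
by move=> K KM; exact: C1_poly.
Qed.

End Transport.

(** * Orthonormal lists and projection onto piecewise polynomials *)

Section Basis.
Context {R : realType}.
Variable Omega : set 'rV[R]_3.
Variable M : mesh R.
Hypothesis Omega_open : open Omega.
Hypothesis Omega_bounded : bounded_set Omega.
Hypothesis tri : triangulation M Omega.
Notation n := (nvert M).
Implicit Types (K L e : {set 'I_n}) (x y : 'rV[R]_3).
Implicit Types (f g h p b : 'rV[R]_3 -> R) (c d : {set 'I_n} -> poly3 R).
Implicit Types (o : seq ('rV[R]_3 -> R)) (N m : nat).

Lemma pwfun_lin (a : R) c d : (fun x => a * pwfun c x + pwfun d x) = pwfun (fun K => a *: c K + d K).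
Proof.
apply/funext => x; rewrite /pwfun mulr_sumr -big_split; apply: eq_bigr => K _ /=.
by rewrite peD peZ; ring.
Qed.

Definition pwpoly N f := exists2 c, f = pwfun c & forall K, deg_le N (c K).

Lemma pwpoly_lin N (a : R) f g : pwpoly N f -> pwpoly N g -> pwpoly N (fun x => a * f x + g x).
Proof.
move=> [c -> cN] [d -> dN]; rewrite pwfun_lin; exists (fun K => a *: c K + d K) => // K.
by apply: deg_leD => //; exact: deg_leZ.
Qed.

Lemma pwpoly0 N : pwpoly N (fun=> 0).
Proof.
exists (fun=> 0) => [|K]; last exact: deg_le0.
by apply/funext => x; rewrite /pwfun big1// => K _; rewrite pe0 mulr0.
Qed.

Lemma pwpoly_sum N o (a : ('rV[R]_3 -> R) -> R) : (forall p, p \in o -> pwpoly N p) ->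
  pwpoly N (fun x => \sum_(p <- o) a p * p x).
Proof.
elim: o => [|p o IH] op.
  by rewrite (_ : (fun x => _) = fun=> 0); [exact: pwpoly0|apply/funext => x; rewrite big_nil].
rewrite (_ : (fun x => _) = fun x => a p * p x + \sum_(p <- o) a p * p x).
  apply: pwpoly_lin; first by apply: op; rewrite mem_head.
  by apply: IH => q qo; apply: op; rewrite inE qo orbT.
by apply/funext => x; rewrite big_cons.
Qed.

Lemma pwpoly_L2 N f : pwpoly N f -> L2 Omega f.
Proof. by move=> [c -> _]; exact: L2_pwfun. Qed.

Lemma pwpoly_pw N f : pwpoly N f -> piecewise_poly M N f.
Proof. by move=> [c -> cN]; apply/(pwP tri); exists c => //; exact: (pwfunE tri). Qed.

Lemma pwpoly_Fh N f : pwpoly N f -> Fh Omega M N f.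
Proof. by move=> fN; split; [exact: pwpoly_L2 fN|exact: pwpoly_pw]. Qed.

Definition l2expansion o f x : R := \sum_(p <- o) inner Omega f p * p x.
(** For an orthonormal list [o] this says that [f] is in its span, functions that
    agree on the open cells being identified. *)
Definition reproduces o f := forall x, inter M x -> f x = l2expansion o f x.

Lemma eq_reproduces o f g : (forall x, inter M x -> f x = g x) -> reproduces o f -> reproduces o g.
Proof.
move=> fg of_ x xI; rewrite -fg// of_//; apply: eq_bigr => p _; congr (_ * _).
exact: (eq_inner_inter Omega_open tri).
Qed.

Lemma reproduces_lin o (a : R) f g : (forall p, p \in o -> L2 Omega p) -> L2 Omega f -> L2 Omega g ->
  reproduces o f -> reproduces o g -> reproduces o (fun x => a * f x + g x).
Proof.
move=> oL fL gL of_ og x xI; rewrite of_// og// /l2expansion mulr_sumr -big_split /= big_seq [RHS]big_seq.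
apply: eq_bigr => p /oL pL; rewrite (innerDl Omega_open)//; last exact: L2Z.
by rewrite (innerZl Omega_open)//; ring.
Qed.

Lemma inner_l2expansion o f g : (forall p, p \in o -> L2 Omega p) -> L2 Omega g ->
  inner Omega (l2expansion o f) g = \sum_(p <- o) inner Omega f p * inner Omega p g.
Proof.
move=> oL gL; rewrite /l2expansion.
elim: o oL => [|p o IH] oL.
  rewrite big_nil -[RHS](inner0l Omega g); apply: eq_inner => // x _; by rewrite big_nil.
rewrite big_cons -IH; last by move=> q qo; apply: oL; rewrite inE qo orbT.
have pL : L2 Omega p by apply: oL; rewrite mem_head.
rewrite -(innerZl Omega_open)// -(innerDl Omega_open)//.
- by apply: eq_inner => // x _; rewrite big_cons.
- exact: L2Z.
- elim: o {IH} oL => [|q o IH] oL.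
    by apply: eq_L2 (L2_0 Omega_open Omega_bounded) => x _; rewrite big_nil.
  apply: (@eq_L2 _ _ (fun x => inner Omega f q * q x + \sum_(r <- o) inner Omega f r * r x)).
    by move=> x _; rewrite big_cons.
  apply: L2_lin => //; first by apply: oL; rewrite !inE eqxx orbT.
  by apply: IH => r; rewrite inE => /predU1P[->//|ro]; apply: oL; rewrite !inE ro !orbT.
Qed.

(** The list grows by the normalized remainder of [b]. If the norm of the remainder
    is zero, it vanishes on the open cells and [b] is already reproduced. *)
Lemma gram_schmidt N (bs : seq ('rV[R]_3 -> R)) : (forall b, b \in bs -> pwpoly N b) ->
  exists o, [/\ forall p, p \in o -> pwpoly N p, forall p, p \in o -> reproduces o p
    & forall b, b \in bs -> reproduces o b].
Proof.
elim: bs => [|b bs IH] bN; first by exists [::].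
have [|o [oN oo obs]] := IH; first by move=> q qs; apply: bN; rewrite inE qs orbT.
have {IH}bN : pwpoly N b by apply: bN; rewrite mem_head.
have oL p : p \in o -> L2 Omega p by move=> /oN/pwpoly_L2.
have bL := pwpoly_L2 bN.
have PN f : pwpoly N (l2expansion o f) by exact: pwpoly_sum.
have PL f : L2 Omega (l2expansion o f) by exact: pwpoly_L2 (PN f).
pose e x := b x - l2expansion o b x.
have eN : pwpoly N e.
  have := pwpoly_lin (-1) (PN b) bN; congr pwpoly.
  by apply/funext => x; rewrite /e mulN1r addrC.
have eL := pwpoly_L2 eN.
have eo p : p \in o -> inner Omega e p = 0.
  move=> po; have pL := oL p po; rewrite /e (innerBl Omega_open)// inner_l2expansion//.
  have -> : inner Omega b p = inner Omega b (l2expansion o p).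
    by apply: (eq_inner_inter Omega_open tri) => // x xI; exact: oo.
  rewrite innerC inner_l2expansion// -sumrB big1_seq// => q _.
  by rewrite [inner Omega p q]innerC [inner Omega q b]innerC mulrC subrr.
have e_ge0 := inner_ge0 Omega e.
have [e0|e0] := eqVneq (inner Omega e e) 0.
  exists o; split=> // q; rewrite inE => /predU1P[->|/obs//] x xI.
  have [c eE _] := eN.
  have ec : ispw e c by rewrite eE; exact: (pwfunE tri).
  have := pw_ae0 tri ec (inner_eq0 Omega_open eL e0) xI.
  by rewrite /e => /eqP; rewrite subr_eq0 => /eqP.
pose s := Num.sqrt (inner Omega e e).
have s0 : s != 0 by rewrite sqrtr_eq0 -ltNge lt_neqAle eq_sym e0.
have ss : s * s = inner Omega e e by rewrite -expr2 sqr_sqrtr.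
pose q x := s^-1 * e x.
have qN : pwpoly N q.
  have := pwpoly_lin s^-1 eN (pwpoly0 N); congr pwpoly.
  by apply/funext => x; rewrite addr0.
have qL := pwpoly_L2 qN.
have qo p : p \in o -> inner Omega q p = 0.
  by move=> po; rewrite (innerZl Omega_open)// ?eo ?mulr0//; exact: oL.
have qq : inner Omega q q = 1.
  rewrite (innerZl Omega_open)// (innerZr Omega_open)// -ss.
  by field.
have projq f x : l2expansion (q :: o) f x = inner Omega f q * q x + l2expansion o f x.
  by rewrite /l2expansion big_cons.
exists (q :: o); split.
- by move=> p; rewrite inE => /predU1P[->//|/oN].
- move=> p; rewrite inE => /predU1P[->|po] x xI; rewrite projq.
    rewrite qq mul1r /l2expansion big1_seq ?addr0// => r /= ro.
    by rewrite qo// mul0r.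
  by rewrite innerC qo// mul0r add0r oo.
- move=> p; rewrite inE => /predU1P[->|pb] x xI; rewrite projq.
    have -> : inner Omega b q = s.
      have -> : inner Omega b q = inner Omega (fun x => s * q x + l2expansion o b x) q.
        apply: eq_inner => // y _; rewrite /q mulrA divff// mul1r /e; ring.
      rewrite (innerDl Omega_open)//; last exact: L2Z.
      rewrite (innerZl Omega_open)// qq mulr1 inner_l2expansion// big1_seq ?addr0// => r /= ro.
      by rewrite innerC [inner Omega r q]innerC qo// mulr0.
    by rewrite /q mulrA divff// mul1r /e; ring.
  suff -> : inner Omega p q = 0 by rewrite mul0r add0r obs.
  have -> : inner Omega p q = inner Omega (l2expansion o p) q.
    by apply: (eq_inner_inter Omega_open tri) => // y yI; exact: obs.
  rewrite inner_l2expansion// big1_seq// => r /= ro.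
  by rewrite [inner Omega r q]innerC qo// mulr0.
Qed.

(** The lists to orthonormalize are the monomials restricted to one cell. *)
Lemma pw_basis N : exists o, (forall p, p \in o -> pwpoly N p) /\
  forall f, piecewise_poly M N f -> reproduces o f.
Proof.
pose J : finType := ({set 'I_n} * bmultinom 3 N.+1)%type.
pose b (j : J) := pwfun (fun K => if K == j.1 then mpolyX R (bmnm j.2) else 0).
have bN j : pwpoly N (b j).
  exists (fun K => if K == j.1 then mpolyX R (bmnm j.2) else 0) => // K.
  case: ifP => _; last exact: deg_le0.
  by rewrite /deg_le msizeX bmdeg.
have [|o [oN oo ob]] := @gram_schmidt N [seq b j | j <- enum J].
  by move=> p /mapP[j _ ->].
exists o; split=> // f /(pwP tri)[c fc cN].
have oL p : p \in o -> L2 Omega p by move=> /oN/pwpoly_L2.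
have H (s : seq J) (a : J -> R) : reproduces o (fun x => \sum_(j <- s) a j * b j x) /\
    L2 Omega (fun x => \sum_(j <- s) a j * b j x).
  elim: s => [|j s [IH1 IH2]].
    have -> : (fun x => \sum_(j <- [::]) a j * b j x) = fun=> 0.
      by apply/funext => x; rewrite big_nil.
    split; last exact: L2_0.
    by move=> x _; rewrite /l2expansion big1// => p _; rewrite inner0l mul0r.
  have -> : (fun x => \sum_(j <- j :: s) a j * b j x) =
      fun x => a j * b j x + \sum_(j <- s) a j * b j x.
    by apply/funext => x; rewrite big_cons.
  split; last by apply: L2_lin => //; exact: pwpoly_L2 (bN j).
  apply: reproduces_lin => //; first exact: pwpoly_L2 (bN j).
  by apply: ob; apply/mapP; exists j => //; rewrite mem_enum.
have [Hf _] := H (enum J) (fun j => mcoeff (bmnm j.2) (c j.1)).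
apply: eq_reproduces Hf => x [K KM xK].
rewrite (fc K KM x xK) big_enum /=.
rewrite (mpolywE (cN K)) pe_sum.
rewrite -(pair_bigA _ (fun L (a : bmultinom 3 N.+1) => mcoeff (bmnm a) (c L) * b (L, a) x)) /=.
rewrite (bigD1 K)//= [X in _ + X]big1 ?addr0.
  by apply: eq_bigr => m _; rewrite peZ /b (pwfunE tri _ KM)//= eqxx.
move=> L LK; rewrite big1// => m _; rewrite /b (pwfunE tri _ KM)//= eq_sym (negbTE LK) pe0 mulr0//.
Qed.

(** The expansion in an orthonormal list is the orthogonal projection, so the
    choice made by [proj_F] is among existing ones. *)
Lemma proj_FP m f : L2 Omega f -> Fh Omega M m (proj_F Omega M m f) /\
  forall h, Fh Omega M m h -> inner Omega (fun x => f x - proj_F Omega M m f x) h = 0.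
Proof.
move=> fL; have [bs [oN oP]] := pw_basis m.
have oL p : p \in bs -> L2 Omega p by move=> /oN/pwpoly_L2.
apply: (@xgetPex _ _ [set g | Fh Omega M m g /\ forall h, Fh Omega M m h ->
  inner Omega (fun x => f x - g x) h = 0]).
have PN : pwpoly m (l2expansion bs f) by exact: pwpoly_sum.
exists (l2expansion bs f); split; first exact: pwpoly_Fh.
move=> h [hL hm]; rewrite (innerBl Omega_open)//; last exact: pwpoly_L2 PN.
rewrite inner_l2expansion//.
have -> : inner Omega f h = inner Omega f (l2expansion bs h).
  by apply: (eq_inner_inter Omega_open tri) => // x xI; exact: oP.
rewrite innerC inner_l2expansion// -sumrB big1_seq// => q _.
by rewrite [inner Omega h q]innerC [inner Omega q f]innerC mulrC subrr.
Qed.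

Lemma Fh_eq m f g : Fh Omega M m f -> Fh Omega M m g -> ae_eq_on Omega f g ->
  forall x, inter M x -> f x = g x.
Proof.
move=> [fL /(pwP tri)[c fc cN]] [gL /(pwP tri)[d gd dN]] fg x xI.
apply/eqP; rewrite -subr_eq0; apply/eqP.
have H : ae_eq_on Omega (fun x => f x - g x) (fun=> 0).
  by apply: ae_imp fg => z H zO; rewrite H// subrr.
exact: (pw_ae0 tri (ispwB fc gd) H xI).
Qed.

Lemma FhB m f g : Fh Omega M m f -> Fh Omega M m g -> Fh Omega M m (fun x => f x - g x).
Proof.
move=> [fL /(pwP tri)[c fc cN]] [gL /(pwP tri)[d gd dN]]; split; first exact: L2B.
apply/(pwP tri); exists (fun K => c K - d K); first exact: ispwB.
by move=> K; exact: deg_leB.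
Qed.

Lemma proj_F_id m f : Fh Omega M m f -> forall x, inter M x -> proj_F Omega M m f x = f x.
Proof.
move=> fF; have [gF gP] := proj_FP m fF.1.
have dF := FhB fF gF.
move=> x xI; apply/esym; apply: (Fh_eq fF gF) xI.
have := inner_eq0 Omega_open dF.1 (gP _ dF).
by apply: ae_imp => z H /H /eqP; rewrite subr_eq0 => /eqP.
Qed.

End Basis.

(** * Weak divergence and weak curl *)

Section Fields.
Context {R : realType}.
Variable Omega : set 'rV[R]_3.
Hypothesis Omega_open : open Omega.
Hypothesis Omega_bounded : bounded_set Omega.
Implicit Types (F G H : 'rV[R]_3 -> 'rV[R]_3) (f g phi : 'rV[R]_3 -> R) (a : R).

Lemma L2v_lin a F G : L2v Omega F -> L2v Omega G -> L2v Omega (fun x => a *: F x + G x).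
Proof.
move=> FL GL i; have := L2_lin a (FL i) (GL i).
by congr (L2 Omega); apply/funext => x; rewrite /component !mxE.
Qed.

Lemma ae_eq_refl (V : Type) (f : 'rV[R]_3 -> V) : ae_eq_on Omega f f.
Proof. exact: aeW. Qed.

Lemma L2v_const (w : 'rV[R]_3) : L2v Omega (fun=> w).
Proof. by move=> i; apply: L2_continuous => //; exact: cst_continuous. Qed.

Lemma L2vN F : L2v Omega F -> L2v Omega (fun x => - F x).
Proof.
move=> FL i; have := L2N Omega_open Omega_bounded (FL i).
by congr (L2 Omega); apply/funext => x; rewrite /component mxE.
Qed.

Lemma L2vB F G : L2v Omega F -> L2v Omega G -> L2v Omega (fun x => F x - G x).
Proof.
move=> FL GL i; have := L2B Omega_open Omega_bounded (FL i) (GL i).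
by congr (L2 Omega); apply/funext => x; rewrite /component !mxE.
Qed.

Lemma innervC F G : innerv Omega F G = innerv Omega G F.
Proof. by apply: eq_vint => x _; rewrite dotC. Qed.

Lemma innerv_linl a F G H : L2v Omega F -> L2v Omega G -> L2v Omega H ->
  innerv Omega (fun x => a *: F x + G x) H = a * innerv Omega F H + innerv Omega G H.
Proof.
move=> FL GL HL; rewrite !(innervE Omega_open)//; last exact: L2v_lin.
rewrite mulr_sumr -big_split; apply: eq_bigr => i _ /=.
rewrite -(innerZl Omega_open)// -(innerDl Omega_open)//; last exact: L2Z.
by apply: eq_inner => // x _; rewrite /component !mxE.
Qed.

Lemma innerv0l F : innerv Omega (fun=> 0) F = 0.
Proof.
rewrite -(inner0l Omega (fun=> 0)); apply: eq_vint => x _; by rewrite dot0l mul0r.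
Qed.

Lemma innervBl F G H : L2v Omega F -> L2v Omega G -> L2v Omega H ->
  innerv Omega (fun x => F x - G x) H = innerv Omega F H - innerv Omega G H.
Proof.
move=> FL GL HL; have -> : innerv Omega (fun x => F x - G x) H =
    innerv Omega (fun x => (-1) *: G x + F x) H.
  by apply: eq_vint => x _; rewrite scaleN1r addrC.
by rewrite innerv_linl//; ring.
Qed.

Lemma innervNl F H : L2v Omega F -> L2v Omega H ->
  innerv Omega (fun x => - F x) H = - innerv Omega F H.
Proof.
move=> FL HL; have := innervBl (L2v_const 0) FL HL; rewrite innerv0l sub0r => <-.
by apply: eq_vint => x _; rewrite sub0r.
Qed.

Lemma ae_component F G i : ae_eq_on Omega F G -> ae_eq_on Omega (component i F) (component i G).
Proof. by apply: ae_imp => z FG zO; rewrite /component FG. Qed.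

Lemma ae_fields F G : (forall i, ae_eq_on Omega (component i F) (component i G)) ->
  ae_eq_on Omega F G.
Proof.
move=> H; have := ae_imp2 (S := fun z => Omega (pt z) -> component 0 F (pt z) = component 0 G (pt z)
  /\ component 1 F (pt z) = component 1 G (pt z)) _ (H 0) (H 1).
move=> /(_ (fun z h1 h2 zO => conj (h1 zO) (h2 zO))) H01.
by apply: ae_imp2 H01 (H 2%:R) => z h01 h2 zO; apply: rV3P; [have [] := h01 zO|have [] := h01 zO|exact: h2].
Qed.

Lemma ae_innerv F G H : L2v Omega F -> L2v Omega G -> L2v Omega H -> ae_eq_on Omega F G ->
  innerv Omega F H = innerv Omega G H.
Proof.
move=> FL GL HL FG; rewrite !(innervE Omega_open)//; apply: eq_bigr => i _.
by apply: (ae_inner Omega_open) => //; exact: ae_component.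
Qed.

Lemma innerv_eq0 F : L2v Omega F -> innerv Omega F F = 0 -> ae_eq_on Omega F (fun=> 0).
Proof.
move=> FL; rewrite (innervE Omega_open)// => /eqP.
rewrite psumr_eq0 => [/allP H|i _]; last exact: inner_ge0.
apply: ae_fields => i.
have := inner_eq0 Omega_open (FL i) (eqP (H i (mem_index_enum _))).
by apply: ae_imp => z h /h ->; rewrite /component mxE.
Qed.

Lemma smooth_partial i phi : smooth phi -> smooth (partial i phi).
Proof. by move=> sphi s; have := sphi (rcons s i); rewrite foldr_rcons. Qed.

Lemma smooth_continuous phi : smooth phi -> continuous phi.
Proof. by move=> sphi; have [] := sphi [::]. Qed.

Lemma component_grad i phi : component i (grad phi) = partial i phi.
Proof. by apply/funext => x; rewrite /component mxE. Qed.

Lemma smoothv_grad phi : smooth phi -> smoothv (grad phi).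
Proof. by move=> sphi i; rewrite component_grad; exact: smooth_partial. Qed.

Lemma smoothv_L2 F : smoothv F -> L2v Omega F.
Proof. by move=> sF i; apply: L2_continuous => //; exact: smooth_continuous. Qed.

Lemma L2v_grad phi : smooth phi -> L2v Omega (grad phi).
Proof. by move=> sphi; apply/smoothv_L2/smoothv_grad. Qed.

Lemma smoothv_curl F : smoothv F -> smoothv (curl F).
Proof.
move=> sF i s /=.
have E (t : seq 'I_3) : (let g := foldr partial (component i (curl F)) t in
    g = fun x => foldr partial (partial (i + 1) (component (i + 2%:R) F)) t x
      - foldr partial (partial (i + 2%:R) (component (i + 1) F)) t x).
  elim: t => [|b t IH] /=; first by apply/funext => x; rewrite /component mxE.
  rewrite IH; apply/funext => x; rewrite /partial deriveB//.
  - by have [_] := smooth_partial (i + 1) (sF (i + 2%:R)) t; exact.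
  - by have [_] := smooth_partial (i + 2%:R) (sF (i + 1)) t; exact.
have [c1 d1] := smooth_partial (i + 1) (sF (i + 2%:R)) s.
have [c2 d2] := smooth_partial (i + 2%:R) (sF (i + 1)) s.
rewrite E; split; first exact: contB.
by move=> b x; exact: derivableB.
Qed.

Lemma L2v_curl F : smoothv F -> L2v Omega (curl F).
Proof. by move=> /smoothv_curl; exact: smoothv_L2. Qed.

Lemma test_uniq f g : L2 Omega f -> L2 Omega g ->
  (forall phi, smooth phi -> compactly_supported Omega phi ->
     inner Omega f phi = inner Omega g phi) -> ae_eq_on Omega f g.
Proof.
move=> fL gL fg; have fgL : L2 Omega (fun x => f x - g x) by exact: L2B.
have H : forall phi, bump_fun phi -> compactly_supported Omega phi ->
    inner Omega (fun x => f x - g x) phi = 0.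
  move=> phi /bump_fun_smooth sphi cphi.
  have pL : L2 Omega phi by apply: L2_continuous => //; exact: smooth_continuous.
  by rewrite (innerBl Omega_open)// fg// subrr.
have := ae0_open Omega_open Omega_bounded (@subset_refl _ Omega) fgL H Omega_open.
by apply: ae_imp => z h zO; apply/eqP; rewrite -subr_eq0; apply/eqP/h.
Qed.

Lemma weak_div_uniq F g1 g2 : is_weak_div Omega F g1 -> is_weak_div Omega F g2 ->
  ae_eq_on Omega g1 g2.
Proof.
move=> [L1 H1] [L2' H2]; apply: test_uniq => // phi sphi cphi.
by apply: oppr_inj; rewrite -H1// -H2.
Qed.

Lemma wcurlP F : (exists z, is_weak_curl Omega F z) -> is_weak_curl Omega F (wcurl Omega F).
Proof. by move=> H; apply: (@xgetPex _ _ [set z | is_weak_curl Omega F z]). Qed.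

(** Scalar test functions put on one axis reduce statements on fields to their
    components. *)
Definition along (k : 'I_3) phi : 'rV[R]_3 -> 'rV[R]_3 := fun x => phi x *: delta_mx 0 k.

Lemma along_component k phi i : component i (along k phi) = fun x => (i == k)%:R * phi x.
Proof. by apply/funext => x; rewrite /component !mxE eqxx /= mulrC. Qed.

Lemma smooth_scale a phi : smooth phi -> smooth (fun x => a * phi x).
Proof.
move=> sphi s /=.
have E (t : seq 'I_3) : foldr partial (fun x => a * phi x) t = fun x => a * foldr partial phi t x.
  elim: t => //= b t ->; apply/funext => x.
  by rewrite /partial deriveZ//; have [_] := sphi t; exact.
have [c1 d1] := sphi s; rewrite E; split; first exact: contZ.
by move=> b x; apply: derivableZ.
Qed.

Lemma smoothv_along k phi : smooth phi -> smoothv (along k phi).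
Proof. by move=> sphi i; rewrite along_component; exact: smooth_scale. Qed.

Lemma compactly_supported_along k phi : compactly_supported Omega phi ->
  compactly_supported Omega (along k phi).
Proof. by move=> [A [cA AO] A0]; exists A => // x /A0; rewrite /along => ->; rewrite scale0r. Qed.

Lemma innerv_along F k phi : innerv Omega F (along k phi) = inner Omega (component k F) phi.
Proof.
apply: eq_vint => x _; rewrite /dot (bigD1 k)//= big1 ?addr0 => [|j jk]; rewrite !mxE eqxx /=.
  by rewrite eqxx mulr1.
by rewrite (negbTE jk) !mulr0.
Qed.

Lemma weak_curl_uniq F G z1 z2 : L2v Omega F -> L2v Omega G -> ae_eq_on Omega F G ->
  is_weak_curl Omega F z1 -> is_weak_curl Omega G z2 -> ae_eq_on Omega z1 z2.
Proof.
move=> FL GL FG [L1 H1] [L2' H2]; apply: ae_fields => k; apply: test_uniq => // phi sphi cphi.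
have sp := smoothv_along k sphi; have cp := compactly_supported_along k cphi.
rewrite -!innerv_along -H1// -H2//; apply: ae_innerv => //; exact: L2v_curl.
Qed.

Lemma weak_curl_lin a F G y z : L2v Omega F -> L2v Omega G -> is_weak_curl Omega F y ->
  is_weak_curl Omega G z -> is_weak_curl Omega (fun x => a *: F x + G x) (fun x => a *: y x + z x).
Proof.
move=> FL GL [yL yW] [zL zW]; split; first exact: L2v_lin.
move=> psi spsi cpsi; rewrite innerv_linl//; last exact: L2v_curl.
by rewrite yW// zW// innerv_linl//; exact: smoothv_L2.
Qed.

Lemma H0curl_lin a F G : H0curl Omega F -> H0curl Omega G -> H0curl Omega (fun x => a *: F x + G x).
Proof.
move=> [FL Fg Ft] [GL Gg Gt].
have FW := wcurlP Fg; have GW := wcurlP Gg; have W := weak_curl_lin a FL GL FW GW.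
have E : exists z, is_weak_curl Omega (fun x => a *: F x + G x) z.
  by exists (fun x => a *: wcurl Omega F x + wcurl Omega G x).
have L := L2v_lin a FL GL.
split; [exact: L2v_lin|by []|move=> psi spsi].
have pL := smoothv_L2 spsi; have cL := L2v_curl spsi.
have U := weak_curl_uniq L L (ae_eq_refl _) (wcurlP E) W.
rewrite (ae_innerv (wcurlP E).1 W.1 pL U) !innerv_linl//; [|exact: FW.1|exact: GW.1].
by rewrite opprD addrACA -mulrBr Ft// Gt// mulr0 addr0.
Qed.

Lemma H0curl0 : H0curl Omega (fun=> 0).
Proof.
have L0 := L2v_const 0.
have W : is_weak_curl Omega (fun=> 0) (fun=> 0) by split=> // psi _ _; rewrite !innerv0l.
have E : exists z, is_weak_curl Omega (fun=> 0) z by exists (fun=> 0).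
split=> // psi spsi; rewrite innerv0l.
have U := weak_curl_uniq L0 L0 (ae_eq_refl _) (wcurlP E) W.
by rewrite (ae_innerv (wcurlP E).1 W.1 (smoothv_L2 spsi) U) innerv0l subrr.
Qed.

End Fields.

(** * Symmetry of second partial derivatives *)

Section Schwarz.
Context {R : realType}.
Implicit Types (phi f : 'rV[R]_3 -> R) (x y : 'rV[R]_3) (i j k : 'I_3) (h t : R).
Notation e_ k := (delta_mx 0 k : 'rV[R]_3).

Lemma line_derive f y k t : derivable f (y + t *: e_ k) (e_ k) ->
  is_derive t 1 (fun s => f (y + s *: e_ k)) (partial k f (y + t *: e_ k)).
Proof.
move=> df.
have E : (fun h : R => h^-1 *: (((fun s => f (y + s *: e_ k)) \o shift t) (h *: (1:R)) - f (y + t *: e_ k))) =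
  (fun h : R => h^-1 *: ((f \o shift (y + t *: e_ k)) (h *: e_ k) - f (y + t *: e_ k))).
  apply/funext => h /=; congr (_ *: (f _ - _)).
  by rewrite scalerDl addrCA [h%:A]mulr1.
by apply: DeriveDef; rewrite /derivable /partial /derive /= E.
Qed.

Lemma partial_shift f k x y : derivable f (y + x) (e_ k) ->
  derivable (fun z => f (z + x)) y (e_ k) /\
  partial k (fun z => f (z + x)) y = partial k f (y + x).
Proof.
move=> df.
have E : (fun t : R => t^-1 *: (((fun z => f (z + x)) \o shift y) (t *: e_ k) - f (y + x))) =
  (fun t : R => t^-1 *: ((f \o shift (y + x)) (t *: e_ k) - f (y + x))).
  by apply/funext => t /=; rewrite addrA.
by split; rewrite /derivable /partial /derive E.
Qed.

Lemma line_MVT f y k h : (forall x, derivable f x (e_ k)) -> 0 < h ->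
  exists2 c, 0 < c < h & f (y + h *: e_ k) - f y = partial k f (y + c *: e_ k) * h.
Proof.
move=> df h0.
have D t : is_derive t 1 (fun s => f (y + s *: e_ k)) (partial k f (y + t *: e_ k)).
  exact: line_derive.
have [|c] := @MVT R (fun s => f (y + s *: e_ k)) (fun t => partial k f (y + t *: e_ k)) 0 h h0 (fun t _ => D t).
  apply: continuous_subspaceT => t; apply/differentiable_continuous/derivable1_diffP.
  by have [] := D t.
by rewrite in_itv /= scale0r addr0 subr0 => ch E; exists c.
Qed.

(** The mean value theorem along the axis [i] for the difference along the axis [j],
    and once more along the axis [j]. *)
Lemma second_difference i j phi x h : smooth phi -> 0 < h ->
  exists z : R * R, [/\ 0 < z.1 < h, 0 < z.2 < h &
    phi (x + h *: e_ i + h *: e_ j) - phi (x + h *: e_ i) - phi (x + h *: e_ j) + phi x =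
    partial j (partial i phi) (x + z.1 *: e_ i + z.2 *: e_ j) * (h * h)].
Proof.
move=> sphi h0.
have d1 k y : derivable phi y (e_ k) by have [_] := sphi [::]; exact.
have d2 k y : derivable (partial i phi) y (e_ k) by have [_] := sphi [:: i]; exact.
pose g y := phi (y + h *: e_ j) - phi y.
have dS y := partial_shift (d1 i (y + h *: e_ j)).
have dg y : derivable g y (e_ i) by apply: derivableB => //; exact: (dS y).1.
have pg y : partial i g y = partial i phi (y + h *: e_ j) - partial i phi y.
  by rewrite -(dS y).2 /partial; apply: deriveB => //; exact: (dS y).1.
have [a a0h E1] := line_MVT x dg h0.
have [b b0h E2] := line_MVT (x + a *: e_ i) (d2 j) h0.
exists (a, b); split=> //=; rewrite mulrA -E2 -pg -E1 /g; ring.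
Qed.

(** Otherwise a constant would separate the two continuous derivatives near [x],
    while [second_difference] applied in both orders makes them take equal values
    at points arbitrarily close to [x]. *)
Lemma partial_swap_le i j phi x : smooth phi ->
  partial i (partial j phi) x <= partial j (partial i phi) x.
Proof.
have mid (a b : R) : a < b -> a < (a + b) / 2 /\ (a + b) / 2 < b by move=> ab; split; lra.
move=> sphi; rewrite leNgt; apply/negP => lt.
pose G z := partial j (partial i phi) (tripoint x (x + e_ i) (x + e_ j) z).
pose H z := partial i (partial j phi) (tripoint x (x + e_ i) (x + e_ j) z).
have tpE z : tripoint x (x + e_ i) (x + e_ j) z = x + z.1 *: e_ i + z.2 *: e_ j.
  by rewrite /tripoint !(addrC x) !addrK.
have cG : continuous G.
  by apply: continuous_tripoint; have [] := sphi [:: j; i].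
have cH : continuous H.
  by apply: continuous_tripoint; have [] := sphi [:: i; j].
pose z0 : R * R := (0, 0).
have t0 : tripoint x (x + e_ i) (x + e_ j) z0 = x by rewrite tpE /= !scale0r !addr0.
have G0 : G z0 = partial j (partial i phi) x := congr1 (partial j (partial i phi)) t0.
have H0 : H z0 = partial i (partial j phi) x := congr1 (partial i (partial j phi)) t0.
rewrite -G0 -H0 in lt; pose c := (G z0 + H z0) / 2.
have [c1 c2] := mid _ _ lt.
have N1 := @cvgr_lt _ _ (nbhs z0) (nbhs_filter z0) G _ (cG z0) _ c1.
have N2 := @cvgr_gt _ _ (nbhs z0) (nbhs_filter z0) H _ (cH z0) _ c2.
have N : \forall z \near z0, G z < c /\ c < H z by exact: filterI N1 N2.
move: N => /nbhs_ballP[r /= r0 Hr].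
have B (z : R * R) : 0 < z.1 < r -> 0 < z.2 < r -> ball z0 r z.
  by move=> /andP[? ?] /andP[? ?]; split; rewrite /ball /= sub0r normrN gtr0_norm.
have [z [z1 z2 E1]] := second_difference i j x sphi r0.
have [y [y1 y2 E2]] := second_difference j i x sphi r0.
have [Gc _] := Hr z (B z z1 z2).
have [_ Hc] := Hr (y.2, y.1) (B (y.2, y.1) y2 y1).
have : G z * (r * r) = H (y.2, y.1) * (r * r).
  have -> : H (y.2, y.1) = partial i (partial j phi) (x + y.1 *: e_ j + y.2 *: e_ i).
    apply: (congr1 (partial i (partial j phi))); by rewrite tpE addrAC.
  have -> : G z = partial j (partial i phi) (x + z.1 *: e_ i + z.2 *: e_ j).
    exact: (congr1 (partial j (partial i phi)) (tpE z)).
  apply: etrans (esym E1) (etrans _ E2).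
  have -> : x + r *: e_ j + r *: e_ i = x + r *: e_ i + r *: e_ j by exact: addrAC.
  by congr (_ + phi x); exact: addrAC.
move/(mulIf (lt0r_neq0 (mulr_gt0 r0 r0))) => e.
by move: Gc Hc; rewrite /= e => a b; have := lt_trans a b; rewrite ltxx.
Qed.

Lemma partialC i j phi : smooth phi -> partial j (partial i phi) = partial i (partial j phi).
Proof.
move=> sphi; apply/funext => x.
exact: (le_anti (introT andP (conj (partial_swap_le j i x sphi) (partial_swap_le i j x sphi)))).
Qed.

Lemma curl_grad phi : smooth phi -> curl (grad phi) = fun=> 0.
Proof.
move=> sphi; apply/funext => x; apply/rowP => i.
rewrite !mxE !component_grad.
by rewrite (congr1 (fun f => f x) (partialC (i + 2%:R) (i + 1) sphi)) subrr.
Qed.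

End Schwarz.

(** * Curls of edge elements *)

Section CurlAsDivergence.
Context {R : realType}.
Implicit Types (phi : 'rV[R]_3 -> R) (F : 'rV[R]_3 -> 'rV[R]_3).

(** The field [rotf k F] is, up to sign, the cross product of [F] with the [k]-th
    basis vector. Its divergence is minus the [k]-th component of the curl of
    [F], so that results on weak divergences apply to weak curls. *)
Definition rot (V : zmodType) (k : 'I_3) (P : 'I_3 -> V) (a : 'I_3) : V :=
  if a == k + 2%:R then P (k + 1) else if a == k + 1 then - P (k + 2%:R) else 0.

Definition rotf k F : 'rV[R]_3 -> 'rV[R]_3 := fun x => \row_a rot k (F x 0) a.

Lemma partial_along k a b phi x : smooth phi ->
  partial b (component a (along k phi)) x = (a == k)%:R * partial b phi x.
Proof.
move=> sphi; rewrite along_component /partial; apply: deriveZ.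
by have [_] := sphi [::]; exact.
Qed.

Lemma dot_rot k F phi x : smooth phi ->
  dot (F x) (curl (along k phi) x) = dot (rotf k F x) (grad phi x).
Proof.
move=> sphi.
have e01 : 0 + 1 = 1 :> 'I_3 by exact/val_inj.
have e02 : 0 + 2%:R = 2%:R :> 'I_3 by exact/val_inj.
have e11 : 1 + 1 = 2%:R :> 'I_3 by exact/val_inj.
have e12 : 1 + 2%:R = 0 :> 'I_3 by exact/val_inj.
have e21 : 2%:R + 1 = 0 :> 'I_3 by exact/val_inj.
have e22 : 2%:R + 2%:R = 1 :> 'I_3 by exact/val_inj.
have n01 : ((0 : 'I_3) == 1) = false by [].
have n02 : ((0 : 'I_3) == 2%:R) = false by [].
have n10 : ((1 : 'I_3) == 0) = false by [].
have n12 : ((1 : 'I_3) == 2%:R) = false by [].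
have n20 : ((2%:R : 'I_3) == 0) = false by [].
have n21 : ((2%:R : 'I_3) == 1) = false by [].
have pa b a := @partial_along k a b phi x sphi.
rewrite !dot3 !mxE !pa /rot; case: (ord3P k) => ->;
  rewrite ?e01 ?e02 ?e11 ?e12 ?e21 ?e22 ?n01 ?n02 ?n10 ?n12 ?n20 ?n21 ?eqxx /=;
  move: (partial 0 phi x) (partial 1 phi x) (partial 2%:R phi x) => p0 p1 p2; ring.
Qed.

End CurlAsDivergence.

Section Spaces.
Context {R : realType}.
Variable Omega : set 'rV[R]_3.
Variable M : mesh R.
Hypothesis Omega_open : open Omega.
Hypothesis Omega_bounded : bounded_set Omega.
Hypothesis tri : triangulation M Omega.
Notation n := (nvert M).
Implicit Types (K : {set 'I_n}) (x y : 'rV[R]_3) (s : nat) (a : R) (k : 'I_3).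
Implicit Types (u v w z f : 'rV[R]_3 -> 'rV[R]_3) (C : {set 'I_n} -> 'I_3 -> poly3 R).

Lemma restricts_pw s u : (forall K, K \in cells M -> exists2 P : 'I_3 -> poly3 R,
    forall k, deg_le s (P k) & forall x, ohull K x -> u x = evalv P x) ->
  exists2 C, ispwv u C & forall K k, deg_le s (C K k).
Proof.
move=> H.
have H' K : exists P : 'I_3 -> poly3 R, (forall k, deg_le s (P k)) /\
    (K \in cells M -> forall x, ohull K x -> u x = evalv P x).
  have [KM|KM] := boolP (K \in cells M); first by have [P Ps uP] := H K KM; exists P.
  by exists (fun=> 0); split=> // k; exact: deg_le0.
have [C HC] := choice H'; exists C => [k K KM x xK|K k]; last by have [] := HC K.
by have [_ /(_ KM x xK)] := HC K; rewrite /component => ->; rewrite mxE.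
Qed.

Lemma Udiv_pw s u : Udiv Omega M s u -> exists2 C, ispwv u C & forall K k, deg_le s.+1 (C K k).
Proof.
move=> [_ H]; apply: restricts_pw => K KM; have [q [r [/is_polyvP[P Ps qP] [p ps rp] uE]]] := H K KM.
exists (fun k => P k + p * mpolyX R (mnm1 k)) => [k|x xK].
  apply: deg_leD; first by apply: deg_leW (Ps k).
  by rewrite -addn1; apply: deg_leM => //; exact: deg_leX.
rewrite uE ?(hull_interior (cellP tri KM))//; apply/rowP => k; rewrite !mxE rp !peE.
by have := congr1 (fun g => g x) (qP k); rewrite /component => ->.
Qed.

Lemma Ucurl_pw s w : Ucurl Omega M s w -> exists2 C, ispwv w C & forall K k, deg_le s.+1 (C K k).
Proof.
move=> [_ H]; apply: restricts_pw => K KM.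
have [q [r [/is_polyvP[P Ps qP] /is_polyvP[Q Qs rQ] wE]]] := H K KM.
exists (fun k => P k + (mpolyX R (mnm1 (k + 1)) * Q (k + 2%:R) - mpolyX R (mnm1 (k + 2%:R)) * Q (k + 1))).
  move=> k; apply: deg_leD; first by apply: deg_leW (Ps k).
  by apply: deg_leB; rewrite -add1n; apply: deg_leM => //; exact: deg_leX.
move=> x xK; rewrite wE ?(hull_interior (cellP tri KM))//; apply/rowP => k.
rewrite !mxE peD peB !peM !peX.
have qx j := congr1 (fun g => g x) (qP j); have rx j := congr1 (fun g => g x) (rQ j).
by rewrite /component in qx rx; rewrite qx !rx.
Qed.

Lemma deg_pdivp s (P : 'I_3 -> poly3 R) : (forall k, deg_le s.+1 (P k)) -> deg_le s (pdivp P).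
Proof. by move=> H; apply: deg_le_sum => k _; exact: (@deg_le_mderiv _ s.+1). Qed.

Lemma is_poly_lin s a (p q : 'rV[R]_3 -> R) : is_poly s p -> is_poly s q ->
  is_poly s (fun x => a * p x + q x).
Proof.
move=> [p' ps ->] [q' qs ->]; exists (a *: p' + q').
  by apply: deg_leD => //; exact: deg_leZ.
by apply/funext => x; rewrite peD peZ.
Qed.

Lemma is_polyv_lin s a u v : is_polyv s u -> is_polyv s v -> is_polyv s (fun x => a *: u x + v x).
Proof.
move=> us vs k; have := is_poly_lin a (us k) (vs k); congr is_poly.
by apply/funext => x; rewrite /component !mxE.
Qed.

Lemma Ucurl_lin s a u v : Ucurl Omega M s u -> Ucurl Omega M s v ->
  Ucurl Omega M s (fun x => a *: u x + v x).
Proof.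
move=> [uH uP] [vH vP]; split; first exact: H0curl_lin.
move=> K KM; have [q [r [qs rs uE]]] := uP K KM; have [q' [r' [qs' rs' vE]]] := vP K KM.
exists (fun x => a *: q x + q' x), (fun x => a *: r x + r' x); split.
- exact: is_polyv_lin.
- exact: is_polyv_lin.
- move=> x xK; rewrite uE// vE//; apply/rowP => k; rewrite !mxE; ring.
Qed.

Lemma Ucurl0 s : Ucurl Omega M s (fun=> 0).
Proof.
split; first exact: H0curl0.
have P0 : is_polyv s (fun=> 0).
  move=> k; exists 0; first exact: deg_le0.
  by apply/funext => x; rewrite /component mxE pe0.
move=> K KM; exists (fun=> 0), (fun=> 0); split=> // x xK.
by apply/rowP => k; rewrite !mxE; ring.
Qed.

Lemma weak_curl_rot k u z : L2v Omega u -> is_weak_curl Omega u z ->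
  is_weak_div Omega (rotf k u) (fun x => - component k z x).
Proof.
move=> uL [zL zW]; split; first by apply: L2N => //; exact: zL.
move=> phi sphi cphi.
have pL : L2 Omega phi by apply: L2_continuous => //; exact: smooth_continuous.
rewrite (innerNl Omega_open)// opprK -innerv_along -zW; first last.
- exact: compactly_supported_along.
- exact: smoothv_along.
by apply: eq_vint => x _; rewrite dot_rot.
Qed.

(** The product of the curl of [w] with a gradient vanishes, also for test functions
    that do not vanish on the boundary, because of the zero tangential trace of
    [w] and since the curl of a gradient is zero. This gives at once the zero
    weak divergence and the zero normal trace. *)
Lemma curl_in_Udiv s w : Ucurl Omega M s w -> exists z,
  [/\ Udiv Omega M s z, ae_eq_on Omega (wcurl Omega w) z & is_weak_div Omega z (fun=> 0)].
Proof.
move=> wU; have [[wL we wt] _] := wU; have [C wC Cs] := Ucurl_pw wU.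
have wW := wcurlP we.
pose c k K := - pdivp (rot k (C K)).
have cs k K : deg_le s (c k K).
  apply/deg_leN/deg_pdivp => j; rewrite /rot; case: ifP => _; first exact: Cs.
  by case: ifP => _; [exact/deg_leN/Cs|exact: deg_le0].
pose z x : 'rV[R]_3 := \row_k pwfun (c k) x.
have zk k : component k z = pwfun (c k) by apply/funext => x; rewrite /component mxE.
have zL : L2v Omega z by move=> k; rewrite zk; exact: L2_pwfun.
have E : ae_eq_on Omega (wcurl Omega w) z.
  apply: ae_fields => k; rewrite zk.
  have rC : ispwv (rotf k w) (fun K => rot k (C K)).
    move=> j K KM x xK; rewrite /component mxE /rot.
    by do 2?[case: ifP => _]; rewrite ?peN ?pe0 -?(wC _ K KM x xK).
  have := weak_div_pw Omega_open Omega_bounded tri (weak_curl_rot k wL wW) rC.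
  have Ec x : inter M x -> pwfun (fun K => pdivp (rot k (C K))) x = - pwfun (c k) x.
    by move=> [K KM xK]; rewrite !(pwfunE tri _ KM)// peN opprK.
  have := inter_ae_eq Omega_open tri Ec.
  by apply: ae_imp2 => y h1 h2 yO; apply: oppr_inj; rewrite -h1// -h2.
(* As [phi] may be nonzero on the boundary, this is also the vanishing of
   the normal trace of [z]. *)
have zW phi : smooth phi -> innerv Omega z (grad phi) = 0.
  move=> sphi; rewrite -(ae_innerv Omega_open wW.1 zL (L2v_grad Omega_open Omega_bounded sphi) E).
  have := wt _ (smoothv_grad sphi); rewrite curl_grad// innervC innerv0l => /eqP.
  by rewrite sub0r oppr_eq0 => /eqP.
have W0 : is_weak_div Omega z (fun=> 0).
  split; first exact: L2_0.
  by move=> phi sphi _; rewrite zW// inner0l oppr0.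
exists z; split=> //; split.
  have ez : exists g, is_weak_div Omega z g by exists (fun=> 0).
  split=> // phi sphi; rewrite zW// add0r.
  have pL : L2 Omega phi by apply: L2_continuous => //; exact: smooth_continuous.
  rewrite (ae_inner Omega_open (wdivP ez).1 W0.1 pL) ?inner0l//.
  exact: weak_div_uniq (wdivP ez) W0.
move=> K KM; exists (evalv (fun k => c k K)), (fun=> 0); split.
- by move=> k; rewrite evalv_comp; exists (c k K) => //; exact: cs.
- exists 0; first exact: deg_le0.
  by apply/funext => x; rewrite pe0.
- move=> x; rewrite (hull_interior (cellP tri KM)) => xK; rewrite scale0r addr0.
  by apply/rowP => k; rewrite !mxE (pwfunE tri _ KM).
Qed.

Definition is_proj_curl s f w := Ucurl Omega M s w /\
  forall v, Ucurl Omega M s v -> innerv Omega (fun x => f x - w x) v = 0.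

(** The function [proj_curl] is a choice among the projections if there is one and
    zero otherwise; both cases are compatible with a change of sign. *)
Lemma proj_curlP s f : (is_proj_curl s f (proj_curl Omega M s f)) \/
  ((forall w, ~ is_proj_curl s f w) /\ proj_curl Omega M s f = fun=> 0).
Proof.
have [[w wP]|H] := pselect (exists w, is_proj_curl s f w).
  by left; apply: (@xgetPex _ _ [set w | is_proj_curl s f w]); exists w.
right; have H' w : ~ is_proj_curl s f w by move=> wP; apply: H; exists w.
by split=> //; apply: xgetPN => w; exact: H'.
Qed.

Lemma Ucurl_proj_curl s f : Ucurl Omega M s (proj_curl Omega M s f).
Proof. by have [[]//|[_ ->]] := proj_curlP s f; exact: Ucurl0. Qed.

Lemma Ucurl_weak s w : Ucurl Omega M s w -> is_weak_curl Omega w (wcurl Omega w).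
Proof. by move=> [[_ we _] _]; exact: wcurlP. Qed.

Lemma Ucurl_L2v s w : Ucurl Omega M s w -> L2v Omega w.
Proof. by move=> [[]]. Qed.

Lemma UcurlN s w : Ucurl Omega M s w -> Ucurl Omega M s (fun x => - w x).
Proof.
move=> wU; have := Ucurl_lin (-1) wU (Ucurl0 s); congr Ucurl.
by apply/funext => x; rewrite scaleN1r addr0.
Qed.

Lemma UcurlB s v w : Ucurl Omega M s v -> Ucurl Omega M s w -> Ucurl Omega M s (fun x => v x - w x).
Proof.
move=> vU wU; have := Ucurl_lin (-1) wU vU; congr Ucurl.
by apply/funext => x; rewrite scaleN1r addrC.
Qed.

Lemma is_proj_curlN s f w : L2v Omega f -> is_proj_curl s f w ->
  is_proj_curl s (fun x => - f x) (fun x => - w x).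
Proof.
move=> fL [wU wP]; split=> [|v vU]; first exact: UcurlN.
have fwL := L2vB Omega_open Omega_bounded fL (Ucurl_L2v wU).
rewrite -[RHS]oppr0 -(wP v vU) -(innervNl Omega_open Omega_bounded fwL (Ucurl_L2v vU)).
by apply: eq_vint => x _; rewrite opprB opprK addrC.
Qed.

Lemma is_proj_curl_uniq s f w w' : L2v Omega f -> is_proj_curl s f w -> is_proj_curl s f w' ->
  ae_eq_on Omega w w'.
Proof.
move=> fL [wU wP] [wU' wP']; have dU := UcurlB wU wU'; have dL := Ucurl_L2v dU.
have wL := Ucurl_L2v wU; have wL' := Ucurl_L2v wU'.
have : innerv Omega (fun x => w x - w' x) (fun x => w x - w' x) = 0.
  have := wP _ dU; have := wP' _ dU.
  rewrite !(innervBl Omega_open Omega_bounded)// => h1 h2.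
  by move: h1 h2; lra.
move=> /(innerv_eq0 Omega_open dL); apply: ae_imp => z H zO.
by have /eqP := H zO; rewrite subr_eq0 => /eqP.
Qed.

Lemma weak_curl0 : is_weak_curl Omega (fun=> 0) (fun=> 0).
Proof. by split=> [|psi _ _]; [exact: L2v_const|rewrite !innerv0l]. Qed.

Lemma wcurl_proj0 s : ae_eq_on Omega (wcurl Omega (proj_curl Omega M s (fun=> 0))) (fun=> 0).
Proof.
have pU := Ucurl_proj_curl s (fun=> 0).
have L0 := L2v_const Omega_open Omega_bounded (0 : 'rV[R]_3).
apply: (weak_curl_uniq Omega_open Omega_bounded (Ucurl_L2v pU) L0 _ (Ucurl_weak pU) weak_curl0).
have [H|[_ ->]] := proj_curlP s (fun=> 0); last exact: ae_eq_refl.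
apply: (is_proj_curl_uniq L0 H); split; first exact: Ucurl0.
by move=> v _; rewrite -(innerv0l Omega v); apply: eq_vint => x _; rewrite subr0.
Qed.

(** Projections of [f] and of [- f] correspond to each other and are unique almost
    everywhere, and so is their weak curl. *)
Lemma wcurl_projN s f : L2v Omega f ->
  ae_eq_on Omega (wcurl Omega (proj_curl Omega M s (fun x => - f x)))
    (fun x => - wcurl Omega (proj_curl Omega M s f) x).
Proof.
move=> fL; set g := fun x => - f x; have gL : L2v Omega g by exact: L2vN.
have pU := Ucurl_proj_curl s f; have qU := Ucurl_proj_curl s g.
have E : ae_eq_on Omega (proj_curl Omega M s g) (fun x => - proj_curl Omega M s f x).
  have [H|[Nw ->]] := proj_curlP s f.
    have HN := is_proj_curlN fL H.
    have [H'|[Ny _]] := proj_curlP s g; first exact: is_proj_curl_uniq gL H' HN.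
    by have := Ny _ HN.
  have [H'|[_ ->]] := proj_curlP s g.
    exfalso; apply: (Nw (fun x => - proj_curl Omega M s g x)).
    have := is_proj_curlN gL H'; congr is_proj_curl.
    by apply/funext => x; rewrite /g opprK.
  by apply: (inter_ae_eq Omega_open tri) => x _; rewrite oppr0.
have L0 := L2v_const Omega_open Omega_bounded (0 : 'rV[R]_3).
have W := weak_curl_lin Omega_open Omega_bounded (-1) (Ucurl_L2v pU) L0 (Ucurl_weak pU) weak_curl0.
have NL := L2v_lin (-1) (Ucurl_L2v pU) L0.
have E' : ae_eq_on Omega (proj_curl Omega M s g) (fun x => (-1) *: proj_curl Omega M s f x + 0).
  by apply: ae_imp E => z h zO; rewrite h// scaleN1r addr0.
have := weak_curl_uniq Omega_open Omega_bounded (Ucurl_L2v qU) NL E' (Ucurl_weak qU) W.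
by apply: ae_imp => z h zO; rewrite h// scaleN1r addr0.
Qed.

End Spaces.

(** * Derivatives relative to a closed interval *)

Section WithinDerivative.
Context {R : realType}.
Variable T : R.
Hypothesis T_gt0 : 0 < T.
Implicit Types (c d : R -> R) (a b t r : R).

Notation near_ t := (within `[0, T] t^').

(** The derivative relative to [[0, T]], one-sided at the end points, with the limit
    taken as in the definition of [has_dt]. *)
Definition wder c t a := (fun r => (r - t)^-1 * (c r - c t)) @ near_ t --> a.

Lemma near_proper t : t \in `[0, T] -> ProperFilter (near_ t).
Proof.
rewrite in_itv /= => /andP[t0 tT]; apply: Build_ProperFilter_ex => B.
rewrite /within /dnbhs /= => /nbhs_ballP[e /= e0 eB].
pose h := Num.min (e / 2) (T / 2).
have h0 : 0 < h by rewrite lt_min !divr_gt0.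
have he : h < e by rewrite gt_min ltr_pdivrMr// ltr_pMr// ltr1n.
have hT : h <= T / 2 by rewrite ge_min lexx orbT.
have [tT2|tT2] := leP t (T / 2).
  exists (t + h); apply: (eB (t + h)) => //=.
  - by rewrite /ball /= opprD addrA subrr sub0r normrN gtr0_norm.
  - by rewrite gt_eqF// ltrDl.
  - by rewrite in_itv /=; apply/andP; split; lra.
exists (t - h); apply: (eB (t - h)) => //=.
- by rewrite /ball /= opprB addrC subrK gtr0_norm.
- by rewrite lt_eqF// ltrBlDr ltrDl.
- by rewrite in_itv /=; apply/andP; split; lra.
Qed.

Lemma near_id t : (fun r => r) @ near_ t --> t.
Proof.
apply: cvg_within_filter; apply: cvg_within_filter; exact: cvg_id.
Qed.

Lemma near_itv t (P : R -> Prop) : (forall r, r \in `[0, T] -> P r) -> \forall r \near near_ t, P r.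
Proof. by move=> H; rewrite near_withinE; apply: nearW => r; exact: H. Qed.

Lemma wder_cvg c t a : wder c t a -> c @ near_ t --> c t.
Proof.
move=> ca; have E : (fun r => c t + (r - t) * ((r - t)^-1 * (c r - c t))) = c.
  apply/funext => r; have [->|rt] := eqVneq r t; first by rewrite !subrr !mul0r addr0.
  by rewrite mulrA divff ?subr_eq0// mul1r addrC subrK.
have : (fun r => c t + (r - t) * ((r - t)^-1 * (c r - c t))) @ near_ t --> c t + (t - t) * a.
  have h1 : (fun r => r - t) @ near_ t --> t - t by apply: cvgB; [exact: near_id|exact: cvg_cst].
  by apply: cvgD; [exact: cvg_cst|exact: cvgM h1 ca].
by rewrite E subrr mul0r addr0.
Qed.

Lemma wder_cst a t : wder (fun=> a) t 0.
Proof.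
rewrite /wder (_ : (fun r => _) = fun=> 0); first exact: cvg_cst.
by apply/funext => r; rewrite subrr mulr0.
Qed.

Lemma wderD c d t a b : wder c t a -> wder d t b -> wder (fun r => c r + d r) t (a + b).
Proof.
move=> ca db; rewrite /wder (_ : (fun r => _) =
  fun r => (r - t)^-1 * (c r - c t) + (r - t)^-1 * (d r - d t)); first exact: cvgD.
by apply/funext => r; ring.
Qed.

Lemma wderM c d t a b : wder c t a -> wder d t b ->
  wder (fun r => c r * d r) t (a * d t + c t * b).
Proof.
move=> ca db; rewrite /wder (_ : (fun r => _) =
  fun r => (r - t)^-1 * (c r - c t) * d r + c t * ((r - t)^-1 * (d r - d t))).
  apply: cvgD; first by apply: cvgM => //; exact: wder_cvg db.
  by apply: cvgM => //; exact: cvg_cst.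
by apply/funext => r; ring.
Qed.

Lemma wderZ k c t a : wder c t a -> wder (fun r => k * c r) t (k * a).
Proof. by move=> ca; have := wderM (wder_cst k t) ca; rewrite mul0r add0r. Qed.

Lemma wder_sum (J : Type) (s : seq J) (c : J -> R -> R) (a : J -> R) t :
  (forall j, wder (c j) t (a j)) -> wder (fun r => \sum_(j <- s) c j r) t (\sum_(j <- s) a j).
Proof.
move=> ca; elim: s => [|j s IH].
  rewrite big_nil (_ : (fun r => _) = fun=> 0); first exact: wder_cst.
  by apply/funext => r; rewrite big_nil.
rewrite big_cons (_ : (fun r => _) = fun r => c j r + \sum_(j <- s) c j r); first exact: wderD.
by apply/funext => r; rewrite big_cons.
Qed.

Lemma eq_wder c d t a : t \in `[0, T] -> (forall r, r \in `[0, T] -> c r = d r) ->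
  wder c t a -> wder d t a.
Proof.
move=> tT cd; apply: cvg_trans; apply: near_eq_cvg.
by apply: near_itv => r rT; rewrite !cd.
Qed.

Lemma wder_uniq c t a b : t \in `[0, T] -> wder c t a -> wder c t b -> a = b.
Proof. by move=> tT ca cb; have P := near_proper tT; exact: cvg_unique ca cb. Qed.

(** The mean value theorem; inside the interval the relative derivative is the
    ordinary one. *)
Lemma wder0_cst c t1 t2 : (forall t, t \in `[0, T] -> wder c t 0) ->
  t1 \in `[0, T] -> t2 \in `[0, T] -> c t1 = c t2.
Proof.
move=> c0.
suff H a b : a \in `[0, T] -> b \in `[0, T] -> a < b -> c a = c b.
  by move=> h1 h2; have [/H->//|/H->//|->//] := ltgtP t1 t2.
rewrite !in_itv /= => /andP[a0 aT] /andP[b0 bT] ab.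
have sub t e : t \in `[0, T] -> 0 < e -> \forall r \near t, r \in `[0, T] -> `|c r - c t| < e.
  move=> tT e0; have := wder_cvg (c0 t tT).
  move=> /cvgr_dist_lt /(_ e e0); rewrite near_withinE /dnbhs near_withinE.
  apply: filterS => r H rT; have [->|rt] := eqVneq r t; first by rewrite subrr normr0.
  by rewrite distrC; exact: H.
have D t : t \in `]a, b[ -> is_derive t 1 c 0.
  rewrite in_itv /= => /andP[at_ tb].
  have tT : t \in `[0, T] by rewrite in_itv /=; apply/andP; split; lra.
  have L : (fun h : R => h^-1 *: ((c \o shift t) (h *: (1 : R)) - c t)) @ 0^' --> (0 : R).
    apply/cvgrPdist_lt => e e0.
    have := c0 t tT; move=> /cvgr_dist_lt /(_ e e0); rewrite near_withinE /dnbhs near_withinE.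
    move=> /nbhs_ballP[r /= r0 H]; rewrite near_withinE; apply/nbhs_ballP.
    pose q := Num.min r (Num.min (t - a) (b - t)).
    exists q; first by rewrite /= !lt_min r0 !subr_gt0 at_ tb.
    move=> h; rewrite /ball /= sub0r normrN !lt_min => /and3P[hr ha hb] h0.
    have := H (h + t); rewrite /ball /= opprD addrCA subrr addr0 normrN => /(_ hr).
    have ht : h + t != t by rewrite -subr_eq0 addrK.
    have hT : h + t \in `[0, T].
      move: ha hb; rewrite in_itv /= !ltr_norml => /andP[? ?] /andP[? ?].
      by apply/andP; split; lra.
    by move=> /(_ ht hT); rewrite addrK [h *: 1]mulr1.
  apply: DeriveDef; first by apply/cvg_ex; exists 0.
  exact: cvg_lim L.
have cA : c @ a^'+ --> c a.
  apply/cvgrPdist_lt => e e0.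
  have aT' : a \in `[0, T] by rewrite in_itv /= a0 aT.
  have S : \forall r \near a^'+, r \in `[0, T] -> `|c r - c a| < e.
    rewrite /at_right near_withinE.
    by apply: (@filterS _ (nbhs a) _ _ _ _ (sub a e aT' e0)) => r H _; exact: H.
  near=> r; rewrite distrC; near: r.
  apply: filterS3 S (nbhs_right_gt a) (nbhs_right_lt ab) => r H ar rb; apply: H.
  by rewrite in_itv /=; apply/andP; split; lra.
have cB : c @ b^'- --> c b.
  apply/cvgrPdist_lt => e e0.
  have bT' : b \in `[0, T] by rewrite in_itv /= b0 bT.
  have S : \forall r \near b^'-, r \in `[0, T] -> `|c r - c b| < e.
    rewrite /at_left near_withinE.
    by apply: (@filterS _ (nbhs b) _ _ _ _ (sub b e bT' e0)) => r H _; exact: H.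
  near=> r; rewrite distrC; near: r.
  apply: filterS3 S (nbhs_left_lt b) (nbhs_left_gt ab) => r H ar rb; apply: H.
  by rewrite in_itv /=; apply/andP; split; lra.
have [|z _] := MVT ab D; last by rewrite mul0r => /eqP; rewrite subr_eq0 => /eqP.
apply/continuous_within_itvP => //; split=> //.
by move=> t tab; have [dt _] := D t tab; exact/differentiable_continuous/derivable1_diffP.
Unshelve. all: by end_near.
Qed.

End WithinDerivative.

(** * Differentiable curves of piecewise polynomials *)

Section Curves.
Context {R : realType}.
Variable Omega : set 'rV[R]_3.
Variable M : mesh R.
Variable T : R.
Hypothesis Omega_open : open Omega.
Hypothesis Omega_bounded : bounded_set Omega.
Hypothesis tri : triangulation M Omega.
Hypothesis T_gt0 : 0 < T.
Notation n := (nvert M).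
Notation near_ t := (within `[0, T] t^').
Implicit Types (f g : R -> 'rV[R]_3 -> R) (D E h phi : 'rV[R]_3 -> R) (t r : R) (N : nat).

(** A curve [f r = sum_j c j r * o j] of piecewise polynomials whose coefficients are
    differentiable at [t], with derivative [D]. Unlike the
    limits in L^2, this notion is visibly stable under products, whatever the
    degrees. *)
Definition curve_der f t D := exists (J : finType) (o : J -> 'rV[R]_3 -> R)
  (c : J -> R -> R) (d : J -> R),
  [/\ forall j, exists p, o j = pwfun (M := M) p, forall j, wder T (c j) t (d j),
      forall r, r \in `[0, T] -> forall x, inter M x -> f r x = \sum_j c j r * o j x
    & forall x, inter M x -> D x = \sum_j d j * o j x].

Lemma eq_curve_der f g t D E : (forall r, r \in `[0, T] -> forall x, inter M x -> f r x = g r x) ->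
  (forall x, inter M x -> D x = E x) -> curve_der f t D -> curve_der g t E.
Proof.
move=> fg DE [J [ o [c [d [op cd fE DE']]]]]; exists J, o, c, d; split=> //.
- by move=> r rT x xI; rewrite -fg// fE.
- by move=> x xI; rewrite -DE// DE'.
Qed.

Lemma curve_derD f g t D E : curve_der f t D -> curve_der g t E ->
  curve_der (fun r x => f r x + g r x) t (fun x => D x + E x).
Proof.
move=> [J [ o [c [d [op cd fE DE]]]]] [J' [ o' [c' [d' [op' cd' fE' DE']]]]].
exists (J + J')%type, (fun j => match j with inl j => o j | inr j => o' j end),
  (fun j => match j with inl j => c j | inr j => c' j end),
  (fun j => match j with inl j => d j | inr j => d' j end); split.
- by case.
- by case.
- by move=> r rT x xI; rewrite big_sumType /= fE// fE'.
- by move=> x xI; rewrite big_sumType /= DE// DE'.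
Qed.

Lemma pwfunM (p q : {set 'I_n} -> poly3 R) x : inter M x ->
  pwfun p x * pwfun q x = pwfun (fun K => p K * q K) x.
Proof. by move=> [K KM xK]; rewrite !(pwfunE tri _ KM)// peM. Qed.

Lemma curve_derM f g t D E : t \in `[0, T] -> curve_der f t D -> curve_der g t E ->
  curve_der (fun r x => f r x * g r x) t (fun x => D x * g t x + f t x * E x).
Proof.
move=> tT [J [ o [c [d [op cd fE DE]]]]] [J' [ o' [c' [d' [op' cd' fE' DE']]]]].
have [p pP] := choice op; have [p' pP'] := choice op'.
exists (J * J')%type, (fun j => pwfun (fun K => p j.1 K * p' j.2 K)),
  (fun j r => c j.1 r * c' j.2 r), (fun j => d j.1 * c' j.2 t + c j.1 t * d' j.2).
have oE x j j' : inter M x -> pwfun (fun K => p j K * p' j' K) x = o j x * o' j' x.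
  by move=> xI; rewrite pP pP' pwfunM.
split.
- by move=> j; eexists.
- by move=> j; exact: wderM.
- move=> r rT x xI; rewrite fE// fE'// big_distrlr /= pair_bigA /=.
  by apply: eq_bigr => j _; rewrite oE//; ring.
- move=> x xI; rewrite DE// DE'// fE// fE'// !big_distrlr /= !pair_bigA -big_split /=.
  by apply: eq_bigr => j _; rewrite oE//; ring.
Qed.

Lemma curve_inner f t D phi : t \in `[0, T] -> L2 Omega phi -> curve_der f t D ->
  wder T (fun r => inner Omega (f r) phi) t (inner Omega D phi).
Proof.
move=> tT pL [J [ o [c [d [op cd fE DE]]]]].
have oL j : L2 Omega (o j) by have [p ->] := op j; exact: L2_pwfun.
have S (a : J -> R) F : (forall x, inter M x -> F x = \sum_j a j * o j x) ->
    inner Omega F phi = \sum_j inner Omega (o j) phi * a j.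
  move=> FE; transitivity (inner Omega (fun x => \sum_j a j * o j x) phi).
    by apply: (eq_inner_inter Omega_open tri) => // x; exact: FE.
  rewrite (inner_suml Omega_open Omega_bounded)//; last by move=> j _; exact: L2Z.
  by apply: eq_bigr => j _; rewrite (innerZl Omega_open)// mulrC.
rewrite (S d)//.
apply: (@eq_wder _ _ (fun r => \sum_j inner Omega (o j) phi * c j r)) => //.
  by move=> r rT; rewrite (S (fun j => c j r))// => x; exact: fE.
by apply: wder_sum => j; exact: wderZ.
Qed.

Lemma curve_vint f t D : t \in `[0, T] -> curve_der f t D ->
  wder T (fun r => vint Omega (f r)) t (vint Omega D).
Proof.
move=> tT fD; have oneL : L2 Omega (fun=> 1) by apply: L2_continuous => //; exact: cst_continuous.
have E F : vint Omega F = inner Omega F (fun=> 1) by apply: eq_vint => x _; rewrite mulr1.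
rewrite E (_ : (fun r => _) = fun r => inner Omega (f r) (fun=> 1)); first exact: curve_inner.
by apply/funext => r; exact: E.
Qed.

Lemma cvg_bigsum (J : Type) (s : seq J) (F : set_system R) (FF : Filter F) (q : J -> R -> R) (l : J -> R) :
  (forall j, q j @ F --> l j) -> (fun r => \sum_(j <- s) q j r) @ F --> \sum_(j <- s) l j.
Proof.
move=> ql; elim: s => [|j s IH].
  rewrite big_nil (_ : (fun r => _) = fun=> 0); first exact: cvg_cst.
  by apply/funext => r; rewrite big_nil.
rewrite big_cons (_ : (fun r => _) = fun r => q j r + \sum_(j <- s) q j r); first exact: cvgD.
by apply/funext => r; rewrite big_cons.
Qed.

(** The squared norm of the difference between quotient and derivative is a
    quadratic form in the corresponding differences of the coefficients. *)
Lemma curve_has_dt f t D : t \in `[0, T] -> curve_der f t D -> L2 Omega D ->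
  (forall r, r \in `[0, T] -> L2 Omega (f r)) -> has_dt Omega T f t D.
Proof.
move=> tT [J [ o [c [d [op cd fE DE]]]]] DL fL; split=> //.
have oL j : L2 Omega (o j) by have [p ->] := op j; exact: L2_pwfun.
pose a j r := (r - t)^-1 * (c j r - c j t) - d j.
pose e r x := (r - t)^-1 * (f r x - f t x) - D x.
have a0 j : a j @ near_ t --> (0 : R).
  rewrite -[X in _ --> X](subrr (d j)); apply: cvgB; last exact: cvg_cst.
  exact: cd.
have eE r x : r \in `[0, T] -> inter M x -> e r x = \sum_j a j r * o j x.
  move=> rT xI; rewrite /e !fE// DE// -sumrB mulr_sumr -sumrB; apply: eq_bigr => j _.
  by rewrite /a; ring.
have eL r : r \in `[0, T] -> L2 Omega (e r).
  by move=> rT; apply: L2B => //; apply: L2Z => //; apply: L2B => //; exact: fL.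
pose G r := \sum_j \sum_k inner Omega (o j) (o k) * (a j r * a k r).
have GE r : r \in `[0, T] -> inner Omega (e r) (e r) = G r.
  move=> rT; pose S x := \sum_j a j r * o j x.
  have SL : L2 Omega S by apply: L2_sum => // j _; exact: L2Z.
  transitivity (inner Omega S S).
    by apply: (eq_inner_inter Omega_open tri) => x xI; exact: eE.
  rewrite {1}/S (inner_suml Omega_open Omega_bounded)//; last by move=> j _; exact: L2Z.
  apply: eq_bigr => j _; rewrite (innerZl Omega_open)// innerC.
  rewrite (inner_suml Omega_open Omega_bounded)//; last by move=> k _; exact: L2Z.
  rewrite mulr_sumr; apply: eq_bigr => k _; rewrite (innerZl Omega_open)// innerC; ring.
have G0 : G @ near_ t --> (0 : R).
  suff : G @ near_ t --> \sum_j \sum_k inner Omega (o j) (o k) * (0 * 0).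
    rewrite [X in _ --> X]big1// => j _; rewrite big1// => k _; rewrite mul0r mulr0//.
  apply: cvg_bigsum => j; apply: cvg_bigsum => k; apply: cvgM; first exact: cvg_cst.
  by apply: cvgM; exact: a0.
have H : (fun r => (Num.sqrt (G r))%:E) @ near_ t --> 0%E.
  apply: cvg_EFin; first exact: nearW.
  have S0 : (fun r => Num.sqrt (G r)) @ near_ t --> Num.sqrt (0 : R).
    exact: (@cvg_comp _ _ _ G (@Num.sqrt R) _ _ _ G0 (@sqrt_continuous R 0)).
  by rewrite sqrtr0 in S0.
apply: cvg_trans H; apply: near_eq_cvg; apply: near_itv => r rT.
by rewrite -GE// -L2normE//; exact: eL.
Qed.

(** By the Cauchy-Schwarz inequality, pairing with [phi] is continuous for the
    norm of L^2. *)
Lemma has_dt_inner f t D phi : t \in `[0, T] -> has_dt Omega T f t D ->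
  (forall r, r \in `[0, T] -> L2 Omega (f r)) -> L2 Omega phi ->
  wder T (fun r => inner Omega (f r) phi) t (inner Omega D phi).
Proof.
move=> tT [DL fD] fL pL.
pose e r x := (r - t)^-1 * (f r x - f t x) - D x.
have eL r : r \in `[0, T] -> L2 Omega (e r).
  by move=> rT; apply: L2B => //; apply: L2Z => //; apply: L2B => //; exact: fL.
pose s r := Num.sqrt (inner Omega (e r) (e r)).
have s0 : s @ near_ t --> (0 : R).
  have H : (fun r => (s r)%:E) @ near_ t --> 0%E.
    apply: cvg_trans fD; apply: near_eq_cvg; apply: near_itv => r rT.
    by rewrite -L2normE//; exact: eL.
  exact: (fine_cvg H).
pose q r := (r - t)^-1 * (inner Omega (f r) phi - inner Omega (f t) phi).
pose k := Num.sqrt (inner Omega phi phi).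
have qE r : r \in `[0, T] -> q r - inner Omega D phi = inner Omega (e r) phi.
  move=> rT; have fr := fL r rT; have ft := fL t tT.
  have dL := L2B Omega_open Omega_bounded fr ft.
  have zL := L2Z Omega_open Omega_bounded (r - t)^-1 dL.
  by rewrite /e (innerBl Omega_open)// (innerZl Omega_open)// (innerBl Omega_open).
have B r : r \in `[0, T] -> inner Omega D phi - s r * k <= q r <= inner Omega D phi + s r * k.
  move=> rT; have CS := inner_CauchySchwarz Omega_open Omega_bounded (eL r rT) pL.
  have : `|inner Omega (e r) phi| <= s r * k.
    rewrite /s /k -sqrtrM ?inner_ge0// -sqrtr_sqr ler_wsqrtr//.
  rewrite -qE// ler_norml => /andP[h1 h2]; apply/andP; split; move: h1 h2; lra.
have L1 : (fun r => inner Omega D phi - s r * k) @ near_ t --> inner Omega D phi.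
  rewrite -[X in _ --> X]subr0 -[X in _ --> _ - X](mul0r k).
  by apply: cvgB; [exact: cvg_cst|apply: cvgM => //; exact: cvg_cst].
have L2' : (fun r => inner Omega D phi + s r * k) @ near_ t --> inner Omega D phi.
  rewrite -[X in _ --> X]addr0 -[X in _ --> _ + X](mul0r k).
  by apply: cvgD; [exact: cvg_cst|apply: cvgM => //; exact: cvg_cst].
apply: squeeze_cvgr L1 L2'.
by apply: near_itv.
Qed.

Lemma has_dt_uniq f t D E : t \in `[0, T] -> has_dt Omega T f t D -> has_dt Omega T f t E ->
  (forall r, r \in `[0, T] -> L2 Omega (f r)) -> ae_eq_on Omega D E.
Proof.
move=> tT fD fE fL; apply: (inner_cancel Omega_open Omega_bounded fD.1 fE.1) => h hL.
exact: (wder_uniq T_gt0 tT (has_dt_inner tT fD fL hL) (has_dt_inner tT fE fL hL)).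
Qed.

Lemma dtP f t : (exists D, has_dt Omega T f t D) -> has_dt Omega T f t (dt Omega T f t).
Proof. by move=> H; apply: (@xgetPex _ _ [set D | has_dt Omega T f t D]). Qed.

Lemma dt_of_curve f t D : t \in `[0, T] -> curve_der f t D -> L2 Omega D ->
  (forall r, r \in `[0, T] -> L2 Omega (f r)) ->
  L2 Omega (dt Omega T f t) /\ ae_eq_on Omega (dt Omega T f t) D.
Proof.
move=> tT fD DL fL; have H := curve_has_dt tT fD DL fL.
have H' : has_dt Omega T f t (dt Omega T f t) by apply: dtP; exists D.
by split; [exact: H'.1|exact: has_dt_uniq tT H' H fL].
Qed.

(** The coefficients in an orthonormal list are inner products, which are
    differentiable by [has_dt_inner]. *)
Lemma dt_curve N f t : t \in `[0, T] -> (exists D, has_dt Omega T f t D) ->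
  (forall r, r \in `[0, T] -> L2 Omega (f r) /\ piecewise_poly M N (f r)) ->
  exists D, [/\ curve_der f t D, pwpoly M N D, L2 Omega (dt Omega T f t)
    & ae_eq_on Omega (dt Omega T f t) D].
Proof.
move=> tT /dtP fD fP; set g := dt Omega T f t in fD *.
have fL r : r \in `[0, T] -> L2 Omega (f r) by move=> /fP[].
have [bs [bN bP]] := pw_basis Omega_open Omega_bounded tri N.
have bL p : p \in bs -> L2 Omega p by move=> /bN/pwpoly_L2; exact.
pose o (j : 'I_(size bs)) := nth (fun=> 0) bs j.
have ob j : o j \in bs by exact: mem_nth.
have E h x : l2expansion Omega bs h x = \sum_j inner Omega h (o j) * o j x.
  by rewrite /l2expansion (big_nth (fun=> 0)) big_mkord.
have C : curve_der f t (l2expansion Omega bs g).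
  exists 'I_(size bs), o, (fun j r => inner Omega (f r) (o j)), (fun j => inner Omega g (o j)).
  split.
  - by move=> j; have [p -> _] := bN _ (ob j); exists p.
  - by move=> j; apply: has_dt_inner => //; exact: bL.
  - by move=> r rT x xI; rewrite (bP (f r) (fP r rT).2 x xI) E.
  - by move=> x xI; rewrite E.
have PN : pwpoly M N (l2expansion Omega bs g) by exact: pwpoly_sum.
exists (l2expansion Omega bs g); split=> //; first exact: fD.1.
have PL : L2 Omega (l2expansion Omega bs g) by exact: pwpoly_L2 PN.
exact: has_dt_uniq tT fD (curve_has_dt tT C PL fL) fL.
Qed.

End Curves.

(** * Piecewise polynomial fields *)

Section PiecewiseFields.
Context {R : realType}.
Variable Omega : set 'rV[R]_3.
Variable M : mesh R.
Hypothesis Omega_open : open Omega.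
Hypothesis Omega_bounded : bounded_set Omega.
Hypothesis tri : triangulation M Omega.
Notation n := (nvert M).
Implicit Types (f g : 'rV[R]_3 -> R) (u v : 'rV[R]_3 -> 'rV[R]_3) (s m : nat).
Implicit Types (C : {set 'I_n} -> 'I_3 -> poly3 R).

(** Being given by polynomials on the open cells does not determine the values on
    the faces, nor their measurability; hence the first condition. The class is
    closed under products, unlike the space of square integrable functions. *)
Definition bpw f := L2 Omega f /\ exists c : {set 'I_n} -> poly3 R, ispw f c.
Definition bpwv u := forall a : 'I_3, bpw (component a u).

Lemma bpwM f g : bpw f -> bpw g -> bpw (fun x => f x * g x).
Proof.
move=> [fL [c fc]] [gL [d gd]]; have fg := ispwM fc gd; split; last by eexists; exact: fg.
apply: (L2_pw Omega_open Omega_bounded tri _ fg).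
by apply: measurable_funM; exact: measurable_L2.
Qed.

Lemma bpwD f g : bpw f -> bpw g -> bpw (fun x => f x + g x).
Proof. by move=> [fL [c fc]] [gL [d gd]]; split; [exact: L2D|eexists; exact: ispwD fc gd]. Qed.

Lemma bpwB f g : bpw f -> bpw g -> bpw (fun x => f x - g x).
Proof. by move=> [fL [c fc]] [gL [d gd]]; split; [exact: L2B|eexists; exact: ispwB fc gd]. Qed.

Lemma pwpoly_bpw N f : pwpoly M N f -> bpw f.
Proof.
by move=> fN; split; [exact: pwpoly_L2 fN|have [c fc _] := (pwP tri _ _).1 (pwpoly_pw tri fN); exists c].
Qed.

Lemma Fh_bpw m f : Fh Omega M m f -> bpw f.
Proof. by move=> [fL /(pwP tri)[c fc _]]; split=> //; exists c. Qed.

Lemma bpw_dot u v : bpwv u -> bpwv v -> bpw (fun x => dot (u x) (v x)).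
Proof.
move=> ub vb; have := bpwD (bpwD (bpwM (ub 0) (vb 0)) (bpwM (ub 1) (vb 1))) (bpwM (ub 2%:R) (vb 2%:R)).
by congr bpw; apply/funext => x; rewrite dot3.
Qed.

Lemma bpwv_scale f u : bpw f -> bpwv u -> bpwv (fun x => f x *: u x).
Proof.
move=> fb ub a; have := bpwM fb (ub a); congr bpw.
by apply/funext => x; rewrite /component mxE.
Qed.

Lemma bpwv_cross u v : bpwv u -> bpwv v -> bpwv (fun x => cross (u x) (v x)).
Proof.
move=> ub vb a; have := bpwB (bpwM (ub (a + 1)) (vb (a + 2%:R))) (bpwM (ub (a + 2%:R)) (vb (a + 1))).
by congr bpw; apply/funext => x; rewrite /component mxE.
Qed.

Lemma bpwvL u : bpwv u -> L2v Omega u.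
Proof. by move=> ub a; have [] := ub a. Qed.

Lemma Udiv_bpw s u : Udiv Omega M s u -> bpwv u.
Proof.
move=> uU; have [C uC _] := Udiv_pw tri uU; have [[uL _ _] _] := uU.
by move=> a; split; [exact: uL|eexists; exact: uC].
Qed.

Lemma vint_inner1 f : vint Omega f = inner Omega f (fun=> 1).
Proof. by apply: eq_vint => x _; rewrite mulr1. Qed.

Lemma L2_1 : L2 Omega (fun=> 1).
Proof. by apply: L2_continuous => //; exact: cst_continuous. Qed.

Lemma vint_D f g : L2 Omega f -> L2 Omega g ->
  vint Omega (fun x => f x + g x) = vint Omega f + vint Omega g.
Proof. by move=> fL gL; rewrite !vint_inner1 (innerDl Omega_open)//; exact: L2_1. Qed.

Lemma Fh_1 m : Fh Omega M m (fun=> 1).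
Proof.
split; first exact: L2_1.
apply/(pwP tri); exists (fun=> mpolyC 3 1) => [|K]; last exact: deg_leC.
exact: ispwC.
Qed.

(** A constant has neither gradient nor jumps. *)
Lemma bh_const m f g u C d : H0div Omega u -> ispwv u C ->
  (forall x, inter M x -> proj_F Omega M m f x = 1) -> ispw (M := M) (proj_F Omega M m g) d ->
  bh Omega M m f g u = 0.
Proof.
move=> uH uC f1 gd.
have fc : ispw (proj_F Omega M m f) (fun _ : {set 'I_n} => mpolyC 3 1).
  by apply: (@eq_ispw _ M (fun=> 1)); [move=> x xI; rewrite f1|exact: ispwC].
rewrite (bhE Omega_open Omega_bounded tri uH uC fc gd) big1 ?oppr0 ?add0r.
  rewrite big1// => e; rewrite inE => /andP[/eqP e3 _]; apply: tE0 => // x _.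
  by rewrite /face_flux subrr mulr0 mul0r mulr0.
move=> K KM; rewrite -[RHS](inner0l (hull K) (fun=> 0)); apply: eq_vint => x _.
have -> : grad (poly_eval (mpolyC 3 (1 : R))) x = 0.
  by apply/rowP => a; rewrite !mxE partial_poly mderivC pe0.
by rewrite dot0r !mul0r.
Qed.

Lemma proj_F_pw m f : L2 Omega f -> exists d : {set 'I_n} -> poly3 R, ispw (proj_F Omega M m f) d.
Proof.
by move=> fL; have [[_ /(pwP tri)[d dP _]] _] := proj_FP Omega_open Omega_bounded tri m fL; exists d.
Qed.

Lemma bh_proj m f g u : L2 Omega f -> H0div Omega u -> bpwv u -> L2 Omega g ->
  bh Omega M m (proj_F Omega M m f) g u = bh Omega M m f g u.
Proof.
move=> fL uH ub gL; have [d gd] := proj_F_pw m gL; have [c fc] := proj_F_pw m fL.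
have [C uC] := choice (fun a => (ub a).2).
have [fF _] := proj_FP Omega_open Omega_bounded tri m fL.
have fc' : ispw (proj_F Omega M m (proj_F Omega M m f)) c.
  by apply: eq_ispw fc => x xI; rewrite (proj_F_id Omega_open Omega_bounded tri fF).
have uC' : ispwv u (fun K a => C a K) by [].
by rewrite (bhE Omega_open Omega_bounded tri uH uC' fc gd) (bhE Omega_open Omega_bounded tri uH uC' fc' gd).
Qed.

Lemma grad_cst (k : R) : grad (fun _ : 'rV[R]_3 => k) = fun=> 0.
Proof.
apply/funext => x; apply/rowP => a; rewrite !mxE.
have -> : (fun _ : 'rV[R]_3 => k) = poly_eval (mpolyC 3 k) by apply/funext => y; rewrite peC.
by rewrite partial_poly mderivC pe0.
Qed.

Lemma smooth_cst (k : R) : smooth (fun _ : 'rV[R]_3 => k).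
Proof.
have -> : (fun _ : 'rV[R]_3 => k) = poly_eval (mpolyC 3 k) by apply/funext => y; rewrite peC.
exact: smooth_poly.
Qed.

(** The divergence of a face element is piecewise polynomial of degree [s], and of
    mean zero by the vanishing normal trace; thus it is an admissible [q], and
    it is orthogonal to itself. *)
Lemma solenoidal s u C : Udiv Omega M s u -> ispwv u C -> (forall K k, deg_le s.+1 (C K k)) ->
  (forall q, Qh Omega M s q -> inner Omega (wdiv Omega u) q = 0) ->
  ae_eq_on Omega (pwfun (fun K => pdivp (C K))) (fun=> 0).
Proof.
move=> [[uL ue ut] _] uC Cs Hq; set q := pwfun _.
have qL : L2 Omega q by exact: L2_pwfun.
have wL : L2 Omega (wdiv Omega u) := (wdivP ue).1.
have wq := wdiv_pw Omega_open Omega_bounded tri ue uC.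
have q0 : vint Omega q = 0.
  rewrite vint_inner1 -(ae_inner Omega_open wL qL L2_1 wq).
  by have := ut _ (smooth_cst 1); rewrite grad_cst innervC innerv0l add0r.
have qQ : Qh Omega M s q.
  split=> //; apply/(pwP tri); exists (fun K => pdivp (C K)); first exact: (pwfunE tri).
  by move=> K; apply: deg_pdivp.
apply: (inner_eq0 Omega_open qL).
by rewrite -(ae_inner Omega_open wL qL qL wq) Hq.
Qed.

End PiecewiseFields.

Section FieldCurves.
Context {R : realType}.
Variable Omega : set 'rV[R]_3.
Variable M : mesh R.
Variable T : R.
Hypothesis Omega_open : open Omega.
Hypothesis Omega_bounded : bounded_set Omega.
Hypothesis tri : triangulation M Omega.
Hypothesis T_gt0 : 0 < T.
Notation n := (nvert M).
Implicit Types (V W : R -> 'rV[R]_3 -> 'rV[R]_3) (D E G : 'rV[R]_3 -> 'rV[R]_3) (t r : R) (s : nat).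

Definition curve_derv V t D := forall a : 'I_3,
  curve_der M T (fun r => component a (V r)) t (component a D).

Lemma curve_dot V W t D E : t \in `[0, T] -> curve_derv V t D -> curve_derv W t E ->
  curve_der M T (fun r x => dot (V r x) (W r x)) t
    (fun x => dot (D x) (W t x) + dot (V t x) (E x)).
Proof.
move=> tT VD WE; have H a := curve_derM tri tT (VD a) (WE a).
have := curve_derD (curve_derD (H 0) (H 1)) (H 2%:R); apply: eq_curve_der.
  by move=> r rT x xI; rewrite dot3.
by move=> x xI; rewrite !dot3 /component; ring.
Qed.

Lemma curve_innerv V t D G : t \in `[0, T] -> curve_derv V t D -> L2v Omega D -> L2v Omega G ->
  (forall r, r \in `[0, T] -> L2v Omega (V r)) ->
  wder T (fun r => innerv Omega (V r) G) t (innerv Omega D G).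
Proof.
move=> tT VD DL GL VL; rewrite (innervE Omega_open)//.
apply: (@eq_wder _ _ (fun r => \sum_(a < 3) inner Omega (component a (V r)) (component a G))) => //.
  by move=> r rT; rewrite (innervE Omega_open)//; exact: VL.
by apply: wder_sum => a; exact: (curve_inner Omega_open Omega_bounded tri tT (GL a) (VD a)).
Qed.

Lemma dtv_curve s V t : t \in `[0, T] -> time_differentiablev Omega T V ->
  (forall r, r \in `[0, T] -> Udiv Omega M s (V r)) ->
  exists D, [/\ curve_derv V t D, bpwv Omega M D, L2v Omega (dtv Omega T V t)
    & ae_eq_on Omega (dtv Omega T V t) D].
Proof.
move=> tT Vd VU.
have H (a : 'I_3) : exists D : 'rV[R]_3 -> R, [/\ curve_der M T (fun r => component a (V r)) t D,
    pwpoly M s.+1 D, L2 Omega (dt Omega T (fun r => component a (V r)) t)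
    & ae_eq_on Omega (dt Omega T (fun r => component a (V r)) t) D].
  apply: dt_curve => //; first exact: Vd.
  move=> r rT; have [[VL _ _] _] := VU r rT; split; first exact: VL.
  by have [C VC Cs] := Udiv_pw tri (VU r rT); apply/(pwP tri); exists (fun K => C K a).
have [D HD] := choice H.
have cD a : component a (fun x => \row_a D a x) = D a.
  by apply/funext => x; rewrite /component mxE.
have cdt a : component a (dtv Omega T V t) = dt Omega T (fun r => component a (V r)) t.
  by apply/funext => x; rewrite /component mxE.
exists (fun x => \row_a D a x); split.
- by move=> a; rewrite cD; have [] := HD a.
- by move=> a; rewrite cD; apply: pwpoly_bpw; have [_ ] := HD a; eauto.
- by move=> a; rewrite cdt; have [] := HD a.
- by apply: ae_fields => a; rewrite cD cdt; have [] := HD a.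
Qed.

Lemma dtv_of_curve V t D : t \in `[0, T] -> curve_derv V t D -> L2v Omega D ->
  (forall r, r \in `[0, T] -> L2v Omega (V r)) ->
  L2v Omega (dtv Omega T V t) /\ ae_eq_on Omega (dtv Omega T V t) D.
Proof.
move=> tT VD DL VL.
have cdt a : component a (dtv Omega T V t) = dt Omega T (fun r => component a (V r)) t.
  by apply/funext => x; rewrite /component mxE.
have H a := dt_of_curve Omega_open Omega_bounded tri T_gt0 tT (VD a) (DL a) (fun r rT => VL r rT a).
split=> [a|]; first by rewrite cdt; have [] := H a.
by apply: ae_fields => a; rewrite cdt; have [] := H a.
Qed.

End FieldCurves.

(** * The conservation laws *)

Section Balances.
Context {R : realFieldType}.

Lemma rho2_balance (a b : R) : b + b = 0 -> a + b = 0 -> a + a = 0.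
Proof. by lra. Qed.

(** Read [a] as the product of the derivative of [rho] with [dot u u], [b] as that of
    [rho u'] with [u], [e] as that of [B'] with [B], [h] as [ah B B u] and [c] as
    [bh (dot u u) rho u]. The conclusion is the derivative of the energy. *)
Lemma energy_balance (a b e h c : R) :
  a + b + 0 - h + 2^-1 * c = 0 -> e + h = 0 -> a + c = 0 -> a + (b + b) + (e + e) = 0.
Proof. by lra. Qed.

(** Read [a] as the product of [u'] with [B], [e] as that of [B'] with [u], [z] as
    [ah u u B] and [c] as [bh (dot u u) rho B]. *)
Lemma helicity_balance (a e z c : R) :
  a + z - 0 + 2^-1 * c = 0 -> e - z = 0 -> c + 0 = 0 -> a + e = 0.
Proof. by lra. Qed.

End Balances.

Section Conservation.
Context {R : realType}.
Variables (Omega : set 'rV[R]_3) (M : mesh R) (s m : nat) (T : R).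
Variables (u B : R -> 'rV[R]_3 -> 'rV[R]_3) (rho p : R -> 'rV[R]_3 -> R).
Hypothesis Omega_open : open Omega.
Hypothesis Omega_bounded : bounded_set Omega.
Hypothesis tri : triangulation M Omega.
Hypothesis T_gt0 : 0 < T.
Hypothesis u_in : forall t, t \in `[0, T] -> Udiv Omega M s (u t).
Hypothesis B_in : forall t, t \in `[0, T] -> Udiv Omega M s (B t).
Hypothesis rho_in : forall t, t \in `[0, T] -> Fh Omega M m (rho t).
Hypothesis p_in : forall t, t \in `[0, T] -> Qh Omega M s (p t).
Hypothesis u_diff : time_differentiablev Omega T u.
Hypothesis B_diff : time_differentiablev Omega T B.
Hypothesis rho_diff : time_differentiable Omega T rho.
Hypothesis divB0 : ae_eq_on Omega (wdiv Omega (B 0)) (fun=> 0).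
Hypothesis momentum : forall t, t \in `[0, T] -> forall v, Udiv Omega M s v ->
  innerv Omega (dtv Omega T (fun r x => rho r x *: u r x) t) v
  + ah Omega M s (fun x => rho t x *: u t x) (u t) v
  - ah Omega M s (B t) (B t) v
  + 2^-1 * bh Omega M m (fun x => dot (u t x) (u t x)) (rho t) v
  = inner Omega (p t) (wdiv Omega v).
Hypothesis induction : forall t, t \in `[0, T] -> forall C, Udiv Omega M s C ->
  innerv Omega (dtv Omega T B t) C + ah Omega M s C (B t) (u t) = 0.
Hypothesis continuity : forall t, t \in `[0, T] -> forall sigma, Fh Omega M m sigma ->
  inner Omega (dt Omega T rho t) sigma + bh Omega M m sigma (rho t) (u t) = 0.
Hypothesis incompressibility : forall t, t \in `[0, T] -> forall q, Qh Omega M s q ->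
  inner Omega (wdiv Omega (u t)) q = 0.
Notation n := (nvert M).
Implicit Types (C : {set 'I_n} -> 'I_3 -> poly3 R) (t : R).
Notation b2 t := (fun x => dot (u t x) (u t x)).

Lemma u_bpw t : t \in `[0, T] -> bpwv Omega M (u t).
Proof. by move=> tT; exact: (Udiv_bpw tri (u_in tT)). Qed.
Lemma B_bpw t : t \in `[0, T] -> bpwv Omega M (B t).
Proof. by move=> tT; exact: (Udiv_bpw tri (B_in tT)). Qed.
Lemma rho_bpw t : t \in `[0, T] -> bpw Omega M (rho t).
Proof. by move=> tT; exact: (Fh_bpw tri (rho_in tT)). Qed.

Lemma u_field t : t \in `[0, T] -> exists2 C : {set 'I_n} -> 'I_3 -> poly3 R, ispwv (u t) C &
  ae_eq_on Omega (pwfun (fun K => pdivp (C K))) (fun=> 0).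
Proof.
move=> tT; have [C uC Cs] := Udiv_pw tri (u_in tT); exists C => //.
apply: (solenoidal Omega_open Omega_bounded tri (u_in tT) uC Cs) => q.
exact: incompressibility.
Qed.

Lemma rho_curve t : t \in `[0, T] -> exists D, [/\ curve_der M T rho t D, pwpoly M m D,
  L2 Omega (dt Omega T rho t) & ae_eq_on Omega (dt Omega T rho t) D].
Proof.
move=> tT; have [|D [DC DN Dl DE]] := dt_curve Omega_open Omega_bounded tri T_gt0 tT (rho_diff tT) (N := m).
  by move=> r /rho_in[].
by exists D.
Qed.

(** The induction equation makes [Z], the sum of the derivative [D] of [B] and the
    curl [z], orthogonal to all face elements, in particular to [B r] for all [r];
    differentiating, [D] is orthogonal to [Z]. So is the face element [z], hence
    [Z] is zero. As minus a curl, [D] is orthogonal to gradients. *)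
Lemma B_curve t : t \in `[0, T] -> exists D, [/\ curve_derv M T B t D, bpwv Omega M D,
  L2v Omega (dtv Omega T B t), ae_eq_on Omega (dtv Omega T B t) D
  & forall phi, smooth phi -> compactly_supported Omega phi -> innerv Omega D (grad phi) = 0].
Proof.
move=> tT.
have [D [BD Db dL dE]] := dtv_curve Omega_open Omega_bounded tri T_gt0 tT B_diff B_in.
exists D; split=> // phi sphi cphi.
set w := proj_curl Omega M s (fun x => cross (B t x) (u t x)).
have wU : Ucurl Omega M s w by exact: Ucurl_proj_curl.
have [z [zU zE zW]] := curl_in_Udiv Omega_open Omega_bounded tri wU.
have wcL : L2v Omega (wcurl Omega w) := (Ucurl_weak wU).1.
have DL := bpwvL Db; have [[zL _ _] _] := zU.
pose Z x := 1 *: D x + z x.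
have ZL : L2v Omega Z by exact: L2v_lin.
have Zorth (c : 'rV[R]_3 -> 'rV[R]_3) : Udiv Omega M s c -> innerv Omega Z c = 0.
  move=> CU; have [[CL _ _] _] := CU.
  rewrite (innerv_linl Omega_open Omega_bounded)// mul1r -[RHS](induction tT CU) /ah -/w.
  by rewrite (ae_innerv Omega_open dL DL CL dE) [innerv Omega c _]innervC (ae_innerv Omega_open wcL zL CL zE).
have DZ : innerv Omega D Z = 0.
  have BL r : r \in `[0, T] -> L2v Omega (B r) by move=> /B_bpw/bpwvL.
  apply: (wder_uniq T_gt0 tT (curve_innerv Omega_open Omega_bounded tri tT BD DL ZL BL)).
  apply: (@eq_wder _ _ (fun=> 0)) (wder_cst T 0 t) => // r rT.
  by rewrite innervC Zorth//; exact: B_in.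
have Z0 : ae_eq_on Omega Z (fun=> 0).
  apply: (innerv_eq0 Omega_open ZL); rewrite {1}/Z (innerv_linl Omega_open Omega_bounded)//.
  by rewrite DZ mulr0 add0r innervC Zorth.
have gL := L2v_grad Omega_open Omega_bounded sphi.
have := ae_innerv Omega_open ZL (L2v_const Omega_open Omega_bounded 0) gL Z0.
rewrite innerv0l {1}/Z (innerv_linl Omega_open Omega_bounded)// mul1r.
by have [_ ->//] := zW; rewrite inner0l oppr0 addr0.
Qed.

Lemma zero_in : 0 \in `[0, T].
Proof. by rewrite in_itv /= lexx ltW. Qed.

(** The product of [B t] with the gradient of a test function does not depend
    on [t]. *)
Lemma B_weak_div t : t \in `[0, T] -> is_weak_div Omega (B t) (fun=> 0).
Proof.
move=> tT; split; first exact: L2_0.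
move=> phi sphi cphi; rewrite inner0l oppr0.
have gL := L2v_grad Omega_open Omega_bounded sphi.
have BL r : r \in `[0, T] -> L2v Omega (B r) by move=> /B_bpw/bpwvL.
have H r : r \in `[0, T] -> wder T (fun r => innerv Omega (B r) (grad phi)) r 0.
  move=> rT; have [D [BD Db _ _ D0]] := B_curve rT.
  rewrite -(D0 phi sphi cphi).
  exact: (curve_innerv Omega_open Omega_bounded tri rT BD (bpwvL Db) gL BL).
rewrite (wder0_cst H tT zero_in).
have [[_ Be _] _] := B_in zero_in; have [wL wW] := wdivP Be.
have pL : L2 Omega phi by apply: L2_continuous => //; exact: smooth_continuous.
rewrite wW// (ae_inner Omega_open wL (L2_0 Omega_open Omega_bounded) pL divB0).
by rewrite inner0l oppr0.
Qed.

Lemma B_field t : t \in `[0, T] -> exists2 C : {set 'I_n} -> 'I_3 -> poly3 R, ispwv (B t) C &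
  ae_eq_on Omega (pwfun (fun K => pdivp (C K))) (fun=> 0).
Proof.
move=> tT; have [C BC _] := Udiv_pw tri (B_in tT); exists C => //.
by apply/ae_eq_sym/(weak_div_pw Omega_open Omega_bounded tri (B_weak_div tT) BC).
Qed.

Lemma wder_vint0 (f : R -> 'rV[R]_3 -> R) D t : t \in `[0, T] -> curve_der M T f t D ->
  vint Omega D = 0 -> wder T (fun r => vint Omega (f r)) t 0.
Proof. by move=> tT fD D0; have := curve_vint Omega_open Omega_bounded tri tT fD; rewrite D0. Qed.

(** The test function is 1. *)
Lemma mass_conserved t1 t2 : t1 \in `[0, T] -> t2 \in `[0, T] ->
  vint Omega (rho t1) = vint Omega (rho t2).
Proof.
apply: (wder0_cst (c := fun t => vint Omega (rho t))) => t tT.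
have [D [DC DN dL dE]] := rho_curve tT.
have Db := pwpoly_bpw Omega_open Omega_bounded tri DN.
have [C uC _] := u_field tT; have [uH _] := u_in tT.
apply: (wder_vint0 tT DC).
have [d rd] := proj_F_pw Omega_open Omega_bounded tri m (rho_in tT).1.
have F1 := Fh_1 Omega_open Omega_bounded tri m.
have := continuity tT F1.
rewrite (bh_const Omega_open Omega_bounded tri uH uC _ rd) ?addr0.
  by rewrite (ae_inner Omega_open dL Db.1 F1.1 dE) -vint_inner1.
by move=> x xI; rewrite (proj_F_id Omega_open Omega_bounded tri F1).
Qed.

(** The test function is [rho t]. *)
Lemma rho2_conserved t1 t2 : t1 \in `[0, T] -> t2 \in `[0, T] ->
  vint Omega (fun x => rho t1 x ^+ 2) = vint Omega (fun x => rho t2 x ^+ 2).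
Proof.
apply: (wder0_cst (c := fun t => vint Omega (fun x => rho t x ^+ 2))) => t tT.
have [D [DC DN dL dE]] := rho_curve tT.
have Db := pwpoly_bpw Omega_open Omega_bounded tri DN.
have [C uC div0] := u_field tT; have [uH _] := u_in tT.
have rF := rho_in tT; have rb := rho_bpw tT.
have [d rd] := proj_F_pw Omega_open Omega_bounded tri m rF.1.
have DD := curve_derM tri tT DC DC.
have DD2 : curve_der M T (fun r x => rho r x ^+ 2) t (fun x => D x * rho t x + D x * rho t x).
  by apply: eq_curve_der DD => [r rT x xI|x xI]; [rewrite expr2|ring].
apply: (wder_vint0 tT DD2).
have DrL := (bpwM Omega_open Omega_bounded tri Db rb).1.
rewrite (vint_D Omega_open Omega_bounded DrL DrL) -/(inner Omega D (rho t)).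
have A := bh_antisym Omega_open Omega_bounded tri uH uC div0 rd rd.
have := continuity tT rF; rewrite (ae_inner Omega_open dL Db.1 rF.1 dE).
exact: rho2_balance A.
Qed.

Lemma ah_self w v t : t \in `[0, T] -> L2v Omega w -> ah Omega M s w (v t) (v t) = 0.
Proof.
move=> tT wL; rewrite /ah.
have -> : (fun x => cross (v t x) (v t x)) = fun=> 0.
  by apply/funext => x; apply/rowP => a; rewrite !mxE; ring.
have pU : Ucurl Omega M s (proj_curl Omega M s (fun=> 0)) by exact: Ucurl_proj_curl.
rewrite innervC (ae_innerv Omega_open (Ucurl_weak pU).1 (L2v_const Omega_open Omega_bounded 0) wL).
  exact: innerv0l.
exact: wcurl_proj0.
Qed.

(** The product rule for [rho u], and the derivative [Dr] of [rho] to be used along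
    with it. *)
Lemma momentum_curve t : t \in `[0, T] -> exists Dr Du, [/\ curve_der M T rho t Dr, pwpoly M m Dr,
   curve_derv M T u t Du, bpwv Omega M Du
  & (L2 Omega (dt Omega T rho t) /\ ae_eq_on Omega (dt Omega T rho t) Dr) /\
    forall v, bpwv Omega M v -> innerv Omega (dtv Omega T (fun r x => rho r x *: u r x) t) v =
      inner Omega Dr (fun x => dot (u t x) (v x)) + inner Omega (rho t) (fun x => dot (Du x) (v x))].
Proof.
move=> tT; have [Dr [rC rN dL dE]] := rho_curve tT.
have rb := pwpoly_bpw Omega_open Omega_bounded tri rN.
have [Du [uC ub _ _]] := dtv_curve Omega_open Omega_bounded tri T_gt0 tT u_diff u_in.
exists Dr, Du; split=> //; split=> // v vb.
pose E x := Dr x *: u t x + rho t x *: Du x.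
have Eb : bpwv Omega M E.
  move=> a; have := bpwD
    (bpwM Omega_open Omega_bounded tri rb (u_bpw tT a)) (bpwM Omega_open Omega_bounded tri (rho_bpw tT) (ub a)).
  by congr bpw; apply/funext => x; rewrite /component !mxE.
have VD : curve_derv M T (fun r x => rho r x *: u r x) t E.
  move=> a; have := curve_derM tri tT rC (uC a); apply: eq_curve_der.
    by move=> r rT x xI; rewrite /component mxE.
  by move=> x xI; rewrite /component !mxE.
have VL r : r \in `[0, T] -> L2v Omega (fun x => rho r x *: u r x).
  by move=> rT; apply: bpwvL (bpwv_scale Omega_open Omega_bounded tri (rho_bpw rT) (u_bpw rT)).
have [dvL dvE] := dtv_of_curve Omega_open Omega_bounded tri T_gt0 tT VD (bpwvL Eb) VL.
rewrite (ae_innerv Omega_open dvL (bpwvL Eb) (bpwvL vb) dvE).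
have L1 := (bpwM Omega_open Omega_bounded tri rb (bpw_dot Omega_open Omega_bounded tri (u_bpw tT) vb)).1.
have L2' := (bpwM Omega_open Omega_bounded tri (rho_bpw tT) (bpw_dot Omega_open Omega_bounded tri ub vb)).1.
rewrite -[RHS](vint_D Omega_open Omega_bounded L1 L2'); apply: eq_vint => x _.
by rewrite /E dotDl !dotZl.
Qed.

(** The square [dot u u] is not in the space of the density, so the continuity
    equation is tested with its projection; neither [bh] nor the product with the
    derivative of [rho] sees the difference. *)
Lemma energy_conserved t1 t2 : t1 \in `[0, T] -> t2 \in `[0, T] ->
  vint Omega (fun x => rho t1 x * dot (u t1 x) (u t1 x) + dot (B t1 x) (B t1 x))
  = vint Omega (fun x => rho t2 x * dot (u t2 x) (u t2 x) + dot (B t2 x) (B t2 x)).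
Proof.
apply: (wder0_cst (c := fun t =>
  vint Omega (fun x => rho t x * dot (u t x) (u t x) + dot (B t x) (B t x)))) => t tT.
have [Dr [Du [rC rN uC ub [[dL dE] HM]]]] := momentum_curve tT.
have rb := pwpoly_bpw Omega_open Omega_bounded tri rN.
have [DB [BC Bb dBL dBE _]] := B_curve tT.
have uub := u_bpw tT; have BBb := B_bpw tT; have rrb := rho_bpw tT.
have b2b := bpw_dot Omega_open Omega_bounded tri uub uub.
pose f x := Dr x * dot (u t x) (u t x).
pose g x := rho t x * dot (Du x) (u t x).
pose h x := dot (DB x) (B t x).
have E : curve_der M T (fun r x => rho r x * dot (u r x) (u r x) + dot (B r x) (B r x)) t
    (fun x => (f x + (g x + g x)) + (h x + h x)).
  have := curve_derD (curve_derM tri tT rC (curve_dot tri tT uC uC)) (curve_dot tri tT BC BC).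
  apply: eq_curve_der => // x xI; rewrite /f /g /h [dot (u t x) (Du x)]dotC [dot (B t x) (DB x)]dotC.
  by ring.
apply: (wder_vint0 tT E).
have fL : L2 Omega f := (bpwM Omega_open Omega_bounded tri rb b2b).1.
have gL : L2 Omega g :=
  (bpwM Omega_open Omega_bounded tri rrb (bpw_dot Omega_open Omega_bounded tri ub uub)).1.
have hL : L2 Omega h := (bpw_dot Omega_open Omega_bounded tri Bb BBb).1.
have ggL := L2D gL gL; have hhL := L2D hL hL.
rewrite (vint_D Omega_open Omega_bounded (L2D fL ggL) hhL).
rewrite (vint_D Omega_open Omega_bounded fL ggL) (vint_D Omega_open Omega_bounded gL gL).
rewrite (vint_D Omega_open Omega_bounded hL hL).
have [pF pP] := proj_FP Omega_open Omega_bounded tri m b2b.1.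
have [uH _] := u_in tT.
have E1 := momentum tT (u_in tT).
rewrite (HM _ uub) [inner Omega (p t) _]innerC (incompressibility tT (p_in tT)) in E1.
rewrite (@ah_self _ u t tT (bpwvL (bpwv_scale Omega_open Omega_bounded tri rrb uub))) in E1.
have E2 := induction tT (B_in tT).
rewrite (ae_innerv Omega_open dBL (bpwvL Bb) (bpwvL BBb) dBE) in E2.
have E3 := continuity tT pF.
rewrite (bh_proj Omega_open Omega_bounded tri m b2b.1 uH uub (rho_in tT).1) in E3.
have E4 : inner Omega (dt Omega T rho t) (proj_F Omega M m (b2 t)) = vint Omega f.
  rewrite (ae_inner Omega_open dL rb.1 pF.1 dE).
  have DrF : Fh Omega M m Dr by exact: pwpoly_Fh.
  have := pP _ DrF; rewrite (innerBl Omega_open)//; [|exact: b2b.1|exact: pF.1|exact: rb.1].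
  by rewrite innerC [inner Omega (proj_F _ _ _ _) _]innerC => /eqP; rewrite subr_eq0 => /eqP <-.
rewrite E4 in E3.
exact: (energy_balance E1 E2 E3).
Qed.

(** The test functions are [B t] in the momentum equation and [u t] in the
    induction equation. *)
Lemma helicity_conserved : (forall t, t \in `[0, T] -> ae_eq_on Omega (rho t) (fun=> 1)) ->
  forall t1 t2, t1 \in `[0, T] -> t2 \in `[0, T] ->
  vint Omega (fun x => dot (u t1 x) (B t1 x)) = vint Omega (fun x => dot (u t2 x) (B t2 x)).
Proof.
move=> rho1; have r1 t x : t \in `[0, T] -> inter M x -> rho t x = 1.
  move=> tT; have F1 := Fh_1 Omega_open Omega_bounded tri m.
  exact: (Fh_eq tri (rho_in tT) F1 (rho1 t tT)).
move=> t1 t2; apply: (wder0_cst (c := fun t => vint Omega (fun x => dot (u t x) (B t x)))) => t tT.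
have [Du [uC ub _ _]] := dtv_curve Omega_open Omega_bounded tri T_gt0 tT u_diff u_in.
have [DB [BC Bb dBL dBE _]] := B_curve tT.
have uub := u_bpw tT; have BBb := B_bpw tT; have rrb := rho_bpw tT.
have b2b := bpw_dot Omega_open Omega_bounded tri uub uub.
apply: (wder_vint0 tT (curve_dot tri tT uC BC)).
rewrite (vint_D Omega_open Omega_bounded (bpw_dot Omega_open Omega_bounded tri ub BBb).1
  (bpw_dot Omega_open Omega_bounded tri uub Bb).1).
pose ru r x := rho r x *: u r x.
have VD : curve_derv M T ru t Du.
  move=> a; apply: eq_curve_der (uC a) => // r rT x xI.
  by rewrite /component mxE r1// mul1r.
have VL r : r \in `[0, T] -> L2v Omega (ru r).
  by move=> rT; apply: bpwvL (bpwv_scale Omega_open Omega_bounded tri (rho_bpw rT) (u_bpw rT)).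
have [dvL dvE] := dtv_of_curve Omega_open Omega_bounded tri T_gt0 tT VD (bpwvL ub) VL.
have ruE : ae_eq_on Omega (ru t) (u t).
  by apply: (inter_ae Omega_open tri) => z zI; rewrite /ru r1// scale1r.
have E1 := momentum tT (B_in tT).
rewrite (ae_innerv Omega_open dvL (bpwvL ub) (bpwvL BBb) dvE) in E1.
rewrite (@ah_self _ B t tT (bpwvL BBb)) in E1.
have [BH _] := B_in tT; have [_ Be _] := BH; have wB := wdivP Be; have [wL _] := wB.
have wB0 := weak_div_uniq Omega_open Omega_bounded wB (B_weak_div tT).
have [pL _ _] := p_in tT.
rewrite [inner Omega (p t) _]innerC (ae_inner Omega_open wL (L2_0 Omega_open Omega_bounded) pL wB0) in E1.
rewrite inner0l in E1.
have [c Bc divB] := B_field tT.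
have [d rd] := proj_F_pw Omega_open Omega_bounded tri m (rho_in tT).1.
have [e be] := proj_F_pw Omega_open Omega_bounded tri m b2b.1.
have A := bh_antisym Omega_open Omega_bounded tri BH Bc divB be rd.
rewrite (bh_const Omega_open Omega_bounded tri BH Bc _ be) in A; last first.
  by move=> x xI; rewrite (proj_F_id Omega_open Omega_bounded tri (rho_in tT))// r1.
have E2 := induction tT (u_in tT).
rewrite (ae_innerv Omega_open dBL (bpwvL Bb) (bpwvL uub) dBE) in E2.
have fL := bpwvL (bpwv_cross Omega_open Omega_bounded tri uub BBb).
set w := proj_curl Omega M s (fun x => cross (u t x) (B t x)).
have wU : Ucurl Omega M s w by exact: Ucurl_proj_curl.
have wcL : L2v Omega (wcurl Omega w) := (Ucurl_weak wU).1.
have E3 : ah Omega M s (ru t) (u t) (B t) = innerv Omega (u t) (wcurl Omega w).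
  exact: (ae_innerv Omega_open (VL t tT) (bpwvL uub) wcL ruE).
have E4 : ah Omega M s (u t) (B t) (u t) = - innerv Omega (u t) (wcurl Omega w).
  have U' : Ucurl Omega M s (proj_curl Omega M s (fun x => - cross (u t x) (B t x))).
    exact: Ucurl_proj_curl.
  have crossN : (fun x => cross (B t x) (u t x)) = fun x => - cross (u t x) (B t x).
    by apply/funext => x; apply/rowP => a; rewrite !mxE; ring.
  have wN := wcurl_projN Omega_open Omega_bounded tri s fL.
  have wNL : L2v Omega (fun x => - wcurl Omega w x) by exact: L2vN.
  have -> : ah Omega M s (u t) (B t) (u t) =
      innerv Omega (u t) (wcurl Omega (proj_curl Omega M s (fun x => - cross (u t x) (B t x)))).
    exact: (congr1 (fun f => innerv Omega (u t) (wcurl Omega (proj_curl Omega M s f))) crossN).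
  have E5 := ae_innerv Omega_open (Ucurl_weak U').1 wNL (bpwvL uub) wN.
  have E6 := innervNl Omega_open Omega_bounded wcL (bpwvL uub).
  apply: (etrans (innervC Omega _ _)); apply: (etrans E5); apply: (etrans E6).
  by congr (- _); exact: innervC.
rewrite E4 in E2; rewrite -/(ru t) E3 in E1.
rewrite [innerv Omega DB _]innervC in E2.
exact: (helicity_balance E1 E2 A).
Qed.

End Conservation.

Theorem proposition3p2 (R : realType) (Omega : set 'rV[R]_3) (M : mesh R)
    (s m : nat) (T : R)
    (u B : R -> 'rV[R]_3 -> 'rV[R]_3) (rho p : R -> 'rV[R]_3 -> R)
    (Omega_open : open Omega) (Omega_connected : connected Omega)
    (Omega_neq0 : Omega !=set0) (Omega_bounded : bounded_set Omega)
    (M_triangulation : triangulation M Omega)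
    (T_gt0 : 0 < T)
    (u_in : forall t, t \in `[0, T] -> Udiv Omega M s (u t))
    (B_in : forall t, t \in `[0, T] -> Udiv Omega M s (B t))
    (rho_in : forall t, t \in `[0, T] -> Fh Omega M m (rho t))
    (p_in : forall t, t \in `[0, T] -> Qh Omega M s (p t))
    (u_diff : time_differentiablev Omega T u)
    (B_diff : time_differentiablev Omega T B)
    (rho_diff : time_differentiable Omega T rho)
    (divB0 : ae_eq_on Omega (wdiv Omega (B 0)) (fun=> 0))
    (momentum : forall t, t \in `[0, T] -> forall v, Udiv Omega M s v ->
       innerv Omega (dtv Omega T (fun r x => rho r x *: u r x) t) v
       + ah Omega M s (fun x => rho t x *: u t x) (u t) v
       - ah Omega M s (B t) (B t) v
       + 2^-1 * bh Omega M m (fun x => dot (u t x) (u t x)) (rho t) v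
       = inner Omega (p t) (wdiv Omega v))
    (induction : forall t, t \in `[0, T] -> forall C, Udiv Omega M s C ->
       innerv Omega (dtv Omega T B t) C + ah Omega M s C (B t) (u t) = 0)
    (continuity : forall t, t \in `[0, T] -> forall sigma, Fh Omega M m sigma ->
       inner Omega (dt Omega T rho t) sigma
       + bh Omega M m sigma (rho t) (u t) = 0)
    (incompressibility : forall t, t \in `[0, T] -> forall q, Qh Omega M s q ->
       inner Omega (wdiv Omega (u t)) q = 0) :
  [/\ forall t1 t2, t1 \in `[0, T] -> t2 \in `[0, T] ->
        vint Omega (rho t1) = vint Omega (rho t2),
      forall t1 t2, t1 \in `[0, T] -> t2 \in `[0, T] ->
        vint Omega (fun x => rho t1 x ^+ 2) = vint Omega (fun x => rho t2 x ^+ 2),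
      forall t1 t2, t1 \in `[0, T] -> t2 \in `[0, T] ->
        vint Omega (fun x => rho t1 x * dot (u t1 x) (u t1 x)
                             + dot (B t1 x) (B t1 x))
        = vint Omega (fun x => rho t2 x * dot (u t2 x) (u t2 x)
                               + dot (B t2 x) (B t2 x))
    & (forall t, t \in `[0, T] -> ae_eq_on Omega (rho t) (fun=> 1)) ->
      forall t1 t2, t1 \in `[0, T] -> t2 \in `[0, T] ->
        vint Omega (fun x => dot (u t1 x) (B t1 x))
        = vint Omega (fun x => dot (u t2 x) (B t2 x))].
Proof.
split.
- exact: (mass_conserved Omega_open Omega_bounded M_triangulation T_gt0 u_in rho_in
    rho_diff continuity incompressibility).
- exact: (rho2_conserved Omega_open Omega_bounded M_triangulation T_gt0 u_in rho_in
    rho_diff continuity incompressibility).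
- exact: (energy_conserved Omega_open Omega_bounded M_triangulation T_gt0 u_in B_in rho_in p_in
    u_diff B_diff rho_diff momentum induction continuity incompressibility).
- exact: (helicity_conserved Omega_open Omega_bounded M_triangulation T_gt0 u_in B_in rho_in p_in
    u_diff B_diff divB0 momentum induction).
Qed.
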